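(* Let $\nu\in(0,1)$ and $c_\nu=\nu^2-\frac14$. For any $f^0\in D((A_\nu)^{1/2})'$ and any $T>0$, there exists a control $u\in L^2(0,T)$ such that the corresponding solution $f\in C^0([0,T],D((A_\nu)^{1/2})')$ of $$\begin{cases}\partial_t f-\partial_{xx}f+\dfrac{c_\nu}{x^2}f+f=0, & (t,x)\in(0,T)\times(-1,1),\\ f(t,-1)=0,\quad f(t,1)=u(t),& t\in(0,T),\\ f(0,x)=f^0(x),& x\in(-1,1),\end{cases}$$ satisfies $f(T)=0$ in $D((A_\nu)^{1/2})'$.
   Context: Functions are real-valued. For $\nu\in(0,1)$ put $c_\nu=\nu^2-\frac14$. Let $\tilde H^2_0(-1,1)=\{f\in H^2(-1,1): f(0)=f'(0)=0\}$ and let $\mathcal F_s^\nu$ be the set of functions of the form $f(x)=c_1^-|x|^{\nu+1/2}+c_2^-|x|^{-\nu+1/2}$ on $(-1,0)$ and $f(x)=c_1^+|x|^{\nu+1/2}+c_2^+|x|^{-\nu+1/2}$ on $(0,1)$, with $c_1^\pm,c_2^\pm\in\mathbb R$. The sum $\tilde H^2_0(-1,1)+\mathcal F^\nu_s$ is direct. The domain $D(A_\nu)$ is the set of $f=f_r+f_s$ with $f_r\in\tilde H_0^2(-1,1)$, $f_s\in\mathcal F_s^\nu$, $f(-1)=f(1)=0$, $c_1^-+c_2^-+c_1^++c_2^+=0$ and $(\nu+\frac12)c_1^-+(-\nu+\frac12)c_2^-=(\nu+\frac12)c_1^++(-\nu+\frac12)c_2^+$. The operator is $A_\nu f=-\partial_{xx}f+\frac{c_\nu}{x^2}f$,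 where $\partial_{xx}$ is taken separately on $(-1,0)$ and $(0,1)$ (so $A_\nu f_s=0$). It is known that $(A_\nu,D(A_\nu))$ is a densely defined, non-negative self-adjoint operator on $L^2(-1,1)$. It has compact resolvent and simple eigenvalues $0=\lambda_0<\lambda_1<\lambda_2<\cdots$, with an associated Hilbert basis $(\phi_n)_{n\ge0}$ of $L^2(-1,1)$ made of eigenfunctions. For $s\in\mathbb R$, $D((A_\nu)^s)$ carries the Hilbert norm $\|f\|_s^2=\sum_{n\ge0}(\lambda_n+1)^{2s}|\langle f,\phi_n\rangle|^2$, and $D((A_\nu)^{1/2})'=D((A_\nu)^{-1/2})$, with duality extending the $L^2(-1,1)$ scalar product (pivot space $L^2(-1,1)$). The solution of the boundary control problem is the (unique) weak solution $f\in C^0([0,T],D((A_\nu)^{1/2})')$, i.e. the one associated with the admissible scalar control operator $b$ given by $\langle b,\phi_n\rangle=-\phi_n'(1)$; in coordinates, for every $n\ge0$ and $t\in[0,T]$, $$\langle f(t),\phi_n\rangle=e^{-(\lambda_n+1)t}\langle f^0,\phi_n\rangle-\phi_n'(1)\int_0^te^{-(\lambda_n+1)(t-s)}u(s)\,\mathrm ds.$$ *)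

(* Defs.v *)
From HB Require Import structures.
From mathcomp Require Import all_boot all_order all_algebra.
From mathcomp Require Import all_classical all_reals all_analysis.

Set Implicit Arguments.
Unset Strict Implicit.
Unset Printing Implicit Defensive.

Import Order.TTheory GRing.Theory Num.Theory.
Import numFieldNormedType.Exports.

Local Open Scope classical_set_scope.
Local Open Scope ring_scope.

(** Functions on an interval are total functions [R -> R] whose values outside
    that interval are irrelevant. *)

Definition L2 (R : realType) (a b : R) (f : R -> R) : Prop :=
  (f \_ `]a, b[) \in Lfun (@lebesgue_measure R) 2%:E.

Definition inner (R : realType) (a b : R) (f g : R -> R) : R :=
  \int[lebesgue_measure]_(x in `]a, b[) (f x * g x).

Definition test_function (R : realType) (a b : R) (p : R -> R) : Prop :=
  [/\ forall x, derivable p x 1,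
      continuous (derive1 p)
    & exists c d, [/\ a < c, d < b & forall x, x \notin `[c, d] -> p x = 0]].

(** Local integrability is required so that the two integrals, which the
    library totalizes, are meaningful. *)
Definition weak_derivative (R : realType) (a b : R) (f g : R -> R) : Prop :=
  [/\ locally_integrable (`]a, b[ : set R) f,
      locally_integrable (`]a, b[ : set R) g
    & forall p, test_function a b p -> inner a b f (derive1 p) = - inner a b g p].

Definition weak_derivative2 (R : realType) (a b : R) (f g : R -> R) : Prop :=
  exists2 f1, weak_derivative a b f f1 & weak_derivative a b f1 g.

Definition H2 (R : realType) (a b : R) (f : R -> R) : Prop :=
  L2 a b f /\
  exists f1 f2, [/\ L2 a b f1, L2 a b f2,
    weak_derivative a b f f1 & weak_derivative a b f1 f2].

(** Continuity selects the representative of [f] in [C^1([-1, 1])], which gives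
    a meaning to the pointwise values [f 0], [f' 0], [f (-1)] and [f 1]. *)
Definition H2tilde0 (R : realType) (f : R -> R) : Prop :=
  [/\ H2 (-1) 1 f, {within `[-1, 1], continuous f},
      f 0 = 0 & is_derive (0 : R) 1 f 0].

Definition singular (R : realType) (nu cm1 cm2 cp1 cp2 : R) (x : R) : R :=
  if x < 0 then cm1 * `|x| `^ (nu + 2^-1) + cm2 * `|x| `^ (- nu + 2^-1)
  else cp1 * `|x| `^ (nu + 2^-1) + cp2 * `|x| `^ (- nu + 2^-1).

(** The equality [f = f_r + f_s] is imposed on [[-1, 1] \ {0}]: elements of the
    domain are given by the representative that is continuous there, so that
    boundary values and the derivative at [1] can be read pointwise. *)
Definition domA (R : realType) (nu : R) (f : R -> R) : Prop :=
  exists fr cm1 cm2 cp1 cp2,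
  [/\ H2tilde0 fr,
      forall x, x \in `[-1, 1] -> x != 0 ->
        f x = fr x + singular nu cm1 cm2 cp1 cp2 x,
      f (-1) = 0 /\ f 1 = 0,
      cm1 + cm2 + cp1 + cp2 = 0
    & (nu + 2^-1) * cm1 + (- nu + 2^-1) * cm2 =
      (nu + 2^-1) * cp1 + (- nu + 2^-1) * cp2].

Definition cpot (R : realType) (nu : R) : R := nu ^+ 2 - 4^-1.

(** [opA nu f g] means that [f] is in the domain and [A_nu f = g] in
    [L^2(-1, 1)]. *)
Definition opA (R : realType) (nu : R) (f g : R -> R) : Prop :=
  [/\ domA nu f, L2 (-1) 1 g
    & exists w, [/\ weak_derivative2 (-1) 0 f w, weak_derivative2 0 1 f w
      & g = (fun x => - w x + cpot nu / x ^+ 2 * f x)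
          %[ae lebesgue_measure in `](-1 : R), 1[%classic]]].

Definition hilbert_basis (R : realType) (a b : R) (phi : nat -> R -> R) : Prop :=
  [/\ forall n, L2 a b (phi n),
      forall m n, inner a b (phi m) (phi n) = (m == n)%:R
    & forall g, L2 a b g ->
        (fun N => let r x := g x - \sum_(k < N) inner a b g (phi k) * phi k x in
                  inner a b r r) @ \oo --> (0 : R)].

Definition eigenbasis (R : realType) (nu : R) (lam : nat -> R)
    (phi : nat -> R -> R) : Prop :=
  [/\ lam 0%N = 0,
      forall n, lam n < lam n.+1,
      forall n, opA nu (phi n) (fun x => lam n * phi n x)
    & hilbert_basis (-1) 1 phi].

Definition coord (R : realType) (phi : nat -> R -> R) (g : R -> R) (n : nat) : R :=
  inner (-1) 1 g (phi n).

(** Square of the norm of [D(A^s)], as a function of the coordinates. *)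
Definition sqnorm (R : realType) (lam : nat -> R) (s : R) (a : nat -> R) : \bar R :=
  (\sum_(0 <= n <oo) ((lam n + 1) `^ (2 * s) * `|a n| ^+ 2)%:E)%E.

(** [D(A^s)] as a subspace of [L^2(-1, 1)], that is, for [0 <= s]. *)
Definition domApow (R : realType) (lam : nat -> R) (phi : nat -> R -> R) (s : R)
    (g : R -> R) : Prop :=
  L2 (-1) 1 g /\ (sqnorm lam s (coord phi g) < +oo)%E.

(** Continuous linear forms on [D(A^(1/2))]; the norm bound makes them
    insensitive to modifications of [g] on a null set.  Since [L^2(-1, 1)] is
    the pivot space, the bracket of [F] with [phi n] is [F (phi n)]. *)
Definition dual_half (R : realType) (lam : nat -> R) (phi : nat -> R -> R)
    (F : (R -> R) -> R) : Prop :=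
  (forall (k : R) (g h : R -> R),
     domApow lam phi 2^-1 g -> domApow lam phi 2^-1 h ->
     F (fun x => k * g x + h x) = k * F g + F h) /\
  exists C : R, forall g, domApow lam phi 2^-1 g ->
    ((`|F g| ^+ 2)%:E <= C%:E * sqnorm lam 2^-1 (coord phi g))%E.

Definition dual_eq0 (R : realType) (lam : nat -> R) (phi : nat -> R -> R)
    (F : (R -> R) -> R) : Prop :=
  forall g, domApow lam phi 2^-1 g -> F g = 0.

Definition dual_continuous (R : realType) (lam : nat -> R) (phi : nat -> R -> R)
    (T : R) (f : R -> (R -> R) -> R) : Prop :=
  forall t, t \in `[0, T] ->
    sqnorm lam (- 2^-1) (fun n => f s (phi n) - f t (phi n))
      @[s --> within `[0, T] (nbhs t)] --> (0 : \bar R)%E.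

Definition left_derivative (R : realType) (f : R -> R) (x : R) : R :=
  lim ((f (x + h) - f x) / h @[h --> (0 : R)^'-]).

(** Coordinates of the control operator [b] of the Dirichlet control at [1]. *)
Definition control_coord (R : realType) (phi : nat -> R -> R) (n : nat) : R :=
  - left_derivative (phi n) 1.

Definition weak_solution (R : realType) (lam : nat -> R) (phi : nat -> R -> R)
    (T : R) (f0 : (R -> R) -> R) (u : R -> R) (f : R -> (R -> R) -> R) : Prop :=
  [/\ forall t, t \in `[0, T] -> dual_half lam phi (f t),
      dual_continuous lam phi T f
    & forall n t, t \in `[0, T] ->
        f t (phi n) = expR (- (lam n + 1) * t) * f0 (phi n)
          + control_coord phi n *
            \int[lebesgue_measure]_(s in `[0, t])
               (expR (- (lam n + 1) * (t - s)) * u s)].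

(* Main.v *)
(** The eigenvalues are zeros of an entire function [P] of order 1/2, the product of
    the characteristic functions of the even and odd matching conditions, whose Taylor
    coefficients come from Bessel series.  The Wronskian of an eigenfunction with its
    derivative in the spectral parameter gives [|P'(lam n)| (phi n)'(1)^2 >= 2 nu^2],
    with no asymptotics of eigenvalues.  Given a Gevrey bump [rho] of order 3/2
    supported in [[T/2, T]], the functions
    [theta_m(t) = exp(-mu_m t) * \sum_j (-1)^j P^(j+1)(lam m) / (j+1)! * rho^(j)(t)],
    [mu_m = lam m + 1], are biorthogonal up to constants to the exponentials
    [exp(mu_n t)]: integrating by parts turns the series into
    [(P(lam n) - P(lam m)) / (lam n - lam m)].  The moment problem is solved by
    [\sum_m alpha_m theta_m], which converges because [theta_m] vanishes before [T/2]
    and [P] grows subexponentially in [lam]. *)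

From mathcomp Require Import all_boot all_order all_algebra.
From mathcomp Require Import all_classical all_reals all_analysis.
From mathcomp Require Import measurable_realfun.
From mathcomp Require Import ring lra.
Require Import Defs.

Set Implicit Arguments.
Unset Strict Implicit.
Unset Printing Implicit Defensive.

Import Order.TTheory GRing.Theory Num.Theory.
Import numFieldNormedType.Exports.
Local Open Scope classical_set_scope.
Local Open Scope ring_scope.

(** * Power series with coefficients bounded by [A * M ^ k / k!^2] *)

(** The orders are tied. P^(j) / j! is of size M^j / j!^2 and rho^(j) of size D^j j!^(3/2), so the
    series for theta_m converges like j!^(-1/2); Gevrey order 2 would be borderline, and order 1
    excludes compact support. Both parities go into one P because a single control acts on all
    modes. Growth is always used as exp(1/e + e M |x|) with [e] free, which avoids square roots.
    Summability over modes rests on one fact: with beta_n = phi_n'(1), the sequence beta_n / mu_n is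
    square summable, by Bessel's inequality. The factor beta_n^2 is inserted into estimates at the
    price exp(e mu_n), thanks to the lower bound 2 nu^2 and the growth of P'. The other obstacle is
    that eigenfunctions are only weak solutions with a regular part f_r in H^2, so their Bessel form
    has to be derived. The conditions f_r(0) = f_r'(0) = 0 identify the singular coefficients when
    nu <= 1/2. For nu > 1/2 the power |x|^(nu + 1/2) satisfies them too, and is excluded only
    because its second derivative is not square integrable. *)

Section Series.
Context {R : realType}.
Implicit Types (u v l b : R^nat).

Lemma series_dominated u v : (forall k, `|u k| <= v k) -> cvgn (series v) ->
  cvgn (series u) /\ `|limn (series u)| <= limn (series v).
Proof.
move=> uv cv.
have cn : cvgn [normed series u].
  apply: series_le_cvg cv; [by move=> n; rewrite /= | |exact: uv].
  by move=> n; exact: le_trans (normr_ge0 _) (uv n).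
split; first exact: normed_cvg.
apply: le_trans (lim_series_norm cn) _.
exact: lim_series_le.
Qed.

Lemma cvg_sum0 (a : nat -> R^nat) l J :
  (forall j, a N j @[N --> \oo] --> l j) ->
  (\sum_(0 <= j < J) `|a N j - l j|) @[N --> \oo] --> (0 : R).
Proof.
move=> al; elim: J => [|J IH].
  under eq_fun do rewrite big_nil.
  exact: cvg_cst.
under eq_fun do rewrite big_nat_recr//=.
have : a N J - l J @[N --> \oo] --> (0 : R).
  by rewrite -(subrr (l J)); apply: cvgB => //; exact: cvg_cst.
by move=> /(norm_cvg0P _).2/(cvgD IH); rewrite addr0.
Qed.

(** Dominated convergence for sums whose range grows with the parameter: finitely many terms
    converge, and the tails of both sums are controlled by the tail of [b]. *)
Lemma tannery (a : nat -> R^nat) l b :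
  (forall N j, (j < N)%N -> `|a N j| <= b j) ->
  (forall j, a N j @[N --> \oo] --> l j) ->
  cvgn (series b) ->
  \sum_(0 <= j < N) a N j @[N --> \oo] --> limn (series l).
Proof.
move=> ab al cb.
have lb j : `|l j| <= b j.
  have : `|a N j| @[N --> \oo] --> `|l j| by apply: cvg_norm.
  move=> nl; rewrite -(cvg_lim _ nl)//; apply: limr_le; first exact: cvgP nl.
  by near=> N; apply: ab; near: N; exact: nbhs_infty_gt.
have [cl _] := series_dominated lb cb.
apply: cvg_sub0 cl; apply/cvgrPdist_le => e e0.
have e4 : 0 < e / 4 by rewrite divr_gt0.
have /cauchy_cvgP/cauchy_seriesP/(_ _ e4) := cb.
move=> [[P Q] /= [[J1 _ HP] [J2 _ HQ]] PQ].
pose J := maxn J1 J2.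
have tail N : (J <= N)%N -> \sum_(J <= k < N) b k <= e / 4.
  move=> JN; apply: ltW; apply: le_lt_trans (ler_norm _) _.
  apply: (PQ (J, N)); split; [apply: HP|apply: HQ] => /=.
    exact: leq_maxl.
  by apply: leq_trans JN; exact: leq_maxr.
have := cvg_sum0 J al => /cvgrPdist_le/(_ _ e4) aJ.
near=> N.
have JN : (J <= N)%N by near: N; exact: nbhs_infty_ge.
rewrite sub0r normrN /= /series /= -[X in `|X|]/(\sum_(0 <= j < N) a N j - \sum_(0 <= j < N) l j).
rewrite -sumrB (@big_cat_nat _ _ _ J) //=.
have h1 : \sum_(0 <= j < J) `|a N j - l j| <= e / 4.
  have : `|0 - \sum_(0 <= j < J) `|a N j - l j| | <= e / 4 by near: N; exact: aJ.
  by rewrite sub0r normrN ger0_norm// sumr_ge0.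
have h2 : `|\sum_(J <= j < N) (a N j - l j)| <= 2 * (e / 4).
  apply: le_trans (ler_norm_sum _ _ _) _.
  apply: (@le_trans _ _ (\sum_(J <= j < N) (b j *+ 2))).
    rewrite big_seq [leRHS]big_seq; apply: ler_sum => j.
    rewrite mem_index_iota => /andP[_ jN].
    by apply: le_trans (ler_normB _ _) _; rewrite mulr2n lerD// ab.
  by rewrite sumrMnl -[leLHS]mulr_natl ler_pM2l// tail.
apply: le_trans (ler_normD _ _) _.
have : `|\sum_(0 <= j < J) (a N j - l j)| <= e / 4.
  by apply: le_trans h1; exact: ler_norm_sum.
move: h2; lra.
Unshelve. all: by end_near. Qed.

Lemma exp_term_le (x : R) k : 0 <= x -> x ^+ k / k`!%:R <= expR x.
Proof.
move=> x0; rewrite /expR.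
apply: le_trans (nondecreasing_cvgn_le _ (is_cvg_series_exp_coeff x) k.+1).
  rewrite /series /= big_nat_recr //= lerDr sumr_ge0// => i _.
  exact: exp_coeff_ge0.
apply: nondecreasing_series => n _ _; exact: exp_coeff_ge0.
Qed.

End Series.

Section PowerSeries.
Context {R : realType}.
Implicit Types (c d : R^nat) (x y A M e : R).

Definition psum c x : R := limn (pseries c x).

(** Such coefficients define entire functions of order at most 1/2. The class is stable under
    differentiation and re-expansion with the same [M], and under products with [4 * M]. *)
Definition fact2_bound A M c := forall k, `|c k| <= A * (M ^+ k / k`!%:R ^+ 2).

Lemma fact2_bound_ge0 A M c : fact2_bound A M c -> 0 <= A.
Proof.
by move=> /(_ 0%N); rewrite expr0 expr1n divr1 mulr1; exact: le_trans.
Qed.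

(** One factorial is spent on [e^-1 ^+ k / k! <= expR e^-1]; the other leaves an exponential series
    of arbitrarily small rate [e]. *)
Lemma fact2_term_le A M c x e k : fact2_bound A M c -> 0 <= M -> 0 < e ->
  `|c k * x ^+ k| <= A * expR e^-1 * exp_coeff (e * (M * `|x|)) k.
Proof.
move=> cb M0 e0; rewrite normrM normrX.
have A0 := fact2_bound_ge0 cb.
apply: (@le_trans _ _ (A * (M ^+ k / k`!%:R ^+ 2) * `|x| ^+ k)).
  by rewrite ler_wpM2r// exprn_ge0.
have ek : e^-1 ^+ k * e ^+ k = 1 by rewrite -exprMn mulVf ?expr1n// gt_eqF.
have -> : A * (M ^+ k / k`!%:R ^+ 2) * `|x| ^+ k =
   A * (e^-1 ^+ k / k`!%:R) * exp_coeff (e * (M * `|x|)) k.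
  rewrite exp_coeffE !exprMn; rewrite -[LHS]mulr1 -ek expr2 invfM.
  set a := _^-1; ring.
apply: ler_wpM2r; first by rewrite exp_coeff_ge0// !mulr_ge0// ltW.
by rewrite ler_wpM2l// exp_term_le// invr_ge0 ltW.
Qed.

Lemma fact2_cvg A M c x : fact2_bound A M c -> 0 <= M -> cvgn (pseries c x).
Proof.
move=> cb M0.
pose v := A * expR 1^-1 *: exp_coeff (1 * (M * `|x|)).
have := @series_dominated _ (fun k => c k * x ^+ k) v.
case => // [k|]; first exact: fact2_term_le.
exact: is_cvg_seriesZ (is_cvg_series_exp_coeff _).
Qed.

Lemma fact2_psum_le A M c x e : fact2_bound A M c -> 0 <= M -> 0 < e ->
  `|psum c x| <= A * expR e^-1 * expR (e * (M * `|x|)).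
Proof.
move=> cb M0 e0.
have ce := is_cvg_series_exp_coeff (e * (M * `|x|)).
have [] := @series_dominated _ (fun k => c k * x ^+ k)
   (A * expR e^-1 *: exp_coeff (e * (M * `|x|))).
- by move=> k; exact: fact2_term_le.
- exact: is_cvg_seriesZ.
- by move=> _; rewrite lim_seriesZ.
Qed.

Lemma fact2_bound_diffs A M c : fact2_bound A M c -> 0 <= M ->
  fact2_bound (A * M) M (pseries_diffs c).
Proof.
move=> cb M0 k; rewrite /pseries_diffs normrM ger0_norm//.
have A0 := fact2_bound_ge0 cb.
apply: le_trans (ler_wpM2l (ler0n _ _) (cb k.+1)) _.
rewrite factS natrM exprS.
have k0 : k`!%:R != 0 :> R by rewrite pnatr_eq0 -lt0n fact_gt0.
have -> : k.+1%:R * (A * (M * M ^+ k / (k.+1%:R * k`!%:R) ^+ 2)) =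
   A * M * (M ^+ k / k`!%:R ^+ 2) * (k.+1%:R)^-1 :> R.
  by field; rewrite k0 nat1r pnatr_eq0.
apply: ler_piMr; last by rewrite invf_le1// ler1n.
by rewrite !mulr_ge0// ?divr_ge0// exprn_ge0.
Qed.

Lemma psum_is_derive A M c x : fact2_bound A M c -> 0 <= M ->
  is_derive x 1 (psum c) (psum (pseries_diffs c) x).
Proof.
move=> cb M0.
have cb1 := fact2_bound_diffs cb M0.
have cb2 := fact2_bound_diffs cb1 M0.
apply: (@pseries_snd_diffs _ c (`|x| + 1)).
- exact: fact2_cvg cb M0.
- exact: fact2_cvg cb1 M0.
- exact: fact2_cvg cb2 M0.
- by rewrite [ltRHS]ger0_norm ?addr_ge0// ltrDl.
Qed.

Lemma psum0 c : psum c 0 = c 0%N.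
Proof.
apply/cvg_lim => //; rewrite -(cvg_shiftn 1) /=.
rewrite (_ : (fun n => _) = cst (c 0%N)); first exact: cvg_cst.
apply/funext => n; rewrite /pseries /series /= addn1 big_nat_recl//= expr0 mulr1.
by rewrite big1 ?addr0// => i _; rewrite expr0n mulr0.
Qed.

Lemma psumD A1 A2 M1 M2 c d x : fact2_bound A1 M1 c -> fact2_bound A2 M2 d ->
  0 <= M1 -> 0 <= M2 ->
  psum (fun k => c k + d k) x = psum c x + psum d x.
Proof.
move=> cb db M10 M20; rewrite /psum /pseries.
rewrite -(lim_seriesD (fact2_cvg (x := x) cb M10) (fact2_cvg (x := x) db M20)).
congr (limn _); congr (series _).
by apply/funext => k /=; rewrite mulrDl.
Qed.

Lemma psumZ A M c x a : fact2_bound A M c -> 0 <= M ->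
  psum (fun k => a * c k) x = a * psum c x.
Proof.
move=> cb M0; rewrite /psum /pseries.
rewrite -[RHS]/(a *: _) -lim_seriesZ; last exact: fact2_cvg cb M0.
congr (limn _); congr (series _).
by apply/funext => k; rewrite /= -mulrA.
Qed.

Lemma pseries_shift_cvg c x : c 0%N = 0 -> cvgn (pseries (fun k => c k.+1) x) ->
  pseries c x n @[n --> \oo] --> x * psum (fun k => c k.+1) x.
Proof.
move=> c0 cc; rewrite -(cvg_shiftn 1) /=.
rewrite (_ : (fun n => _) = (fun n => x * pseries (fun k => c k.+1) x n)).
  exact: cvgMr.
apply/funext => n; rewrite /pseries /series /= addn1 big_nat_recl//= c0 mul0r add0r.
by rewrite mulr_sumr; apply: eq_bigr => i _; rewrite exprS mulrCA.
Qed.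

(** The [j]-th derivative at [x] divided by [j!], written as a power series so that the same bounds
    apply to it. *)
Definition taylor_coef c x : R^nat :=
  fun j => psum (fun i => 'C(i + j, j)%:R * c (i + j)%N) x.

(** The square of [(i + j)!] contains two binomials: one cancels the binomial of the coefficient,
    the other is at least 1. *)
Lemma fact2_bound_binom A M c j : fact2_bound A M c -> 0 <= M ->
  fact2_bound (A * (M ^+ j / j`!%:R ^+ 2)) M
    (fun i => 'C(i + j, j)%:R * c (i + j)%N).
Proof.
move=> cb M0 i; rewrite normrM ger0_norm//.
have A0 := fact2_bound_ge0 cb.
apply: le_trans (ler_wpM2l (ler0n _ _) (cb _)) _.
have := bin_fact (leq_addl i j); rewrite addnK => H.
rewrite -H !natrM.
have b0 : 'C(i + j, j)%:R != 0 :> R by rewrite pnatr_eq0 -lt0n bin_gt0 leq_addl.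
have k0 k : k`!%:R != 0 :> R by rewrite pnatr_eq0 -lt0n fact_gt0.
have -> : 'C(i + j, j)%:R *
    (A * (M ^+ (i + j) / ('C(i + j, j)%:R * (j`!%:R * i`!%:R)) ^+ 2)) =
   A * (M ^+ j / j`!%:R ^+ 2) * (M ^+ i / i`!%:R ^+ 2) * ('C(i + j, j)%:R)^-1 :> R.
  by rewrite exprD; field; rewrite b0 !k0.
apply: ler_piMr; last by rewrite invf_le1 ?ltr0n ?ler1n bin_gt0 leq_addl.
by rewrite !mulr_ge0// ?divr_ge0// exprn_ge0.
Qed.

Lemma taylor_coef_le A M c x e j : fact2_bound A M c -> 0 <= M -> 0 < e ->
  `|taylor_coef c x j| <=
   A * (M ^+ j / j`!%:R ^+ 2) * (expR e^-1 * expR (e * (M * `|x|))).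
Proof.
move=> cb M0 e0; rewrite mulrA.
exact: fact2_psum_le (fact2_bound_binom _ cb M0) M0 e0.
Qed.

Lemma taylor_coef1 c x : taylor_coef c x 1 = psum (pseries_diffs c) x.
Proof.
rewrite /taylor_coef; congr (psum _ x); apply/funext => i.
by rewrite /pseries_diffs bin1 addn1.
Qed.

Lemma taylor_coef0 c x : taylor_coef c x 0 = psum c x.
Proof.
rewrite /taylor_coef; congr (psum _ x); apply/funext => i.
by rewrite bin0 addn0 mul1r.
Qed.

Lemma partial_sum_le A M c x n : fact2_bound A M c -> 0 <= M ->
  `|pseries c x n| <= A * expR 1^-1 * expR (1 * (M * `|x|)).
Proof.
move=> cb M0.
apply: le_trans (ler_norm_sum _ _ _) _.
apply: (@le_trans _ _ (A * expR 1^-1 * series (exp_coeff (1 * (M * `|x|))) n)).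
  rewrite /series /= mulr_sumr; apply: ler_sum => k _; exact: fact2_term_le.
rewrite ler_wpM2l ?mulr_ge0 ?expR_ge0 ?(fact2_bound_ge0 cb)//.
apply: nondecreasing_cvgn_le; last exact: is_cvg_series_exp_coeff.
apply: nondecreasing_series => i _ _; apply: exp_coeff_ge0.
by rewrite mul1r mulr_ge0.
Qed.

(* the summation domain i + j < N of both double sums below *)
Lemma cvg_triangular_sum (c : nat -> R^nat) (A : R^nat) (M B L x h : R) :
  0 <= M -> 0 <= L -> (forall j, fact2_bound (A j) M (c j)) ->
  (forall j, A j <= B * (L ^+ j / j`!%:R ^+ 2)) ->
  \sum_(0 <= j < N) (h ^+ j * pseries (c j) x (N - j)%N) @[N --> \oo] -->
     psum (fun j => psum (c j) x) h.
Proof.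
move=> M0 L0 cb AB.
have A0 j : 0 <= A j := fact2_bound_ge0 (cb j).
pose E := expR 1^-1 * expR (1 * (M * `|x|)).
have E0 : 0 <= E by rewrite mulr_ge0// expR_ge0.
have ABj : fact2_bound B L A by move=> j; rewrite ger0_norm//.
rewrite /psum /pseries.
rewrite (_ : [sequence _]_i = (fun j => h ^+ j * psum (c j) x)); last first.
  by apply/funext => j /=; rewrite mulrC.
apply: (@tannery _ (fun N j => h ^+ j * pseries (c j) x (N - j)%N) _
  (fun j => E * `|A j * h ^+ j|)).
- move=> N j jN; rewrite !normrM (ger0_norm (A0 j)).
  apply: le_trans (ler_wpM2l (normr_ge0 _) (partial_sum_le x _ (cb j) M0)) _.
  rewrite le_eqVlt; apply/orP; left; apply/eqP; rewrite /E; ring.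
- move=> j; apply: cvgMr.
  have : pseries (c j) x @ \oo --> psum (c j) x by exact: (fact2_cvg (cb j)).
  by move=> H; apply: cvg_comp H; exact: cvg_subnr.
- apply: is_cvg_seriesZ.
  have [] := @series_dominated _ (fun k => `|A k * h ^+ k|)
      (B * expR 1^-1 *: exp_coeff (1 * (L * `|h|))).
  + by move=> k; rewrite normr_id; exact: fact2_term_le.
  + exact: is_cvg_seriesZ (is_cvg_series_exp_coeff _).
  + by [].
Qed.

End PowerSeries.

(** * Taylor expansion and Cauchy products *)

Section TaylorCauchy.
Context {R : realType}.
Implicit Types (c d : R^nat) (x y h A M : R).

Lemma sum_triangle (g : nat -> nat -> R) N :
  \sum_(0 <= j < N) \sum_(0 <= i < N - j) g i j =
  \sum_(0 <= k < N) \sum_(0 <= j < k.+1) g (k - j)%N j.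
Proof.
elim: N => [|N IH]; first by rewrite !big_nil.
rewrite [RHS]big_nat_recr//= -IH.
have -> : \sum_(0 <= j < N) \sum_(0 <= i < N - j) g i j =
    \sum_(0 <= j < N.+1) \sum_(0 <= i < N - j) g i j.
  by rewrite [RHS]big_nat_recr//= subnn big_nil addr0.
rewrite -big_split/= big_nat [RHS]big_nat; apply: eq_bigr => j /andP[_ jN].
by rewrite subSn// big_nat_recr.
Qed.

(** Truncating the double sum to a triangle makes its [N]-th truncation equal to the [N]-th partial
    sum at [x + h], by the binomial formula. *)
Lemma taylorE c x h A M : fact2_bound A M c -> 0 <= M ->
  psum c (x + h) = psum (taylor_coef c x) h.
Proof.
move=> cb M0; apply/cvg_lim => //.
have := @cvg_triangular_sum _ (fun j i => 'C(i + j, j)%:R * c (i + j)%N)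
  (fun j => A * (M ^+ j / j`!%:R ^+ 2)) M A M x h M0 M0
  (fun j => fact2_bound_binom j cb M0) (fun j => lexx _).
set S := (fun N => _); suff -> : S = pseries c (x + h) by [].
apply/funext => N; rewrite /S.
rewrite (eq_bigr (fun j => \sum_(0 <= i < N - j)
   h ^+ j * ('C(i + j, j)%:R * c (i + j)%N * x ^+ i))); last first.
  by move=> j _; rewrite /pseries /series /= mulr_sumr.
rewrite sum_triangle /pseries /series /=; apply: eq_bigr => k _.
rewrite exprDn big_mkord mulr_sumr; apply: eq_bigr => j _.
rewrite subnK; last by rewrite -ltnS.
by rewrite mulr_natl mulrCA -!mulrnAr mulrnAl -!mulrnAr; ring.
Qed.

Definition cauchy_coef c d : R^nat := fun k => \sum_(0 <= j < k.+1) c j * d (k - j)%N.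

Lemma psum_cauchy c d x A1 A2 M : fact2_bound A1 M c -> fact2_bound A2 M d ->
  0 <= M -> psum (cauchy_coef c d) x = psum c x * psum d x.
Proof.
move=> cb db M0; apply/cvg_lim => //.
have A20 := fact2_bound_ge0 db.
have b1 j : fact2_bound (A2 * `|c j|) M (fun i => c j * d i).
  by move=> i; rewrite normrM [A2 * _]mulrC -mulrA ler_wpM2l.
have b2 j : A2 * `|c j| <= A1 * A2 * (M ^+ j / j`!%:R ^+ 2).
  by rewrite [A1 * _]mulrC -mulrA ler_wpM2l.
have := cvg_triangular_sum (x := x) (h := x) M0 M0 b1 b2.
have -> : psum (fun j => psum (fun i => c j * d i) x) x = psum c x * psum d x.
  rewrite mulrC -(psumZ _ _ cb M0); congr (psum _ x); apply/funext => j.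
  by rewrite (psumZ _ _ db M0) mulrC.
set S := (fun N => _); suff -> : S = pseries (cauchy_coef c d) x by [].
apply/funext => N; rewrite /S.
rewrite (eq_bigr (fun j => \sum_(0 <= i < N - j)
   x ^+ j * (c j * d i * x ^+ i))); last first.
  by move=> j _; rewrite /pseries /series /= mulr_sumr.
rewrite sum_triangle /pseries /series /=; apply: eq_bigr => k _.
rewrite /cauchy_coef mulr_suml !big_mkord; apply: eq_bigr => j _.
have jk : (j <= k)%N by rewrite -ltnS.
have -> : x ^+ k = x ^+ (k - j) * x ^+ j by rewrite -exprD subnK.
ring.
Qed.

(** The products of inverse squared factorials are squared binomials over [k! ^+ 2], and the squared
    binomials sum to at most [2 ^+ k * 2 ^+ k]: hence the 4. *)
Lemma fact2_bound_cauchy c d A1 A2 M : fact2_bound A1 M c -> fact2_bound A2 M d ->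
  0 <= M -> fact2_bound (A1 * A2) (4 * M) (cauchy_coef c d).
Proof.
move=> cb db M0 k.
have A10 := fact2_bound_ge0 cb; have A20 := fact2_bound_ge0 db.
have f0 n : n`!%:R != 0 :> R by rewrite pnatr_eq0 -lt0n fact_gt0.
have s2 : \sum_(j < k.+1) 'C(k, j)%:R = 2 ^+ k :> R.
  rewrite -[2]/(1 + 1) exprDn; apply: eq_bigr => j _.
  by rewrite !expr1n mulr1.
apply: le_trans (ler_norm_sum _ _ _) _.
have -> : A1 * A2 * ((4 * M) ^+ k / k`!%:R ^+ 2) =
    \sum_(j < k.+1) A1 * A2 * (M ^+ k / k`!%:R ^+ 2) * 2 ^+ k * 'C(k, j)%:R.
  rewrite -mulr_sumr s2 (_ : 4 = 2 * 2) ?exprMn; last by rewrite -natrM.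
  by field; rewrite f0.
rewrite big_mkord; apply: ler_sum => j _; rewrite normrM.
have jk : (j <= k)%N by rewrite -ltnS.
apply: le_trans (ler_pM _ _ (cb j) (db (k - j)%N)) _ => //.
have C2 : 'C(k, j)%:R <= 2 ^+ k :> R.
  rewrite -s2 (bigD1 j)//= lerDl sumr_ge0//.
have Hk := bin_fact jk.
have -> : A1 * (M ^+ j / j`!%:R ^+ 2) * (A2 * (M ^+ (k - j) / (k - j)`!%:R ^+ 2)) =
   A1 * A2 * (M ^+ k / k`!%:R ^+ 2) * 'C(k, j)%:R * 'C(k, j)%:R.
  have -> : M ^+ k = M ^+ j * M ^+ (k - j) by rewrite -exprD subnKC.
  rewrite -Hk !natrM; field.
  by rewrite !f0 pnatr_eq0 -lt0n bin_gt0 jk.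
rewrite ler_wpM2r// ler_wpM2l// !mulr_ge0// ?divr_ge0// exprn_ge0//.
Qed.

End TaylorCauchy.

(** * Bessel solutions *)

Section DeriveRules.
Context {R : realType}.
Implicit Types (f g : R -> R) (x : R).

Lemma derE f x a b : is_derive x 1 f a -> a = b -> is_derive x 1 f b.
Proof. by move=> + <-. Qed.

Lemma derC (a x : R) : is_derive x 1 (fun=> a) 0.
Proof. exact: is_derive_cst. Qed.

Lemma derI x : is_derive x 1 (fun y : R => y) 1.
Proof. exact: is_derive_id. Qed.

Lemma derD f g x a b : is_derive x 1 f a -> is_derive x 1 g b ->
  is_derive x 1 (fun y => f y + g y) (a + b).
Proof. by move=> fa gb; exact: is_deriveD. Qed.

Lemma derB f g x a b : is_derive x 1 f a -> is_derive x 1 g b ->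
  is_derive x 1 (fun y => f y - g y) (a - b).
Proof. by move=> fa gb; exact: is_deriveB. Qed.

Lemma derN f x a : is_derive x 1 f a -> is_derive x 1 (fun y => - f y) (- a).
Proof. by move=> fa; exact: is_deriveN. Qed.

Lemma derM f g x a b : is_derive x 1 f a -> is_derive x 1 g b ->
  is_derive x 1 (fun y => f y * g y) (a * g x + f x * b).
Proof.
move=> fa gb; apply: derE (is_deriveM fa gb) _.
by rewrite /GRing.scale/=; ring.
Qed.

Lemma derZ f x a k : is_derive x 1 f a -> is_derive x 1 (fun y => k * f y) (k * a).
Proof. by move=> fa; apply: derE (derM (derC k x) fa) _; ring. Qed.

Lemma derX f x a n : is_derive x 1 f a ->
  is_derive x 1 (fun y => f y ^+ n.+1) (n.+1%:R * f x ^+ n * a).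
Proof.
move=> fa; elim: n => [|n IH].
  by apply: derE fa _; rewrite expr0 !mul1r.
under [X in is_derive _ _ X]eq_fun do rewrite exprS.
by apply: derE (derM fa IH) _; rewrite -[n.+2%:R]nat1r exprS; ring.
Qed.

Lemma der_comp f g x a b : is_derive x 1 f a -> is_derive (f x) 1 g b ->
  is_derive x 1 (fun y => g (f y)) (b * a).
Proof.
by move=> fa gb; exact: is_derive1_comp.
Qed.

Lemma der_near f g x a : (\forall y \near x, f y = g y) -> is_derive x 1 f a ->
  is_derive x 1 g a.
Proof.
move=> fg [df <-]; have fg' : {near x, f =1 g} by [].
by split; [exact: near_eq_derivable df|rewrite (near_eq_derive _ fg')].
Qed.

Lemma der_cont f x a : is_derive x 1 f a -> {for x, continuous f}.
Proof. by move=> [df _]; apply/differentiable_continuous/derivable1_diffP. Qed.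

Lemma der_powR (p x : R) : 0 < x -> is_derive x 1 (fun y => y `^ p) (p * x `^ p / x).
Proof.
move=> x0; apply: derE; first exact: (@is_derive1_powR R p x x0).
rewrite -mulrA; congr (_ * _).
by rewrite powRB ?powRr1 ?ltW// (gt_eqF x0) implybT.
Qed.

Lemma der0_cst f : (forall x, is_derive x 1 f 0) -> forall x y, f x = f y.
Proof.
move=> f0 x y; suff H a b : a < b -> f a = f b.
  by have [/H//|/H//|->//] := ltgtP x y.
move=> ab; have [|z _] := MVT ab (fun z _ => f0 z).
  by apply: derivable_within_continuous => z _; case: (f0 z).
by rewrite mul0r => /eqP; rewrite subr_eq0 => /eqP.
Qed.

Lemma expR_scale_is_derive (k : R) x : is_derive x 1 (fun t => expR (k * t)) (k * expR (k * x)).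
Proof.
apply: derE (der_comp (derZ k (derI x)) (is_derive_expR _)) _.
by rewrite mulr1 mulrC.
Qed.

End DeriveRules.

Section Bessel.
Context {R : realType}.
Implicit Types (s l x y : R).

(* [bessel_coef s] are the Taylor coefficients of the entire function
   [y |-> Gamma(s+1) (sqrt y / 2)^-s J_s(sqrt y)]. *)
Definition bessel_coef s : R^nat := fun k =>
  (- 4^-1) ^+ k / (k`!%:R * \prod_(0 <= i < k) (s + 1 + i%:R)).

Lemma bessel_coef_rec s k : -1 < s ->
  k.+1%:R * (k.+1%:R + s) * bessel_coef s k.+1 = - 4^-1 * bessel_coef s k.
Proof.
move=> s1; rewrite /bessel_coef big_nat_recr//= factS natrM exprS.
have p0 : \prod_(0 <= i < k) (s + 1 + i%:R) != 0.
  rewrite prodf_seq_neq0; apply/allP => i _ /=.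
  by rewrite gt_eqF// ltr_wpDr// -ltrBlDr sub0r.
have f0 : k`!%:R != 0 :> R by rewrite pnatr_eq0 -lt0n fact_gt0.
have sk0 : s + 1 + k%:R != 0 by rewrite gt_eqF// ltr_wpDr// -ltrBlDr sub0r.
field; by rewrite p0 f0 sk0 nat1r pnatr_eq0.
Qed.

(** Each factor [s + 1 + i] is at least [kap * (i + 1)], so the product supplies the second
    factorial; the powers of 1/4 are dropped. *)
Lemma fact2_bound_bessel s (kap : R) : 0 < kap -> kap <= 1 -> kap <= 1 + s ->
  fact2_bound 1 kap^-1 (bessel_coef s).
Proof.
move=> k0 k1 ks n; rewrite mul1r /bessel_coef normrM normfV normrX normrN.
have pr : kap ^+ n * n`!%:R <= \prod_(0 <= i < n) (s + 1 + i%:R).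
  elim: n => [|n IH]; first by rewrite big_nil expr0 mul1r.
  rewrite big_nat_recr//= factS natrM.
  have -> : kap ^+ n.+1 * (n.+1%:R * n`!%:R) = kap ^+ n * n`!%:R * (kap * n.+1%:R).
    by rewrite exprS; ring.
  have kap0 := ltW k0.
  apply: ler_pM => //; [by rewrite mulr_ge0// exprn_ge0|by rewrite mulr_ge0|].
  rewrite -nat1r mulrDr mulr1 lerD//; first by rewrite [s + 1]addrC.
  by rewrite ler_piMl.
have f0 : 0 < n`!%:R :> R by rewrite ltr0n fact_gt0.
have p0 : 0 < kap ^+ n * n`!%:R by rewrite mulr_gt0// exprn_gt0.
have pp := lt_le_trans p0 pr.
rewrite !gtr0_norm ?mulr_gt0//.
have -> : kap^-1 ^+ n / n`!%:R ^+ 2 = 1 * (n`!%:R * (kap ^+ n * n`!%:R))^-1.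
  by rewrite exprVn mul1r; field; rewrite !gt_eqF// exprn_gt0.
apply: ler_pM => //.
- by rewrite invr_ge0 mulr_ge0// ltW.
- by rewrite exprn_ile1// ?invr_ge0// invf_le1 ?ler1n.
- by rewrite lef_pV2 ?posrE ?mulr_gt0 ?exprn_gt0// ler_pM2l.
Qed.

(** The recurrence cancels the terms for each [k], so the partial sums already vanish. *)
Lemma pseries_ode (c : R^nat) A M a y : fact2_bound A M c -> 0 <= M ->
  (forall k, k.+1%:R * (k%:R + a) * c k.+1 = - 4^-1 * c k) ->
  y * psum (pseries_diffs (pseries_diffs c)) y + a * psum (pseries_diffs c) y +
    4^-1 * psum c y = 0.
Proof.
move=> cb M0 cr.
have cb1 := fact2_bound_diffs cb M0.
have cb2 := fact2_bound_diffs cb1 M0.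
have H2 := @pseries_shift_cvg _ (fun k => k%:R * pseries_diffs c k) y (mul0r _)
   (fact2_cvg (x := y) cb2 M0).
have H1 : (fun n => a * pseries (pseries_diffs c) y n) @ \oo -->
    a * psum (pseries_diffs c) y by apply: cvgMr; exact: fact2_cvg cb1 M0.
have H0 : (fun n => 4^-1 * pseries c y n) @ \oo --> 4^-1 * psum c y.
  by apply: cvgMr; exact: fact2_cvg cb M0.
pose F n := pseries (fun k => k%:R * pseries_diffs c k) y n +
  a * pseries (pseries_diffs c) y n + 4^-1 * pseries c y n.
have HF : F n @[n --> \oo] -->
    y * psum (pseries_diffs (pseries_diffs c)) y + a * psum (pseries_diffs c) y +
    4^-1 * psum c y.
  by apply: cvgD => //; exact: cvgD.
have F0 : F = cst 0.
  apply/funext => n; rewrite /F /pseries /series /=.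
  rewrite !mulr_sumr -!big_split/= big1// => k _.
  have := cr k; rewrite /pseries_diffs => h.
  rewrite !mulrA -!mulrDl [X in X * _](_ : _ = 0) ?mul0r//.
  by move: h => /eqP; rewrite mulNr -addr_eq0 => /eqP <-; ring.
by rewrite -(cvg_lim _ HF)// F0 lim_cst.
Qed.

Definition bessel s y : R := psum (bessel_coef s) y.

Lemma bessel0 s : bessel s 0 = 1.
Proof. by rewrite /bessel psum0 /bessel_coef expr0 big_nil mulr1 divr1. Qed.

End Bessel.

(** * Solutions of the singular equation on the half-line and their Wronskian *)

Section BesselSolutions.
Context {R : realType}.
Implicit Types (s l x y u v nu : R).

Definition dbessel s y : R := psum (pseries_diffs (bessel_coef s)) y.
Definition d2bessel s y : R := psum (pseries_diffs (pseries_diffs (bessel_coef s))) y.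
Definition d3bessel s y : R :=
  psum (pseries_diffs (pseries_diffs (pseries_diffs (bessel_coef s)))) y.

Definition bessel_rate s : R := (Num.min 1 (1 + s))^-1.

Lemma bessel_rate_ge0 s : -1 < s -> 0 <= bessel_rate s.
Proof. by move=> s1; rewrite invr_ge0 le_min ler01/=; lra. Qed.

Lemma bessel_coef_bound s : -1 < s -> fact2_bound 1 (bessel_rate s) (bessel_coef s).
Proof.
move=> s1; apply: fact2_bound_bessel.
- by rewrite lt_min ltr01/=; lra.
- by rewrite ge_min lexx.
- by rewrite ge_min lexx orbT.
Qed.

Section OneSolution.
Context (s : R) (s1 : -1 < s).
Let b0 := bessel_coef_bound s1.
Let M0 := bessel_rate_ge0 s1.
Let b1 := fact2_bound_diffs b0 M0.
Let b2 := fact2_bound_diffs b1 M0.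

Lemma bessel_is_derive y : is_derive y 1 (bessel s) (dbessel s y).
Proof. exact: psum_is_derive b0 M0. Qed.

Lemma dbessel_is_derive y : is_derive y 1 (dbessel s) (d2bessel s y).
Proof. exact: psum_is_derive b1 M0. Qed.

Lemma d2bessel_is_derive y : is_derive y 1 (d2bessel s) (d3bessel s y).
Proof. exact: psum_is_derive b2 M0. Qed.

Lemma bessel_ode y : y * d2bessel s y + (1 + s) * dbessel s y + 4^-1 * bessel s y = 0.
Proof.
apply: (pseries_ode _ b0 M0) => k; rewrite -bessel_coef_rec//.
by rewrite -natr1; ring.
Qed.

Lemma dbessel_ode y :
  y * d3bessel s y + (2 + s) * d2bessel s y + 4^-1 * dbessel s y = 0.
Proof.
apply: (pseries_ode _ b1 M0) => k; rewrite /pseries_diffs.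
have := bessel_coef_rec k.+1 s1.
rewrite mulrCA => h.
transitivity (k.+1%:R * (k.+2%:R * (k.+2%:R + s) * bessel_coef s k.+2)).
  by rewrite -[k.+2%:R]nat1r -[k.+1%:R]nat1r; ring.
by rewrite bessel_coef_rec//; ring.
Qed.

(** For [l > 0] this is sqrt(x) J_s(sqrt(l) x) up to a constant, normalised to be entire in [l] and
    equal to x^(s + 1/2) at [l = 0], the powers used in the domain. *)
Definition bsol l x : R := x `^ (s + 2^-1) * bessel s (l * x ^+ 2).
Definition dbsol l x : R := x `^ (s + 2^-1) / x *
  ((s + 2^-1) * bessel s (l * x ^+ 2) + 2 * (l * x ^+ 2) * dbessel s (l * x ^+ 2)).
(* [lsol] and [dlsol] are the derivatives of [bsol] and [dbsol] with respect to [l]. *)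
Definition lsol l x : R := x `^ (s + 2^-1) * (x ^+ 2 * dbessel s (l * x ^+ 2)).
Definition dlsol l x : R := x `^ (s + 2^-1) *
  (x * ((s + 2^-1 + 2) * dbessel s (l * x ^+ 2)
        + 2 * (l * x ^+ 2) * d2bessel s (l * x ^+ 2))).

Let dlx l x : is_derive x 1 (fun x => l * x ^+ 2) (2 * l * x).
Proof. by apply: derE (derZ l (derX 1 (derI x))) _; rewrite expr1; ring. Qed.

Lemma bsol_is_derive l x : 0 < x -> is_derive x 1 (bsol l) (dbsol l x).
Proof.
move=> x0; rewrite /bsol.
apply: derE (derM (der_powR _ x0) (der_comp (dlx l x) (bessel_is_derive _))) _.
by rewrite /dbsol; field; rewrite gt_eqF.
Qed.

Lemma dbsol_is_derive l x : 0 < x ->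
  is_derive x 1 (dbsol l) (((s ^+ 2 - 4^-1) / x ^+ 2 - l) * bsol l x).
Proof.
move=> x0; have xn0 : x != 0 by rewrite gt_eqF.
have dB := der_comp (dlx l x) (bessel_is_derive (l * x ^+ 2)).
have dD := der_comp (dlx l x) (dbessel_is_derive (l * x ^+ 2)).
have dV : is_derive x 1 (fun x => x^-1) (- x ^- 2).
  by apply: derE (is_deriveV xn0 (derI x)) _; rewrite /GRing.scale/= mulr1.
apply: derE (derM (derM (der_powR (s + 2^-1) x0) dV)
  (derD (derZ (s + 2^-1) dB) (derM (derZ 2 (dlx l x)) dD))) _.
have := bessel_ode (l * x ^+ 2); rewrite /bsol.
set P := x `^ _; set B := bessel _ _; set D := dbessel _ _; set D2 := d2bessel _ _.
move=> ode; apply/eqP; rewrite -subr_eq0.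
set L := (X in X == _).
have -> : L = P * 4 * l * (l * x ^+ 2 * D2 + (1 + s) * D + 4^-1 * B).
  by rewrite /L; field; rewrite xn0.
by rewrite ode mulr0.
Qed.

Lemma lsol_is_derive l x : 0 < x -> is_derive x 1 (lsol l) (dlsol l x).
Proof.
move=> x0; have xn0 : x != 0 by rewrite gt_eqF.
have dD := der_comp (dlx l x) (dbessel_is_derive (l * x ^+ 2)).
apply: derE (derM (der_powR _ x0) (derM (derX 1 (derI x)) dD)) _.
by rewrite /dlsol; field; rewrite xn0.
Qed.

Lemma dlsol_is_derive l x : 0 < x ->
  is_derive x 1 (dlsol l) (((s ^+ 2 - 4^-1) / x ^+ 2 - l) * lsol l x - bsol l x).
Proof.
move=> x0; have xn0 : x != 0 by rewrite gt_eqF.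
have dB := der_comp (dlx l x) (dbessel_is_derive (l * x ^+ 2)).
have dD := der_comp (dlx l x) (d2bessel_is_derive (l * x ^+ 2)).
apply: derE (derM (der_powR (s + 2^-1) x0) (derM (derI x)
  (derD (derZ (s + 2^-1 + 2) dB) (derM (derZ 2 (dlx l x)) dD)))) _.
have := bessel_ode (l * x ^+ 2); have := dbessel_ode (l * x ^+ 2).
rewrite /bsol /lsol.
set P := x `^ _; set B := bessel _ _; set D := dbessel _ _; set D2 := d2bessel _ _.
set D3 := d3bessel _ _.
move=> ode1 ode0; apply/eqP; rewrite -subr_eq0.
set L := (X in X == _).
have -> : L = P * 4 * (l * x ^+ 2 * (l * x ^+ 2 * D3 + (2 + s) * D2 + 4^-1 * D)
    + (l * x ^+ 2 * D2 + (1 + s) * D + 4^-1 * B)).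
  by rewrite /L; field; rewrite xn0.
by rewrite ode1 ode0 !(mulr0,addr0).
Qed.

End OneSolution.

Section Wronskian.
Context (s : R) (s1 : -1 < s) (s2 : s < 1).
Let s2' : -1 < - s. Proof. by rewrite ltrN2. Qed.

(** This is the Wronskian of the two solutions in the variable y = l x^2, where the singular powers
    have cancelled. Its derivative vanishes by the two equations, and its constant value can be read
    at 0. *)
Lemma bessel_wronskian y :
  2 * s * bessel s y * bessel (- s) y +
   2 * (y * (dbessel s y * bessel (- s) y - bessel s y * dbessel (- s) y)) = 2 * s.
Proof.
pose w z := 2 * s * bessel s z * bessel (- s) z +
   2 * (z * (dbessel s z * bessel (- s) z - bessel s z * dbessel (- s) z)).
suff /(der0_cst (f := w)) H : forall z : R, is_derive z 1 w 0.
  by rewrite -/(w y) (H y 0) /w !bessel0 mul0r mulr0 addr0 !mulr1.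
move=> z; have dp := bessel_is_derive s1 z; have dm := bessel_is_derive s2' z.
have ddp := dbessel_is_derive s1 z; have ddm := dbessel_is_derive s2' z.
apply: derE (derD (derM (derZ (2 * s) dp) dm)
   (derZ 2 (derM (derI z) (derB (derM ddp dm) (derM dp ddm))))) _.
have := bessel_ode s1 z; have := bessel_ode s2' z.
set A := bessel s z; set B := bessel (- s) z; set A' := dbessel s z.
set B' := dbessel (- s) z; set A'' := d2bessel s z; set B'' := d2bessel (- s) z.
move=> o1 o2.
transitivity (2 * ((z * A'' + (1 + s) * A' + 4^-1 * A) * B -
   A * (z * B'' + (1 + - s) * B' + 4^-1 * B))); first by field.
by rewrite o1 o2; ring.
Qed.

Lemma bsol_wronskian l x : 0 < x ->
  dbsol s l x * bsol (- s) l x - bsol s l x * dbsol (- s) l x = 2 * s.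
Proof.
move=> x0; rewrite -(bessel_wronskian (l * x ^+ 2)) /bsol /dbsol.
have xn0 : x != 0 by rewrite gt_eqF.
have : x `^ (s + 2^-1) * x `^ (- s + 2^-1) = x.
  rewrite -powRD; last by rewrite xn0 implybT.
  by rewrite (_ : _ + _ = 1) ?powRr1 ?ltW//; field.
set P := x `^ _; set Q := x `^ _ => PQ.
set y := l * x ^+ 2.
transitivity (P * Q / x * (2 * s * bessel s y * bessel (- s) y +
  2 * (y * (dbessel s y * bessel (- s) y - bessel s y * dbessel (- s) y)))).
  by field; rewrite xn0.
by rewrite PQ mulfV// mul1r.
Qed.

End Wronskian.

End BesselSolutions.

(** * General solutions, their energy, and the characteristic function *)

Section Combinations.
Context {R : realType} (nu : R) (nu_gt0 : 0 < nu) (nu_lt1 : nu < 1).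
Implicit Types (u v l x : R).
Let sp : -1 < nu. Proof. by apply: lt_trans nu_gt0; rewrite ltrN10. Qed.
Let sm : -1 < - nu. Proof. by rewrite ltrN2. Qed.

(** Here [e] is [bsol], [dbsol], [lsol] or [dlsol]: the same coefficients give a solution, its
    slope, and their derivatives in [l]. *)
Definition comb (e : R -> R -> R -> R) u v l x : R := u * e nu l x + v * e (- nu) l x.

Lemma comb_is_derive u v l x : 0 < x ->
  is_derive x 1 (comb bsol u v l) (comb dbsol u v l x).
Proof.
move=> x0; exact: derD (derZ u (bsol_is_derive sp l x0)) (derZ v (bsol_is_derive sm l x0)).
Qed.

Lemma dcomb_is_derive u v l x : 0 < x ->
  is_derive x 1 (comb dbsol u v l) ((cpot nu / x ^+ 2 - l) * comb bsol u v l x).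
Proof.
move=> x0.
apply: derE (derD (derZ u (dbsol_is_derive sp l x0)) (derZ v (dbsol_is_derive sm l x0))) _.
by rewrite /comb /cpot sqrrN; ring.
Qed.

Lemma lcomb_is_derive u v l x : 0 < x ->
  is_derive x 1 (comb lsol u v l) (comb dlsol u v l x).
Proof.
move=> x0; exact: derD (derZ u (lsol_is_derive sp l x0)) (derZ v (lsol_is_derive sm l x0)).
Qed.

Lemma dlcomb_is_derive u v l x : 0 < x ->
  is_derive x 1 (comb dlsol u v l)
    ((cpot nu / x ^+ 2 - l) * comb lsol u v l x - comb bsol u v l x).
Proof.
move=> x0.
apply: derE (derD (derZ u (dlsol_is_derive sp l x0)) (derZ v (dlsol_is_derive sm l x0))) _.
by rewrite /comb /cpot sqrrN; ring.
Qed.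

(* The Wronskian of a solution and its derivative in the spectral parameter:
   a primitive of the square of the solution. *)
Definition energy u v l x : R :=
  comb dbsol u v l x * comb lsol u v l x - comb bsol u v l x * comb dlsol u v l x.

Lemma energy_is_derive u v l x : 0 < x ->
  is_derive x 1 (energy u v l) (comb bsol u v l x ^+ 2).
Proof.
move=> x0; apply: derE (derB
  (derM (dcomb_is_derive u v l x0) (lcomb_is_derive u v l x0))
  (derM (comb_is_derive u v l x0) (dlcomb_is_derive u v l x0))) _.
ring.
Qed.

(** The derivative in [l] brings x^2 against the 1/x of a derivative in [x], so a factor [x] is
    left. Giving sqrt(x) to each side of the products raises the exponents from 1/2 + nu and 1/2 -
    nu to 1 + nu and 1 - nu, both positive. *)
Lemma energy_cvg0 u v l : energy u v l x @[x --> 0^'+] --> (0 : R).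
Proof.
pose f s x := bessel s (l * x ^+ 2); pose g s x := dbessel s (l * x ^+ 2).
pose h s x := d2bessel s (l * x ^+ 2); pose y x := l * x ^+ 2.
have cy : {for 0, continuous y}.
  exact: der_cont (derZ l (derX 1 (derI 0))).
have cf (s : R) : -1 < s -> f s x @[x --> 0^'+] --> f s 0.
  move=> s1; apply: cvg_at_right_filter.
  apply: (@continuous_comp _ _ _ y (bessel s)); first exact: cy.
  exact: der_cont (bessel_is_derive s1 _).
have cg (s : R) : -1 < s -> g s x @[x --> 0^'+] --> g s 0.
  move=> s1; apply: cvg_at_right_filter.
  apply: (@continuous_comp _ _ _ y (dbessel s)); first exact: cy.
  exact: der_cont (dbessel_is_derive s1 _).
have ch (s : R) : -1 < s -> h s x @[x --> 0^'+] --> h s 0.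
  move=> s1; apply: cvg_at_right_filter.
  apply: (@continuous_comp _ _ _ y (d2bessel s)); first exact: cy.
  exact: der_cont (d2bessel_is_derive s1 _).
have cyr : y x @[x --> 0^'+] --> y 0 by apply: cvg_at_right_filter.
pose p x : R := x `^ (nu + 1); pose q x : R := x `^ (- nu + 1).
have p0 : p x @[x --> 0^'+] --> (0 : R) by apply: powR_cvg0; move: nu_gt0 nu_lt1; lra.
have q0 : q x @[x --> 0^'+] --> (0 : R) by apply: powR_cvg0; move: nu_gt0 nu_lt1; lra.
pose al s x := (s + 2^-1) * f s x + 2 * y x * g s x.
pose ep s x := (s + 2^-1 + 2) * g s x + 2 * y x * h s x.
have cal (s : R) : -1 < s -> al s x @[x --> 0^'+] --> al s 0.
  move=> s1; apply: cvgD; first by apply: cvgMr; exact: cf.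
  by apply: cvgM; [exact: cvgMr|exact: cg].
have cep (s : R) : -1 < s -> ep s x @[x --> 0^'+] --> ep s 0.
  move=> s1; apply: cvgD; first by apply: cvgMr; exact: cg.
  by apply: cvgM; [exact: cvgMr|exact: ch].
pose cc (k : R -> R -> R) x := u * (p x * k nu x) + v * (q x * k (- nu) x).
have ccE (k : R -> R -> R) : (forall s : R, -1 < s -> k s x @[x --> 0^'+] --> k s 0) ->
    cc k x @[x --> 0^'+] --> (0 : R).
  move=> ck.
  have : cc k x @[x --> 0^'+] --> u * (0 * k nu 0) + v * (0 * k (- nu) 0).
    by apply: cvgD; apply: cvgMr; apply: cvgM => //; apply: ck.
  by rewrite !mul0r !mulr0 addr0.
have : cc al x * cc g x - cc f x * cc ep x @[x --> 0^'+] --> (0 * 0 - 0 * 0 : R).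
  by apply: cvgB; apply: cvgM; apply: ccE.
rewrite mul0r subr0; apply: cvg_trans; apply: near_eq_cvg; near=> x.
have x0 : 0 < x by near: x; exact: nbhs_right_gt.
have xn0 : x != 0 by rewrite gt_eqF.
have pE : p x = x `^ (nu + 2^-1) * x `^ 2^-1.
  rewrite -powRD; last by rewrite xn0 implybT.
  by rewrite /p; congr (_ `^ _); field.
have qE : q x = x `^ (- nu + 2^-1) * x `^ 2^-1.
  rewrite -powRD; last by rewrite xn0 implybT.
  by rewrite /q; congr (_ `^ _); field.
have rE : x `^ 2^-1 * x `^ 2^-1 = x.
  rewrite -powRD; last by rewrite xn0 implybT.
  by rewrite (_ : _ + _ = 1) ?powRr1 ?ltW//; field.
rewrite /cc pE qE /energy /comb /dbsol /lsol /bsol /dlsol /al /ep /f /g /h /y.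
move: rE; set r := x `^ 2^-1; set P := x `^ _; set Q := x `^ _.
move: (bessel _ _) (bessel _ _) (dbessel _ _) (dbessel _ _) => b2 b1 d2 d1.
move: (d2bessel _ _) (d2bessel _ _) => e2 e1 rE.
transitivity (r * r * ((u * P * ((nu + 2^-1) * b1 + 2 * (l * x ^+ 2) * d1)
    + v * Q * ((- nu + 2^-1) * b2 + 2 * (l * x ^+ 2) * d2)) * (u * P * d1 + v * Q * d2)
  - (u * P * b1 + v * Q * b2) * (u * P * ((nu + 2^-1 + 2) * d1 + 2 * (l * x ^+ 2) * e1)
    + v * Q * ((- nu + 2^-1 + 2) * d2 + 2 * (l * x ^+ 2) * e2)))).
  ring.
by rewrite rE; field; rewrite xn0.
Unshelve. all: by end_near. Qed.

Lemma energy_ge0 u v l x : 0 < x -> 0 <= energy u v l x.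
Proof.
move=> x0; have ce := energy_cvg0 u v l.
rewrite -(cvg_lim _ ce)//; apply: limr_le; first exact: cvgP ce.
near=> z.
have z0 : 0 < z by near: z; exact: nbhs_right_gt.
have zx : z < x by near: z; exact: nbhs_right_lt.
have [| |c _] := @MVT _ (energy u v l) (fun x => comb bsol u v l x ^+ 2) z x zx.
- move=> t; rewrite in_itv/= => /andP[zt _].
  by apply: energy_is_derive; exact: lt_trans zt.
- apply: derivable_within_continuous => t; rewrite in_itv/= => /andP[zt _].
  by case: (energy_is_derive u v l (lt_le_trans z0 zt)).
- by move=> h; rewrite -subr_ge0 h mulr_ge0 ?sqr_ge0// subr_ge0 ltW.
Unshelve. all: by end_near. Qed.

(* up to nonzero factors, the product of the characteristic functions of the
   even and of the odd part of the operator *)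
Definition char_coef : R^nat :=
  cauchy_coef (fun k => bessel_coef nu k + (-1) * bessel_coef (- nu) k)
    (fun k => (nu - 2^-1) * bessel_coef nu k + (nu + 2^-1) * bessel_coef (- nu) k).

Let fact2_bound_le (A A' M M' : R) c : A <= A' -> 0 <= M -> M <= M' ->
  fact2_bound A M c -> fact2_bound A' M' c.
Proof.
move=> AA M0 MM cb k; apply: le_trans (cb k) _.
have A0 := fact2_bound_ge0 cb.
by rewrite ler_pM// ?divr_ge0 ?exprn_ge0// ler_wpM2r// lerXn2r// nnegrE// (le_trans M0).
Qed.

Let fact2_boundD (A A' M : R) c d : fact2_bound A M c -> fact2_bound A' M d ->
  fact2_bound (A + A') M (fun k => c k + d k).
Proof.
move=> cb db k; apply: le_trans (ler_normD _ _) _.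
by rewrite mulrDl lerD.
Qed.

Let fact2_boundZ (A M a : R) c : fact2_bound A M c ->
  fact2_bound (`|a| * A) M (fun k => a * c k).
Proof. by move=> cb k; rewrite normrM -mulrA ler_wpM2l. Qed.

(** This is [(1 - nu)^-1], the worse of the two rates, and serves for both series. *)
Let rate := bessel_rate (- nu).
Let rate0 : 0 <= rate. Proof. exact: bessel_rate_ge0. Qed.
Let bp : fact2_bound 1 rate (bessel_coef nu).
Proof.
apply: fact2_bound_le (bessel_coef_bound sp) => //; first exact: bessel_rate_ge0.
rewrite /bessel_rate lef_pV2 ?posrE ?lt_min ?ltr01/=; [|by move: nu_gt0; lra|by move: nu_lt1; lra].
rewrite le_min !ge_min lexx/=; apply/orP; right; move: nu_gt0; lra.
Qed.
Let bm : fact2_bound 1 rate (bessel_coef (- nu)).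
Proof. exact: bessel_coef_bound. Qed.

Let be := fact2_boundD bp (fact2_boundZ (-1) bm).
Let bo := fact2_boundD (fact2_boundZ (nu - 2^-1) bp) (fact2_boundZ (nu + 2^-1) bm).

Lemma char_coef_bound : exists A M, 0 <= M /\ fact2_bound A M char_coef.
Proof.
exists ((1 + `|-1| * 1) * (`|nu - 2^-1| * 1 + `|nu + 2^-1| * 1)), (4 * rate).
split; first by rewrite mulr_ge0.
exact: fact2_bound_cauchy be bo rate0.
Qed.

Lemma psum_char l : psum char_coef l = (bessel nu l - bessel (- nu) l) *
  ((nu - 2^-1) * bessel nu l + (nu + 2^-1) * bessel (- nu) l).
Proof.
rewrite (psum_cauchy _ be bo rate0).
rewrite (psumD _ bp (fact2_boundZ (-1) bm) rate0 rate0) (psumZ _ _ bm rate0) mulN1r.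
rewrite (psumD _ (fact2_boundZ (nu - 2^-1) bp) (fact2_boundZ (nu + 2^-1) bm) rate0 rate0).
by rewrite (psumZ _ _ bm rate0) (psumZ _ _ bp rate0).
Qed.

Lemma char_derive l : taylor_coef char_coef l 1 =
  (dbessel nu l - dbessel (- nu) l) *
    ((nu - 2^-1) * bessel nu l + (nu + 2^-1) * bessel (- nu) l) +
  (bessel nu l - bessel (- nu) l) *
    ((nu - 2^-1) * dbessel nu l + (nu + 2^-1) * dbessel (- nu) l).
Proof.
rewrite taylor_coef1; have [A [M [M0 cb]]] := char_coef_bound.
have := psum_is_derive l cb M0.
have -> : psum char_coef = fun l => (bessel nu l - bessel (- nu) l) *
  ((nu - 2^-1) * bessel nu l + (nu + 2^-1) * bessel (- nu) l).
  by apply/funext => x; exact: psum_char.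
have dp := bessel_is_derive sp l; have dm := bessel_is_derive sm l.
move=> [_ <-].
by case: (derM (derB dp dm) (derD (derZ (nu - 2^-1) dp) (derZ (nu + 2^-1) dm))).
Qed.

Lemma bsol_at1 s l : bsol s l 1 = bessel s l.
Proof. by rewrite /bsol powR1 mul1r expr1n mulr1. Qed.

Lemma lsol_at1 s l : lsol s l 1 = dbessel s l.
Proof. by rewrite /lsol powR1 expr1n !mul1r mulr1. Qed.

(** These coefficients are those of the solutions that vanish at 1; the slope at 1 is then [k] times
    the Wronskian [2 * nu]. *)
Lemma dcomb_at1 k l :
  comb dbsol (k * bessel (- nu) l) (- k * bessel nu l) l 1 = 2 * nu * k.
Proof.
rewrite -(bsol_wronskian sp nu_lt1 l (x := 1))// !bsol_at1 /comb.
ring.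
Qed.

Lemma energy_at1 k l :
  energy (k * bessel (- nu) l) (- k * bessel nu l) l 1 =
  2 * nu * k ^+ 2 * (bessel (- nu) l * dbessel nu l - bessel nu l * dbessel (- nu) l).
Proof.
rewrite /energy dcomb_at1 /comb !bsol_at1 !lsol_at1; ring.
Qed.

(** Where the first factor of P vanishes, the product rule leaves its derivative times
    [2 * nu * bessel nu l], which is the Wronskian of [energy_at1]. *)
Lemma char_derive_even k l : bessel nu l = bessel (- nu) l ->
  k ^+ 2 * taylor_coef char_coef l 1 = energy (k * bessel (- nu) l) (- k * bessel nu l) l 1.
Proof. by rewrite char_derive energy_at1 => ->; ring. Qed.

(** When the second factor vanishes, the first one is proportional to each of the two Bessel values
    ([h1], [h2]); this turns the remaining term into the same Wronskian with the opposite sign. *)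
Lemma char_derive_odd k l :
  (nu - 2^-1) * bessel nu l + (nu + 2^-1) * bessel (- nu) l = 0 ->
  k ^+ 2 * taylor_coef char_coef l 1 = - energy (k * bessel (- nu) l) (- k * bessel nu l) l 1.
Proof.
rewrite char_derive energy_at1 => h; rewrite h mulr0 add0r.
have h1 : (bessel nu l - bessel (- nu) l) * (nu - 2^-1) = - (2 * nu * bessel (- nu) l).
  by apply/eqP; rewrite -subr_eq0 -h; apply/eqP; field.
have h2 : (bessel nu l - bessel (- nu) l) * (nu + 2^-1) = 2 * nu * bessel nu l.
  by apply/eqP; rewrite -subr_eq0; apply/eqP; rewrite -[RHS]oppr0 -[in RHS]h; field.
have -> : (bessel nu l - bessel (- nu) l) *
    ((nu - 2^-1) * dbessel nu l + (nu + 2^-1) * dbessel (- nu) l) =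
  (bessel nu l - bessel (- nu) l) * (nu - 2^-1) * dbessel nu l +
  (bessel nu l - bessel (- nu) l) * (nu + 2^-1) * dbessel (- nu) l by ring.
by rewrite h1 h2; ring.
Qed.

Lemma bessel_neq0 l : (bessel nu l != 0) || (bessel (- nu) l != 0).
Proof.
apply/negPn/negP; rewrite negb_or !negbK => /andP[/eqP h1 /eqP h2].
have := bessel_wronskian sp nu_lt1 l; rewrite h1 h2; move: nu_gt0; lra.
Qed.

End Combinations.

(** * Integrals and square-integrable functions *)

Section IntervalIntegrals.
Context {R : realType}.
Notation mu := (@lebesgue_measure R).
Implicit Types (f g F : R -> R) (a b x : R).

Lemma continuous_within_segment f a b : (forall x, a <= x <= b -> {for x, continuous f}) ->
  {within `[a, b], continuous f}.
Proof.
move=> cf; apply: continuous_in_subspaceT => x.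
by rewrite inE/= in_itv/=; exact: cf.
Qed.

Lemma segment_integrable f a b : (forall x, a <= x <= b -> {for x, continuous f}) ->
  mu.-integrable `[a, b] (EFin \o f).
Proof.
move=> cf; apply: continuous_compact_integrable; first exact: segment_compact.
exact: continuous_within_segment.
Qed.

Lemma FTC2_is_derive F f a b : a <= b ->
  (forall x, a <= x <= b -> is_derive x 1 F (f x)) ->
  (forall x, a <= x <= b -> {for x, continuous f}) ->
  \int[mu]_(x in `[a, b]) f x = F b - F a.
Proof.
rewrite le_eqVlt => /predU1P[<- _ _|ab dF cf].
  by rewrite set_itv1 Rintegral_set1 subrr.
rewrite /Rintegral (continuous_FTC2 (F := F) ab)//.
- exact: continuous_within_segment.
- have cF x : a <= x <= b -> {for x, continuous F}.
    by move=> /dF; exact: der_cont.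
  split.
  + by move=> x; rewrite in_itv/= => /andP[ax xb]; case: (dF x); rewrite ?ltW.
  + by apply: cvg_at_right_filter; apply: cF; rewrite lexx ltW.
  + by apply: cvg_at_left_filter; apply: cF; rewrite lexx ltW.
- move=> x; rewrite in_itv/= => /andP[ax xb]; rewrite derive1E.
  by case: (dF x); rewrite ?ltW.
Qed.

Lemma Rintegral_oo f a b (b0 b1 : bool) : measurable_fun `]a, b[ f ->
  \int[mu]_(x in [set` Interval (BSide b0 a) (BSide b1 b)]) f x =
  \int[mu]_(x in `]a, b[) f x.
Proof.
by move=> mf; rewrite /Rintegral integral_itv_bndoo//; exact/measurable_EFinP.
Qed.

Lemma bounded_integrable f a b (K : R) : measurable_fun `[a, b] f ->
  (forall x, a <= x <= b -> `|f x| <= K) -> mu.-integrable `[a, b] (EFin \o f).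
Proof.
move=> mf fK; apply: measurable_bounded_integrable => //=.
- by rewrite [ltLHS]lebesgue_measure_itv/=; case: ifP => // _; rewrite -EFinB ltry.
- exists K; split; first exact: num_real.
  move=> x Kx y; rewrite /= in_itv/= => /fK; move=> /le_trans; apply; exact: ltW.
Qed.

Lemma bounded_cvg_Rintegral (h : nat -> R -> R) f a b (K : R) :
  (forall n, measurable_fun `[a, b] (h n)) ->
  (forall n x, a <= x <= b -> `|h n x| <= K) ->
  (forall x, a <= x <= b -> h n x @[n --> \oo] --> f x) ->
  measurable_fun `[a, b] f /\
  \int[mu]_(x in `[a, b]) h n x @[n --> \oo] --> \int[mu]_(x in `[a, b]) f x.
Proof.
move=> mh hK hf.
have mf : measurable_fun `[a, b] (EFin \o f).
  apply: (emeasurable_fun_cvg (fun n => EFin \o h n)) => //.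
    by move=> n; exact/measurable_EFinP.
  move=> x; rewrite /= in_itv/= => xab.
  apply: cvg_EFin; first by near=> n.
  exact: hf.
split; first exact/measurable_EFinP.
have iK : mu.-integrable `[a, b] (EFin \o cst K).
  apply: (@bounded_integrable _ _ _ `|K|) => //.
have [] := @dominated_convergence _ _ R mu `[a, b] (measurable_itv _)
  (fun n => EFin \o h n) (EFin \o f) (EFin \o cst K).
- by move=> n; have /measurable_EFinP := mh n.
- by [].
- apply: aeW => x; rewrite /= in_itv/= => xab.
  by apply: cvg_EFin; [near=> n|exact: hf].
- by [].
- by apply: aeW => x n; rewrite /= in_itv/= => xab; rewrite lee_fin hK.
move=> iF _ cv.
have fin : (\int[mu]_(x in `[a, b]) (f x)%:E)%E \is a fin_num.
  exact: integrable_fin_num.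
by apply: fine_cvg; rewrite fineK.
Unshelve. all: by end_near. Qed.

End IntervalIntegrals.

(** * Scalar products and orthonormal families *)

Section L2.
Context {R : realType} (a b : R).
Notation mu := (@lebesgue_measure R).
Implicit Types (f g h : R -> R).
Let I : set R := `]a, b[.

Lemma L2_mul_integrable f g : L2 a b f -> L2 a b g ->
  mu.-integrable I (EFin \o (fun x => f x * g x)).
Proof.
move=> Lf Lg; have := Lfun2_mul_Lfun1 Lf Lg => /Lfun1_integrable.
rewrite (_ : EFin \o _ = (EFin \o (fun x => f x * g x)) \_ I).
  by move=> H; apply/integrable_mkcond => //; exact: measurable_itv.
apply/funext => x; rewrite /= !patchE; case: ifPn => //= _.
by rewrite mulr0.
Qed.

Lemma L2_lin k f g : L2 a b f -> L2 a b g -> L2 a b (fun x => k * f x + g x).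
Proof.
move=> Lf Lg; rewrite /L2.
have -> : (fun x => k * f x + g x) \_ `]a, b[ = k *: (f \_ `]a, b[) + g \_ `]a, b[.
  apply/funext => x; rewrite !fctE /= !patchE; case: ifPn => //= _.
  by rewrite scaler0 addr0.
have h1 : (1 <= 2%:E :> \bar R)%E by rewrite lee_fin ler1n.
exact: (Lfun_submod_closed mu h1).2.
Qed.

Lemma L2_bounded f (K : R) : measurable_fun I f -> (forall x, I x -> `|f x| <= K) ->
  L2 a b f.
Proof.
move=> mf fK; rewrite /L2 inE; apply/andP; split.
  by rewrite inE/=; apply/(measurable_restrictT _ (measurable_itv _)).
rewrite inE/= /finite_norm unlock poweR_lty//.
have mI : measurable I by exact: measurable_itv.
have fin : (mu I < +oo)%E.
  by rewrite /I lebesgue_measure_itv/=; case: ifP => // _; rewrite -EFinB ltry.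
apply: (@le_lt_trans _ _ (\int[mu]_(x in I) (K `^ 2)%:E)%E); last first.
  by rewrite integral_cst// lte_mul_pinfty// lee_fin powR_ge0.
rewrite [leRHS]integral_mkcond; apply: ge0_le_integral => //=.
- apply/measurable_EFinP.
  apply: (@measurableT_comp _ _ _ _ _ _ (@powR R ^~ 2)) => //.
  apply: measurableT_comp => //.
  by apply/(measurable_restrictT _ (measurable_itv _)).
- by apply/(measurable_restrictT _ (measurable_itv _)); exact: measurable_cst.
- move=> x _; rewrite !patchE; case: ifPn => [xI|_].
    rewrite lee_fin ge0_ler_powR ?nnegrE//; last by apply: fK; rewrite inE in xI.
    by apply: le_trans (fK x _) => //; rewrite inE in xI.
  by rewrite normr0 powR0.
Qed.

Lemma L2_0 : L2 a b (fun=> 0).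
Proof. by apply: (@L2_bounded _ 0) => // x _; rewrite normr0. Qed.

Lemma innerC f g : inner a b f g = inner a b g f.
Proof. by apply: eq_Rintegral => x _; rewrite mulrC. Qed.

Lemma inner_linl k f g h : L2 a b f -> L2 a b g -> L2 a b h ->
  inner a b (fun x => k * f x + g x) h = k * inner a b f h + inner a b g h.
Proof.
move=> Lf Lg Lh.
have ifh := L2_mul_integrable Lf Lh; have igh := L2_mul_integrable Lg Lh.
have ikfh : mu.-integrable I (EFin \o (fun x => k * (f x * h x))).
  exact: (@integrableZl _ _ R mu I (measurable_itv _) k _ ifh).
rewrite /inner -(@RintegralZl _ _ R mu I _ k (measurable_itv _) ifh).
rewrite -(@RintegralD _ _ R mu I _ _ (measurable_itv _) ikfh igh).
by apply: eq_Rintegral => x _; rewrite mulrDl mulrA.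
Qed.

Lemma inner_linr k f g h : L2 a b f -> L2 a b g -> L2 a b h ->
  inner a b h (fun x => k * f x + g x) = k * inner a b h f + inner a b h g.
Proof. by move=> *; rewrite innerC inner_linl// ![inner a b h _]innerC. Qed.

Lemma inner_ge0 f : 0 <= inner a b f f.
Proof. by apply: Rintegral_ge0 => x _; rewrite -expr2 sqr_ge0. Qed.

Section Sums.
Variables (phi : nat -> R -> R) (Lphi : forall n, L2 a b (phi n)).
Implicit Types (c : nat -> R) (N : nat).

Lemma L2_sum c N : L2 a b (fun x => \sum_(k < N) c k * phi k x).
Proof.
elim: N => [|N IH].
  by under eq_fun do rewrite big_ord0; exact: L2_0.
under eq_fun do rewrite big_ord_recr/= addrC.
exact: L2_lin.
Qed.

Lemma inner_suml c N g : L2 a b g ->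
  inner a b (fun x => \sum_(k < N) c k * phi k x) g = \sum_(k < N) c k * inner a b (phi k) g.
Proof.
move=> Lg; elim: N => [|N IH].
  rewrite big_ord0 /inner; under eq_Rintegral do rewrite big_ord0 mul0r.
  by rewrite Rintegral_cst ?mul0r//; exact: measurable_itv.
under [X in inner _ _ X]eq_fun do rewrite big_ord_recr/= addrC.
by rewrite inner_linl//; [rewrite IH big_ord_recr/= addrC|exact: L2_sum].
Qed.

Hypothesis ortho : forall m n, inner a b (phi m) (phi n) = (m == n)%:R.

Lemma inner_sum_coord c N n :
  inner a b (fun x => \sum_(k < N) c k * phi k x) (phi n) = if (n < N)%N then c n else 0.
Proof.
rewrite inner_suml//; case: ltnP => nN.
  rewrite (bigD1 (Ordinal nN))//= ortho eqxx mulr1 big1 ?addr0// => i.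
  by rewrite -val_eqE/= ortho => /negPf ->; rewrite mulr0.
by rewrite big1// => i _; rewrite ortho ltn_eqF ?mulr0// (leq_trans (ltn_ord i)).
Qed.

Lemma bessel_inequality g N : L2 a b g ->
  \sum_(k < N) inner a b g (phi k) ^+ 2 <= inner a b g g.
Proof.
move=> Lg; pose c k := inner a b g (phi k).
pose S x := \sum_(k < N) c k * phi k x.
have LS : L2 a b S by exact: L2_sum.
have LgS : L2 a b (fun x => (-1) * S x + g x) by exact: L2_lin.
have := inner_ge0 (fun x => (-1) * S x + g x).
rewrite inner_linl// !inner_linr//.
have -> : inner a b S S = \sum_(k < N) c k ^+ 2.
  rewrite inner_suml//; apply: eq_bigr => k _.
  by rewrite innerC inner_sum_coord ltn_ord expr2.
have -> : inner a b g S = \sum_(k < N) c k ^+ 2.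
  rewrite innerC inner_suml//; apply: eq_bigr => k _.
  by rewrite innerC expr2.
have -> : inner a b S g = \sum_(k < N) c k ^+ 2.
  rewrite inner_suml//; apply: eq_bigr => k _.
  by rewrite innerC expr2.
rewrite -/(c _); set s := \sum_(k < N) _; lra.
Qed.

End Sums.

End L2.

(** * A Gevrey bump of order 3/2 *)

Section GevreyFlat.
Context {R : realType}.
Implicit Types (q : seq (R * nat)) (t z w : R).

(* A list of pairs [(c, m)] stands for the polynomial [\sum c z^m]; applying
   [flat_next] to it differentiates [c z^m exp(-z^2)] with respect to [t = 1/z]. *)
Definition flat_next q : seq (R * nat) :=
  flatten [seq [:: (2 * x.1, (x.2 + 3)%N); (- (x.2%:R * x.1), x.2.+1)] | x <- q].

Definition flat_coef j := iter j flat_next [:: (1, 0%N)].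

Definition peval q z : R := \sum_(x <- q) x.1 * z ^+ x.2.

(** The [j]-th derivative of exp(-1/t^2) extended by 0. The exponent 2 gives Gevrey order 3/2;
    exp(-1/t) would have order 2, which the decay j!^(-2) of the Taylor coefficients merely
    balances. *)
Definition flat j t : R :=
  if 0 < t then peval (flat_coef j) t^-1 * expR (- (t^-1 ^+ 2)) else 0.

Lemma big_flat_next (F : R * nat -> R) q :
  \sum_(x <- flat_next q) F x =
  \sum_(x <- q) (F (2 * x.1, (x.2 + 3)%N) + F (- (x.2%:R * x.1), x.2.+1)).
Proof.
rewrite /flat_next big_flatten big_map; apply: eq_bigr => x _.
by rewrite big_cons big_seq1.
Qed.

Lemma flat_pos_is_derive q t : 0 < t ->
  is_derive t 1 (fun t => peval q t^-1 * expR (- (t^-1 ^+ 2)))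
    (peval (flat_next q) t^-1 * expR (- (t^-1 ^+ 2))).
Proof.
move=> t0; have tn0 : t != 0 by rewrite gt_eqF.
have dV : is_derive t 1 (fun t : R => t^-1) (- t^-1 ^+ 2).
  by apply: derE (is_deriveV tn0 (derI t)) _; rewrite /GRing.scale/= mulr1 exprVn.
have dE : is_derive t 1 (fun t => expR (- (t^-1 ^+ 2)))
    (2 * t^-1 ^+ 3 * expR (- (t^-1 ^+ 2))).
  apply: derE (der_comp (derN (derX 1 dV)) (is_derive_expR _)) _.
  by rewrite !exprS expr0; ring.
have dP : is_derive t 1 (fun t => peval q t^-1)
    (\sum_(x <- q) - (x.2%:R * x.1 * t^-1 ^+ x.2.+1)).
  rewrite /peval; elim: q => [|x q IH].
    under [X in is_derive _ _ X]eq_fun do rewrite big_nil.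
    by rewrite big_nil; exact: derC.
  under [X in is_derive _ _ X]eq_fun do rewrite big_cons.
  rewrite big_cons; apply: derD IH.
  case: x => c [|m] /=.
    rewrite mul0r mul0r oppr0; under [X in is_derive _ _ X]eq_fun do rewrite expr0 mulr1.
    exact: derC.
  apply: derE (derZ c (derX m dV)) _.
  by rewrite !exprS; ring.
apply: derE (derM dP dE) _.
rewrite mulrA -mulrDl; congr (_ * _).
rewrite /peval big_flat_next mulr_suml -big_split/=; apply: eq_bigr => x _.
by rewrite addn3 !exprS; ring.
Qed.

(** Raise y <= exp(y^2 / 2) with y = z / w to the power [m]; the condition on [m] makes the exponent
    at most z^2. *)
Lemma gauss_pow_le w z m : 0 < w -> 0 <= z -> m%:R <= 2 * w ^+ 2 ->
  z ^+ m * expR (- (z ^+ 2)) <= w ^+ m.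
Proof.
move=> w0 z0 mw; rewrite expRN ler_pdivrMr ?expR_gt0//.
have y0 : 0 <= z / w by rewrite divr_ge0// ltW.
have h : z / w <= expR ((z / w) ^+ 2 / 2).
  apply: le_trans (expR_ge1Dx _).
  rewrite -subr_ge0; have -> : 1 + (z / w) ^+ 2 / 2 - z / w = ((1 - z / w) ^+ 2 + 1) / 2.
    by field; rewrite gt_eqF.
  by rewrite divr_ge0// addr_ge0// sqr_ge0.
have -> : z ^+ m = w ^+ m * (z / w) ^+ m.
  by rewrite -exprMn mulrC mulfVK ?gt_eqF.
rewrite ler_pM2l ?exprn_gt0//.
apply: le_trans (lerXn2r m _ _ h) _; rewrite ?nnegrE ?expR_ge0//.
rewrite -expRM_natl ler_expR.
apply: (@le_trans _ _ (2 * w ^+ 2 * ((z / w) ^+ 2 / 2))).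
  by rewrite ler_wpM2r// divr_ge0// sqr_ge0.
by rewrite le_eqVlt; apply/orP; left; apply/eqP; field; rewrite gt_eqF.
Qed.

Definition pnorm w q : R := \sum_(x <- q) `|x.1| * w ^+ x.2.

Lemma peval_gauss_le w q z : 0 < w -> 0 <= z ->
  (forall x, x \in q -> x.2%:R <= 2 * w ^+ 2) ->
  `|peval q z * expR (- (z ^+ 2))| <= pnorm w q.
Proof.
move=> w0 z0 qw; rewrite /peval mulr_suml; apply: le_trans (ler_norm_sum _ _ _) _.
rewrite /pnorm big_seq [leRHS]big_seq; apply: ler_sum => x xq.
rewrite -mulrA normrM ler_wpM2l// ger0_norm ?mulr_ge0 ?exprn_ge0 ?expR_ge0//.
by apply: gauss_pow_le => //; exact: qw.
Qed.

Lemma flat_coef_degree j x : x \in flat_coef j -> (x.2 <= 3 * j)%N.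
Proof.
elim: j x => [|j IH] x; first by rewrite /= inE => /eqP ->.
rewrite /flat_coef iterS => /flattenP[s /mapP[y /IH yj ->]].
move: yj; rewrite !inE => yj /orP[] /eqP -> /=; rewrite mulnS.
  by rewrite addnC leq_add2l.
by apply: leq_ltn_trans yj _; rewrite -[X in (X < _)%N]add0n ltn_add2r.
Qed.

Lemma peval_bound q : exists C : R, forall z, 0 <= z -> `|peval q z * expR (- (z ^+ 2))| <= C.
Proof.
pose m := \sum_(x <- q) x.2.
pose w : R := m.+1%:R.
have w0 : 0 < w by rewrite ltr0n.
exists (pnorm w q) => z z0; apply: peval_gauss_le => // x xq.
have xm : (x.2 <= m)%N by rewrite /m (big_rem x)//= leq_addr.
apply: (@le_trans _ _ w); first by rewrite ler_nat leqW.
rewrite expr2 mulrA ler_peMl ?(ltW w0)// -[leLHS](mulr1 1) ler_pM// ?ler1n//.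
Qed.

Lemma flat_is_derive j t : is_derive t 1 (flat j) (flat j.+1 t).
Proof.
rewrite /flat; have [t0|t0|<-] := ltgtP 0 t.
- have -> : flat_coef j.+1 = flat_next (flat_coef j) by [].
  apply: (der_near (f := fun t => peval (flat_coef j) t^-1 * expR (- (t^-1 ^+ 2)))).
    near=> s; have s0 : 0 < s by near: s; exact: lt_nbhsr.
    by rewrite s0.
  exact: flat_pos_is_derive.
- apply: (der_near (f := fun=> 0)).
  near=> s; have s0 : s < 0 by near: s; exact: lt_nbhsl.
  by rewrite ltNge (ltW s0).
(* Raising every exponent by 2 turns mere boundedness into [flat j s = O(s ^+ 2)], hence a zero
   derivative at 0. *)
have [C HC] := peval_bound [seq (x.1, x.2.+2) | x <- flat_coef j].
have HC' (s : R) : 0 < s -> `|flat j s| <= C * s ^+ 2.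
  move=> s0; have := HC s^-1 (ltW _); rewrite invr_gt0 s0 => /(_ isT).
  rewrite /flat s0 /peval big_map.
  rewrite (eq_bigr (fun x : R * nat => s^-1 ^+ 2 * (x.1 * s^-1 ^+ x.2))); last first.
    by move=> x _ /=; rewrite !exprS; ring.
  rewrite -mulr_sumr -mulrA normrM ger0_norm ?exprn_ge0 ?invr_ge0 ?(ltW s0)//.
  by rewrite exprVn ler_pdivrMl ?exprn_gt0// [C * _]mulrC.
have C0 : 0 <= C by apply: le_trans (HC 0 (lexx _)).
have F0 : flat j 0 = 0 by rewrite /flat ltxx.
have H : h^-1 *: (flat j (h%:A + 0) - flat j 0) @[h --> 0^'] --> (0 : R).
  apply/cvgrPdist_le => e e0; near=> h.
  have h0 : h != 0 by near: h; exact: nbhs_dnbhs_neq.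
  have he : `|h| <= e / (C + 1).
    by near: h; apply: dnbhs0_le; rewrite divr_gt0// ltr_wpDl.
  rewrite F0 subr0 addr0 [_%:A]mulr1 sub0r normrN /GRing.scale/= normrM normfV.
  rewrite ler_pdivrMl ?normr_gt0//.
  have hb : `|flat j h| <= C * `|h| ^+ 2.
    have [h1|h1] := ltP 0 h; first by rewrite (gtr0_norm h1) HC'.
    by rewrite /flat ltNge h1/= normr0 mulr_ge0// exprn_ge0.
  apply: le_trans hb _; rewrite expr2 mulrA mulrC ler_wpM2l//.
  apply: le_trans (ler_wpM2l C0 he) _; rewrite mulrCA ler_piMr// ?ltW//.
  by rewrite ltr_pdivrMr ?mul1r ?ltrDl// ltr_wpDl.
have H' : derivable (flat j) 0 1 by apply/cvg_ex; exists 0.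
split => //; rewrite -/(flat j).
exact: (cvg_lim _ H).
Unshelve. all: by end_near. Qed.

(** One differentiation costs a factor [2 * w ^+ 3] from the exponential and, the exponents being at
    most [3 * K <= 3 / 2 * w ^+ 2], a factor [3 / 2 * w ^+ 3] from the powers. *)
Lemma pnorm_flat w j K : 0 < w -> 2 * K%:R <= w ^+ 2 -> (j <= K)%N ->
  pnorm w (flat_coef j) <= (4 * w ^+ 3) ^+ j.
Proof.
move=> w0 Kw; elim: j => [_|j IH jK].
  by rewrite /pnorm /= big_seq1/= normr1 mulr1.
have -> : flat_coef j.+1 = flat_next (flat_coef j) by [].
apply: (@le_trans _ _ (4 * w ^+ 3 * pnorm w (flat_coef j))); last first.
  rewrite [leRHS]exprS ler_wpM2l ?IH ?(ltnW jK)//.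
  by rewrite mulr_ge0// exprn_ge0// ltW.
rewrite /pnorm big_flat_next mulr_sumr big_seq [leRHS]big_seq; apply: ler_sum => x xq /=.
have xj : x.2%:R <= 3 / 2 * w ^+ 2.
  have : x.2%:R <= 3 * K%:R :> R.
    rewrite -natrM ler_nat (leq_trans (flat_coef_degree xq))// leq_mul2l/=.
    exact: ltnW.
  by move: Kw; lra.
rewrite normrN !normrM !normr_nat.
have wx : 0 <= w ^+ x.2 by rewrite exprn_ge0// ltW.
have c0 := normr_ge0 x.1.
apply: (@le_trans _ _ (2 * w ^+ 3 * (`|x.1| * w ^+ x.2) + 3 / 2 * w ^+ 2 * w * (`|x.1| * w ^+ x.2))).
  rewrite lerD//.
    by rewrite exprD le_eqVlt; apply/orP; left; apply/eqP; ring.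
  have -> : x.2%:R * `|x.1| * w ^+ x.2.+1 = x.2%:R * w * (`|x.1| * w ^+ x.2).
    by rewrite exprS; ring.
  by rewrite ler_wpM2r ?mulr_ge0// ler_wpM2r// ltW.
rewrite -mulrDl ler_wpM2r ?mulr_ge0//.
by have := exprn_gt0 3 w0; rewrite -(mulrA (3 / 2)) -exprSr; lra.
Qed.

End GevreyFlat.

(** * Gevrey bounds for the flat function and for a compactly supported bump *)

Section GevreyBump.
Context {R : realType}.
Notation mu := (@lebesgue_measure R).
Implicit Types (t z w a b : R).

(* Squared, so that the Gevrey order 3/2 shows as an integer power of [j!]. *)
Lemma flat_bound : exists2 D : R, 1 <= D &
  forall j t, flat j t ^+ 2 <= D ^+ j * j`!%:R ^+ 3.
Proof.
(* With [w ^+ 2 = 2 * n] the bound [(4 * w ^+ 3) ^+ n] squares to [(128 * n ^+ 3) ^+ n], and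
   [n ^+ n] is at most [expR n] times [n!]. *)
exists (128 * expR 1 ^+ 3).
  have := expR_ge1Dx (1 : R); set e := expR 1 => e2.
  have e1 : 1 <= e by lra.
  have : 1 <= e ^+ 3 by rewrite exprn_ege1.
  lra.
move=> j t; rewrite /flat; case: ifPn => [t0|_]; last first.
  by rewrite expr0n mulr_ge0 ?exprn_ge0 ?mulr_ge0// exprn_ge0// expR_ge0.
case: j => [|j].
  rewrite expr0 fact0 expr1n mulr1 /flat_coef /peval/= big_seq1/= expr0 !mul1r.
  by rewrite exprn_ile1 ?expR_ge0// -expR0 ler_expR oppr_le0 sqr_ge0.
set n := j.+1; pose w : R := Num.sqrt (2 * n%:R).
have w0 : 0 < w by rewrite sqrtr_gt0 mulr_gt0// ltr0n.
have w2 : w ^+ 2 = 2 * n%:R by rewrite sqr_sqrtr// mulr_ge0.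
have t1 : 0 <= t^-1 by rewrite invr_ge0 ltW.
have deg (x : R * nat) : x \in flat_coef n -> x.2%:R <= 2 * w ^+ 2.
  move=> /flat_coef_degree; rewrite -(ler_nat R) natrM w2 => h.
  by move: h (ler0n R n); lra.
have h : `|peval (flat_coef n) t^-1 * expR (- t^-1 ^+ 2)| <= (4 * w ^+ 3) ^+ n.
  apply: le_trans (peval_gauss_le w0 t1 deg) _.
  by apply: (@pnorm_flat _ _ _ n) => //; rewrite w2.
rewrite -real_normK ?num_real//.
apply: le_trans (lerXn2r 2 _ _ h) _; rewrite ?nnegrE ?exprn_ge0// ?mulr_ge0// ?exprn_ge0 ?(ltW w0)//.
have -> : ((4 * w ^+ 3) ^+ n) ^+ 2 = 128 ^+ n * (n%:R ^+ n) ^+ 3.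
  rewrite -!exprM mulnC [(n * 3)%N]mulnC !exprM -exprMn; congr (_ ^+ n).
  have -> : (4 * w ^+ 3) ^+ 2 = 16 * (w ^+ 2) ^+ 3 by ring.
  by rewrite w2; ring.
have := exp_term_le n (ler0n R n).
rewrite ler_pdivrMr ?ltr0n ?fact_gt0// => hn.
rewrite exprMn -mulrA ler_wpM2l ?exprn_ge0//.
have -> : expR 1 ^+ 3 ^+ n * n`!%:R ^+ 3 = (expR n%:R * n`!%:R) ^+ 3 :> R.
  by rewrite -[n%:R in RHS]mulr1 expRM_natl [RHS]exprMn -!exprM mulnC.
by rewrite lerXn2r ?nnegrE ?mulr_ge0 ?expR_ge0// exprn_ge0.
Qed.

(* The [j]-th derivative of [flat 0 (t - a) * flat 0 (b - t)]. *)
Definition flat_bump a b j t : R :=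
  \sum_(i < j.+1) 'C(j, i)%:R * (flat i (t - a) * ((-1) ^+ (j - i) * flat (j - i) (b - t))).

Lemma leibniz_is_derive (F G : nat -> R -> R) t :
  (forall i, is_derive t 1 (F i) (F i.+1 t)) ->
  (forall i, is_derive t 1 (G i) (G i.+1 t)) ->
  forall j, is_derive t 1 (fun t => \sum_(i < j.+1) 'C(j, i)%:R * (F i t * G (j - i)%N t))
    (\sum_(i < j.+2) 'C(j.+1, i)%:R * (F i t * G (j.+1 - i)%N t)).
Proof.
move=> dF dG j.
have d (n : nat) : is_derive t 1 (fun t => \sum_(i < n) 'C(j, i)%:R * (F i t * G (j - i)%N t))
   (\sum_(i < n) 'C(j, i)%:R * (F i.+1 t * G (j - i)%N t + F i t * G (j - i).+1 t)).
  elim: n => [|n IH].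
    under [X in is_derive _ _ X]eq_fun do rewrite big_ord0.
    by rewrite big_ord0; exact: derC.
  under [X in is_derive _ _ X]eq_fun do rewrite big_ord_recr/=.
  by rewrite big_ord_recr/=; exact: derD IH (derZ _ (derM (dF n) (dG _))).
apply: derE (d j.+1) _.
under eq_bigr do rewrite mulrDr.
rewrite big_split/= [RHS]big_ord_recl/= bin0 subn0.
under [X in _ = _ + X]eq_bigr => i _ do rewrite /bump/= add1n binS natrD mulrDl subSS.
rewrite [in RHS]big_split/= addrA [LHS]addrC; congr (_ + _).
rewrite big_ord_recl/= bin0 subn0; congr (_ + _).
rewrite [RHS]big_ord_recr/= bin_small// mul0r addr0.
by apply: eq_bigr => i _; rewrite /bump/= add1n subnSK.
Qed.

Lemma flat_bump_is_derive a b j t : is_derive t 1 (flat_bump a b j) (flat_bump a b j.+1 t).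
Proof.
have dF i : is_derive t 1 (fun t => flat i (t - a)) (flat i.+1 (t - a)).
  by apply: derE (der_comp (derB (derI t) (derC a t)) (flat_is_derive i _)) _; rewrite subr0 mulr1.
have dG i : is_derive t 1 (fun t => (-1) ^+ i * flat i (b - t)) ((-1) ^+ i.+1 * flat i.+1 (b - t)).
  apply: derE (derZ _ (der_comp (derB (derC b t) (derI t)) (flat_is_derive i _))) _.
  by rewrite exprS; ring.
exact: (leibniz_is_derive dF dG j).
Qed.

Lemma flat_bump_vanish a b j t : t <= a \/ b <= t -> flat_bump a b j t = 0.
Proof.
move=> h; rewrite /flat_bump big1// => i _; rewrite /flat !subr_gt0.
by case: h => h; [rewrite (ltNge a t)|rewrite (ltNge t b)]; rewrite h/= !(mulr0, mul0r).
Qed.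

Lemma flat_bump_bound : exists2 D : R, 0 <= D & forall a b j t,
  `|flat_bump a b j t| <= D ^+ j * Num.sqrt (j`!%:R ^+ 3).
Proof.
have [D D1 HD] := flat_bound.
have D0 : 0 <= D by lra.
(* The 2 comes from the sum of the binomials in the Leibniz rule; [i! * (j - i)! <= j!] keeps the
   Gevrey order of the factors. *)
exists (2 * Num.sqrt D) => [|a b j t]; first by rewrite mulr_ge0// sqrtr_ge0.
pose S : R := Num.sqrt (D ^+ j * j`!%:R ^+ 3).
have S0 : 0 <= S by exact: sqrtr_ge0.
apply: le_trans (ler_norm_sum _ _ _) _.
apply: (@le_trans _ _ (\sum_(i < j.+1) 'C(j, i)%:R * S)).
  apply: ler_sum => i _; rewrite normrM ger0_norm// ler_wpM2l//.
  have ij : (i <= j)%N by rewrite -ltnS.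
  rewrite -ler_sqr ?nnegrE// real_normK ?num_real// sqr_sqrtr ?mulr_ge0 ?exprn_ge0//.
  rewrite !exprMn sqrr_sign mul1r.
  apply: le_trans (ler_pM (sqr_ge0 _) (sqr_ge0 _) (HD _ _) (HD _ _)) _.
  rewrite mulrACA -exprD subnKC// -exprMn -natrM.
  rewrite ler_wpM2l ?exprn_ge0// lerXn2r ?nnegrE ?ler0n// ler_nat.
  by rewrite -(bin_fact ij) leq_pmull// bin_gt0.
rewrite -mulr_suml -natr_sum -(big_mkord xpredT (fun i => 'C(j, i))).
have -> : (\sum_(0 <= i < j.+1) 'C(j, i) = 2 ^ j)%N.
  rewrite -[2%N]/(1 + 1)%N expnDn big_mkord; apply: eq_bigr => i _.
  by rewrite !exp1n !muln1.
rewrite natrX exprMn -mulrA ler_wpM2l ?exprn_ge0//.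
rewrite /S sqrtrM ?exprn_ge0//.
have -> : D ^+ j = (Num.sqrt D ^+ j) ^+ 2 by rewrite -exprM mulnC exprM sqr_sqrtr.
by rewrite sqrtr_sqr ger0_norm// exprn_ge0// sqrtr_ge0.
Qed.

Lemma flat_bump_continuous a b j : continuous (flat_bump a b j).
Proof. by move=> t; exact: der_cont (flat_bump_is_derive a b j t). Qed.

Lemma flat_bump_ge0 a b t : 0 <= flat_bump a b 0 t.
Proof.
rewrite /flat_bump big_ord1 bin0 subnn expr0 !mul1r /flat /flat_coef /peval/= !big_seq1/=.
by rewrite !expr0 !mul1r; apply: mulr_ge0; case: ifP => // _; rewrite expR_ge0.
Qed.

Lemma flat_bump_integral_gt0 a b : a < b -> 0 < \int[mu]_(t in `[a, b]) flat_bump a b 0 t.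
Proof.
move=> ab; pose e := (b - a) / 4.
have e0 : 0 < e by rewrite divr_gt0// subr_gt0.
pose m : R := expR (- (e^-1 ^+ 2)) ^+ 2.
have m0 : 0 < m by rewrite exprn_gt0// expR_gt0.
have ce : a + e < b - e by rewrite /e; lra.
have bm t : a + e <= t <= b - e -> m <= flat_bump a b 0 t.
  move=> /andP[t1 t2]; rewrite /flat_bump big_ord1 bin0 subnn expr0 !mul1r.
  have f s : e <= s -> expR (- (e^-1 ^+ 2)) <= flat 0 s.
    move=> es; have s0 := lt_le_trans e0 es.
    rewrite /flat s0 /flat_coef /peval/= big_seq1/= expr0 !mul1r ler_expR lerN2.
    by rewrite lerXn2r ?nnegrE ?invr_ge0 ?(ltW s0) ?(ltW e0)// lef_pV2 ?posrE.
  by rewrite /m expr2; apply: ler_pM; rewrite ?expR_ge0//; apply: f; lra.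
have iab c d : mu.-integrable `[c, d] (EFin \o flat_bump a b 0).
  exact: segment_integrable (fun t _ => @flat_bump_continuous a b 0 t).
have lo : \int[mu]_(t in `[a + e, b - e]) (cst m t) <= \int[mu]_(t in `[a + e, b - e]) flat_bump a b 0 t.
  have icst : mu.-integrable `[a + e, b - e] (EFin \o cst m).
    by apply: segment_integrable => t _; exact: cvg_cst.
  apply: (@le_Rintegral _ _ R mu _ _ _ (measurable_itv _) icst (iab _ _)) => t.
  by rewrite /= in_itv/=; exact: bm.
rewrite Rintegral_cst//= in lo.
have hi : \int[mu]_(t in `[a + e, b - e]) flat_bump a b 0 t <= \int[mu]_(t in `[a, b]) flat_bump a b 0 t.
  rewrite /Rintegral fine_le//.
  - exact: (integrable_fin_num _ (iab _ _)).
  - exact: (integrable_fin_num _ (iab _ _)).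
  apply: ge0_subset_integral => //=.
  - by case/integrableP: (iab a b).
  - by move=> t _; rewrite lee_fin flat_bump_ge0.
  - by apply: subset_itv; rewrite bnd_simp; lra.
apply: lt_le_trans hi; apply: lt_le_trans lo.
rewrite lebesgue_measure_itv/= lte_fin ce -EFinB/=.
by rewrite mulr_gt0// subr_gt0.
Qed.

End GevreyBump.

(** * Weak solutions of second order equations *)

Section CompactSupport.
Context {R : realType}.
Notation mu := (@lebesgue_measure R).
Implicit Types (f g h p q F : R -> R) (a b c d l r x y : R).

Definition vanish_outside c d F := forall x, x \notin `[c, d] -> F x = 0.

Lemma vanish_outside_near c d F x : vanish_outside c d F -> x \notin `[c, d] ->
  \forall y \near x, F y = 0.
Proof.
move=> vF; rewrite in_itv/= negb_and -!ltNge => /orP[xc|dx].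
  near=> y; apply: vF; rewrite in_itv/= negb_and -!ltNge; apply/orP; left.
  by near: y; exact: lt_nbhsl.
near=> y; apply: vF; rewrite in_itv/= negb_and -!ltNge; apply/orP; right.
by near: y; exact: lt_nbhsr.
Unshelve. all: by end_near. Qed.

Lemma vanish_outside_derive c d F F' : vanish_outside c d F ->
  (forall x, is_derive x 1 F (F' x)) -> vanish_outside c d F'.
Proof.
move=> vF dF x xcd.
have /(der_near (g := fun=> 0))/(_ (dF x)) [_ <-] := vanish_outside_near vF xcd.
by rewrite derive_cst.
Qed.

Lemma in_open_itv l r c d x : l < c -> d < r -> x \in `[c, d] -> x \in `]l, r[.
Proof.
move=> lc dr; rewrite !in_itv/= => /andP[cx xd].
by rewrite (lt_le_trans lc cx) (le_lt_trans xd dr).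
Qed.

Lemma continuous_mul_support l r c d g h : l < c -> d < r ->
  {in `]l, r[, forall x, {for x, continuous g}} -> continuous h -> vanish_outside c d h ->
  continuous (fun x => g x * h x).
Proof.
move=> lc dr cg ch vh x; have [xcd|xcd] := boolP (x \in `[c, d]).
  by apply: cvgM; [exact: (cg x (in_open_itv lc dr xcd))|exact: ch].
have h0 : \forall y \near x, 0 = g y * h y.
  near=> y; have -> : h y = 0 by near: y; exact: vanish_outside_near vh xcd.
  by rewrite mulr0.
have H : g y * h y @[y --> x] --> (0 : R).
  have C : (fun=> 0 : R) y @[y --> x] --> (0 : R) by exact: cvg_cst.
  by apply: cvg_trans C; exact: near_eq_cvg.
have E : g x * h x = 0 by rewrite vh// mulr0.
by rewrite -E in H; exact: H.
Unshelve. all: by end_near. Qed.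

Lemma Rintegral_support (D : set R) c d F : vanish_outside c d F -> `[c, d] `<=` D ->
  \int[mu]_(x in D) F x = \int[mu]_(x in `[c, d]) F x.
Proof.
move=> vF cD; rewrite Rintegral_mkcond [RHS]Rintegral_mkcond.
congr (Rintegral _ _ _); apply/funext => x; rewrite !patchE.
case: ifPn => [_|xD]; case: ifPn => // xcd.
- by rewrite vF//; apply: contra xcd => xcd; rewrite inE.
- by move: xD; rewrite notin_setE; rewrite inE in xcd; move/(_ (cD x xcd)).
Qed.

Lemma support_integrable (D : set R) c d F : measurable (D : set (measurableTypeR R)) -> vanish_outside c d F -> `[c, d] `<=` D ->
  (forall x, c <= x <= d -> {for x, continuous F}) -> mu.-integrable D (EFin \o F).
Proof.
move=> mD vF cD cF; have := segment_integrable cF.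
move=> /(@integrable_mkcond _ _ R mu _ _ (measurable_itv _)) H.
apply/(@integrable_mkcond _ _ R mu D _ mD).
rewrite (_ : _ \_ D = (EFin \o F) \_ `[c, d])//.
apply/funext => x; rewrite !patchE.
case: ifPn => [_|xD]; case: ifPn => // xcd.
- by rewrite /= vF//; apply: contra xcd => xcd; rewrite inE.
- by move: xD; rewrite notin_setE; rewrite inE in xcd; move/(_ (cD x xcd)).
Qed.

Lemma primitive_support c d g : continuous g -> vanish_outside c d g ->
  \int[mu]_(x in `[c, d]) g x = 0 ->
  exists2 H, forall x, is_derive x 1 H (g x) & vanish_outside c d H.
Proof.
move=> cg vg g0.
(* Starting at [c - 1] instead of [c] puts every [x >= c] in the interior of the range used by the
   fundamental theorem. *)
pose H x := \int[mu]_(t in `[c - 1, x]) g t.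
have H0 x : x < c -> H x = 0.
  move=> xc; rewrite /H (@eq_Rintegral _ _ _ _ _ (fun=> 0)).
    by rewrite Rintegral_cst ?mul0r//; exact: measurable_itv.
  move=> t; rewrite inE/= in_itv/= => /andP[_ tx].
  by apply: vg; rewrite in_itv/= negb_and -!ltNge (le_lt_trans tx xc).
exists H; last first.
  move=> x; rewrite in_itv/= negb_and -!ltNge => /orP[/H0//|dx].
  have [cd|dc] := leP c d.
    rewrite /H (Rintegral_support vg)//.
    by apply: subset_itv; rewrite bnd_simp ?gerBl// ltW.
  rewrite /H (@eq_Rintegral _ _ _ _ _ (fun=> 0)).
    by rewrite Rintegral_cst ?mul0r//; exact: measurable_itv.
  move=> t _; apply: vg; rewrite in_itv/= negb_and -!ltNge.
  by have [|/(lt_le_trans dc) ->] := ltP t c; rewrite ?orbT.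
move=> x; have [xc|cx] := ltP x c.
  rewrite vg; last by rewrite in_itv/= negb_and -!ltNge xc.
  apply: (der_near (f := fun=> 0)).
  near=> y; apply/esym/H0; near: y; exact: lt_nbhsl.
have cx1 : c - 1 < x by rewrite ltrBlDr (le_lt_trans cx)// ltrDl.
have [||||dH dHE] := @continuous_FTC1_closed _ g (c - 1) x (x + 1).
- by rewrite ltrDl.
- by apply: segment_integrable => y _; exact: cg.
- by [].
- exact: cg.
- by split; [exact: dH|rewrite -derive1E].
Unshelve. all: by end_near. Qed.

End CompactSupport.

Section WeakSecondDerivative.
Context {R : realType}.
Notation mu := (@lebesgue_measure R).
Implicit Types (f g h p q w : R -> R) (c d l r x y : R).

Lemma test_function_support l r c d p p1 : l < c -> d < r ->
  (forall x, is_derive x 1 p (p1 x)) -> continuous p1 -> vanish_outside c d p ->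
  test_function l r p /\ derive1 p = p1.
Proof.
move=> lc dr dp cp vp; have E : derive1 p = p1.
  by apply/funext => x; rewrite derive1E; case: (dp x).
split=> //; split.
- by move=> x; case: (dp x).
- by rewrite E.
- by exists c, d.
Qed.

Lemma weak_derivative2_test l r c d f w p p1 p2 : l < c -> d < r ->
  weak_derivative2 l r f w ->
  (forall x, is_derive x 1 p (p1 x)) -> (forall x, is_derive x 1 p1 (p2 x)) ->
  continuous p2 -> vanish_outside c d p ->
  inner l r f p2 = inner l r w p.
Proof.
move=> lc dr [f1 [_ _ h1] [_ _ h2]] dp dp1 cp2 vp.
have vp1 := vanish_outside_derive vp dp.
have cp1 : continuous p1 by move=> x; exact: der_cont (dp1 x).
have [t0 E0] := test_function_support lc dr dp cp1 vp.
have [t1 E1] := test_function_support lc dr dp1 cp2 vp1.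
have := h1 _ t1; rewrite E1 => ->.
by have := h2 _ t0; rewrite E0 => ->; rewrite opprK.
Qed.

(* Testing against the variation of constants formula. *)
Lemma weak_ode_orthogonal l r c d (q f w e1 e2 d1 d2 h : R -> R) W : l < c -> d < r ->
  (forall x, l < x < r -> is_derive x 1 e1 (d1 x)) ->
  (forall x, l < x < r -> is_derive x 1 e2 (d2 x)) ->
  (forall x, l < x < r -> is_derive x 1 d1 (q x * e1 x)) ->
  (forall x, l < x < r -> is_derive x 1 d2 (q x * e2 x)) ->
  (forall x, l < x < r -> e1 x * d2 x - e2 x * d1 x = W) -> W != 0 ->
  (forall x, l < x < r -> {for x, continuous q}) ->
  (forall x, l < x < r -> {for x, continuous f}) ->
  weak_derivative2 l r f w ->
  (w = (fun x => q x * f x) %[ae mu in `]l, r[%classic]) ->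
  continuous h -> vanish_outside c d h ->
  inner l r e1 h = 0 -> inner l r e2 h = 0 -> inner l r f h = 0.
Proof.
move=> lc dr De1 De2 Dd1 Dd2 HW W0 cq cf wf wE ch vh o1 o2.
have sub : `[c, d] `<=` (`]l, r[ : set R).
  by move=> x /=; exact: in_open_itv.
have itvP x : c <= x <= d -> l < x < r.
  by move=> /andP[cx xd]; rewrite (lt_le_trans lc cx) (le_lt_trans xd dr).
have inP x : x \in `]l, r[ -> l < x < r by rewrite in_itv.
have prim e : {in `]l, r[, forall x, {for x, continuous e}} -> inner l r e h = 0 ->
    exists2 H, forall x, is_derive x 1 H (e x * h x) & vanish_outside c d H.
  move=> ce o; have vg : vanish_outside c d (fun x => e x * h x).
    by move=> x /vh ->; rewrite mulr0.
  apply: primitive_support => //; first exact: continuous_mul_support lc dr _ ch vh.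
  by rewrite -(Rintegral_support vg sub).
have [|H1 dH1 vH1] := prim e1 _ o1; first by move=> x /inP /De1; exact: der_cont.
have [|H2 dH2 vH2] := prim e2 _ o2; first by move=> x /inP /De2; exact: der_cont.
(* This solves p'' = q p + h. Orthogonality of [h] to [e1] and [e2] gives [H1] and [H2], hence [p],
   compact support, so [p] is an admissible test function; inserting it in the weak equation leaves
   the integral of [f * h]. *)
pose p x := W^-1 * (e2 x * H1 x - e1 x * H2 x).
pose p1 x := W^-1 * (d2 x * H1 x - d1 x * H2 x).
pose p2 x := if x \in `]l, r[ then q x * p x + h x else 0.
have vp : vanish_outside c d p.
  by move=> x xcd; rewrite /p vH1// vH2// !mulr0 subrr mulr0.
have vp1 : vanish_outside c d p1.
  by move=> x xcd; rewrite /p1 vH1// vH2// !mulr0 subrr mulr0.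
have vp2 : vanish_outside c d p2.
  move=> x xcd; rewrite /p2; case: ifPn => // _.
  by rewrite vp// vh// mulr0 addr0.
have out F F' : vanish_outside c d F -> vanish_outside c d F' -> forall x, x \notin `[c, d] -> is_derive x 1 F (F' x).
  move=> vF vF' x xcd; rewrite vF'//; apply: (der_near (f := fun=> 0)).
  near=> y; apply/esym; near: y; exact: vanish_outside_near vF xcd.
have dp x : is_derive x 1 p (p1 x).
  have [xcd|xcd] := boolP (x \in `[c, d]); last exact: out.
  have xlr := itvP x xcd.
  apply: derE (derZ W^-1 (derB (derM (De2 _ xlr) (dH1 x)) (derM (De1 _ xlr) (dH2 x)))) _.
  by rewrite /p1; ring.
have dp1 x : is_derive x 1 p1 (p2 x).
  have [xcd|xcd] := boolP (x \in `[c, d]); last exact: out.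
  have xlr := itvP x xcd.
  apply: derE (derZ W^-1 (derB (derM (Dd2 _ xlr) (dH1 x)) (derM (Dd1 _ xlr) (dH2 x)))) _.
  rewrite /p2 (in_open_itv lc dr xcd) /p.
  have hW := HW x xlr.
  transitivity (W^-1 * (q x * (e2 x * H1 x - e1 x * H2 x)) + W^-1 * (e1 x * d2 x - e2 x * d1 x) * h x).
    by ring.
  by rewrite hW mulVf// mul1r; ring.
have cp : continuous p by move=> x; exact: der_cont (dp x).
have cp2 : continuous p2.
  have cqp : continuous (fun x => q x * p x).
    by apply: continuous_mul_support lc dr _ cp vp => x /inP; exact: cq.
  rewrite (_ : p2 = fun x => q x * p x + h x); first by move=> x; apply: cvgD; [exact: cqp|exact: ch].
  apply/funext => x; rewrite /p2; case: ifPn => // xlr.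
  have xcd : x \notin `[c, d] by apply: contra xlr; exact: in_open_itv.
  by rewrite vp// vh// mulr0 addr0.
have key := weak_derivative2_test lc dr wf dp dp1 cp2 vp.
have mlr : measurable (`]l, r[ : set (measurableTypeR R)) by exact: measurable_itv.
have vF F G : vanish_outside c d G -> vanish_outside c d (fun x => F x * G x).
  by move=> vG x /vG ->; rewrite mulr0.
have i1 : mu.-integrable `]l, r[ (EFin \o (fun x => f x * (q x * p x))).
  apply: (support_integrable mlr _ sub); first exact: (vF f _ (vF q _ vp)).
  move=> x /itvP xlr; apply: cvgM; first exact: cf.
  by apply: cvgM; [exact: cq|exact: cp].
have i2 : mu.-integrable `]l, r[ (EFin \o (fun x => f x * h x)).
  apply: (support_integrable mlr _ sub); first exact: (vF f _ vh).
  by move=> x /itvP xlr; apply: cvgM; [exact: cf|exact: ch].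
have E1 : inner l r f p2 = inner l r f (fun x => q x * p x) + inner l r f h.
  rewrite /inner -(@RintegralD _ _ R mu _ _ _ (measurable_itv _) i1 i2).
  by apply: eq_Rintegral => x; rewrite inE/= => xlr; rewrite /p2 xlr mulrDr.
have E2 : inner l r w p = inner l r f (fun x => q x * p x).
  rewrite /inner /Rintegral; congr fine; apply: ae_eq_integral => //=.
  - apply/measurable_EFinP; apply: measurable_funM.
      by case: wf => f1 _ [_ []].
    apply: measurable_funS (continuous_measurable_fun cp) => //.
  - by case/integrableP: i1.
  - move: wE; apply: filterS; first exact: (ae_filter_ringOfSetsType mu).
    by move=> x /= H xlr; rewrite H//; congr EFin; ring.
move: key; rewrite E1 E2 => /eqP; rewrite eq_sym -subr_eq0 opprD addNKr oppr_eq0.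
by move/eqP.
Unshelve. all: by end_near. Qed.

End WeakSecondDerivative.

(** * Point values as limits of weighted means *)

Section TentAverages.
Context {R : realType}.
Notation mu := (@lebesgue_measure R).
Implicit Types (f g h q w : R -> R) (c d l r x y e : R).

(** The hat max(0, e - |x - y|), written with an absolute value to make continuity immediate. *)
Definition tent y e x : R := ((e - `|x - y|) + `|e - `|x - y| |) / 2.

Lemma tent_continuous y e : continuous (tent y e).
Proof.
move=> x; rewrite /tent; apply: cvgMl.
have ct : {for x, continuous (fun x => e - `|x - y|)}.
  apply: cvgB; first exact: cvg_cst.
  by apply: cvg_norm; apply: cvgB; [exact: cvg_id|exact: cvg_cst].
by apply: cvgD; [exact: ct|apply: cvg_norm; exact: ct].
Qed.

Lemma tent_ge0 y e x : 0 <= tent y e x.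
Proof.
rewrite /tent; set t := e - _; have := ler_norm (- t); rewrite normrN; lra.
Qed.

Lemma tent_vanish y e : vanish_outside (y - e) (y + e) (tent y e).
Proof.
move=> x; rewrite in_itv/= -ler_distl -ltNge => h.
have t0 : e - `|x - y| < 0 by rewrite subr_lt0.
by rewrite /tent (ltr0_norm t0) subrr mul0r.
Qed.

Lemma tent_ge y e x : `|x - y| <= e / 2 -> e / 2 <= tent y e x.
Proof.
move=> h; apply: (@le_trans _ _ (e - `|x - y|)); first by lra.
rewrite /tent; have := ler_norm (e - `|x - y|); lra.
Qed.

(** Needed because [weak_ode_orthogonal] speaks only of continuous weights with compact support, not
    of point evaluations. *)
Lemma avg_cvg l r g y : l < y < r ->
  (forall x, l < x < r -> {for x, continuous g}) ->
  inner l r g (tent y e) / inner l r (fun=> 1) (tent y e) @[e --> 0^'+] --> g y.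
Proof.
move=> /andP[ly yr] cg; apply/cvgrPdist_le => eta eta0.
have := cg y; rewrite ly yr => /(_ isT)/cvgrPdist_le/(_ _ eta0).
move=> /nbhs_ballP[dl /= dl0 Hdl].
near=> e.
have e0 : 0 < e by near: e; exact: nbhs_right_gt.
have edl : e < dl by near: e; exact: nbhs_right_lt.
have ely : l < y - e.
  by rewrite ltrBrDl -ltrBrDr; near: e; apply: nbhs_right_lt; rewrite subr_gt0.
have eyr : y + e < r.
  by rewrite -ltrBrDl; near: e; apply: nbhs_right_lt; rewrite subr_gt0.
have sub : `[y - e, y + e] `<=` (`]l, r[ : set R).
  by move=> x /=; exact: in_open_itv.
have mlr : measurable (`]l, r[ : set (measurableTypeR R)) by exact: measurable_itv.
have vF (F : R -> R) : vanish_outside (y - e) (y + e) (fun x => F x * tent y e x).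
  by move=> x /tent_vanish ->; rewrite mulr0.
have itvP x : y - e <= x <= y + e -> l < x < r.
  by move=> /andP[cx xd]; rewrite (lt_le_trans ely cx) (le_lt_trans xd eyr).
have iF (F : R -> R) : (forall x, l < x < r -> {for x, continuous F}) ->
    mu.-integrable `]l, r[ (EFin \o (fun x => F x * tent y e x)).
  move=> cF; apply: (support_integrable mlr (vF F) sub).
  by move=> x /itvP xlr; apply: cvgM; [exact: cF|exact: tent_continuous].
have icst k : mu.-integrable `]l, r[ (EFin \o (fun x => k * tent y e x)).
  by apply: (iF (fun=> k)) => x _; apply: cvg_cst.
have i1 := icst 1.
have Z0 : 0 < inner l r (fun=> 1) (tent y e).
  have e2 : 0 < e / 2 by rewrite divr_gt0.
  apply: (@lt_le_trans _ _ (\int[mu]_(x in `[y - e / 2, y + e / 2]) (e / 2))).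
    rewrite Rintegral_cst; last exact: measurable_itv.
    rewrite /= lebesgue_measure_itv/= lte_fin ifT; last by lra.
    by rewrite mulr_gt0//=; lra.
  rewrite Rintegral_mkcond /inner [leRHS]Rintegral_mkcond.
  apply: le_Rintegral => //.
  - rewrite -restrict_EFin; apply/(@integrable_mkcond _ _ R mu _ _ (measurable_itv _)).
    by apply: segment_integrable => x _; apply: cvg_cst.
  - rewrite (_ : EFin \o _ = (EFin \o (fun x => 1 * tent y e x)) \_ `]l, r[).
      by apply/(@integrable_mkcond _ _ R mu _ _ mlr); exact: i1.
    by apply/funext => x; rewrite restrict_EFin.
  - move=> x _; rewrite !patchE; case: ifPn => [|_].
      rewrite inE/= in_itv/= => xe.
      have xlr : x \in (`]l, r[%classic : set R).
        by rewrite inE; apply: sub; rewrite /= in_itv/=; move: xe e0; lra.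
      rewrite xlr mul1r; apply: tent_ge; rewrite ler_norml; move: xe; lra.
    by case: ifPn => // _; rewrite mul1r tent_ge0.
set Z := inner _ _ (fun=> 1) _ in Z0 *.
have ZE : g y = inner l r (fun=> g y) (tent y e) / Z.
  rewrite /inner -[X in _ = X / _](_ : g y * Z = _) ?mulfK ?gt_eqF//.
  rewrite /Z /inner -(@RintegralZl _ _ R mu _ _ _ mlr i1).
  by apply: eq_Rintegral => x _; rewrite mul1r.
rewrite {1}ZE -mulrBl normrM normfV (gtr0_norm Z0) ler_pdivrMr//.
have ic := icst (g y).
have ig := iF g cg.
rewrite /inner -(@RintegralB _ _ R mu _ _ _ mlr ic ig).
have iB : mu.-integrable `]l, r[ (EFin \o (fun x => g y * tent y e x - g x * tent y e x)).
  have := @integrableB _ _ R mu `]l, r[ mlr _ _ ic ig.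
  by apply: eq_integrable.
apply: le_trans (@le_normr_Rintegral _ _ R mu _ _ mlr iB) _.
rewrite /Z /inner -(@RintegralZl _ _ R mu _ _ _ mlr i1).
apply: (@le_Rintegral _ _ R mu _ _ _ mlr).
- exact: (@integrable_norm _ _ R mu).
- rewrite (_ : EFin \o _ = EFin \o (fun x => eta * tent y e x)); first exact: icst.
  by apply/funext => x /=; rewrite mul1r.
move=> x; rewrite /= in_itv/= => xlr.
rewrite -mulrBl normrM (ger0_norm (tent_ge0 _ _ _)) mul1r.
have [xe|xe] := boolP (x \in `[y - e, y + e]); last by rewrite tent_vanish// !mulr0.
rewrite ler_wpM2r ?tent_ge0//; apply: Hdl; rewrite /ball/= distrC.
apply: le_lt_trans edl; move: xe; rewrite in_itv/= ler_norml; lra.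
Unshelve. all: by end_near. Qed.

End TentAverages.

(** * Weak solutions are combinations of two classical ones *)

Section WeakOde.
Context {R : realType}.
Notation mu := (@lebesgue_measure R).
Implicit Types (f g h q w : R -> R) (c d l r x y e : R).

Lemma vanish_outsideW c d c' d' g : c' <= c -> d <= d' -> vanish_outside c d g ->
  vanish_outside c' d' g.
Proof.
move=> cc dd vg x xcd; apply: vg; apply: contra xcd; rewrite !in_itv/=.
by move=> /andP[cx xd]; rewrite (le_trans cc cx) (le_trans xd dd).
Qed.

Lemma inner_comb3 l r c d g T1 T2 T3 k1 k2 k3 : l < c -> d < r ->
  (forall x, l < x < r -> {for x, continuous g}) ->
  continuous T1 -> continuous T2 -> continuous T3 ->
  vanish_outside c d T1 -> vanish_outside c d T2 -> vanish_outside c d T3 ->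
  inner l r g (fun x => k1 * T1 x + k2 * T2 x + k3 * T3 x) =
  k1 * inner l r g T1 + k2 * inner l r g T2 + k3 * inner l r g T3.
Proof.
move=> lc dr cg c1 c2 c3 v1 v2 v3.
have mlr : measurable (`]l, r[ : set (measurableTypeR R)) by exact: measurable_itv.
have sub : `[c, d] `<=` (`]l, r[ : set R).
  by move=> x /=; exact: in_open_itv.
have iT (T : R -> R) k : continuous T -> vanish_outside c d T ->
    mu.-integrable `]l, r[ (EFin \o (fun x => k * (g x * T x))).
  move=> cT vT; apply: (support_integrable mlr _ sub).
    by move=> x /vT ->; rewrite !mulr0.
  move=> x /andP[cx xd]; apply: cvgM; first exact: cvg_cst.
  apply: cvgM; last exact: cT.
  by apply: cg; rewrite (lt_le_trans lc cx) (le_lt_trans xd dr).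
have iT1 (T : R -> R) : continuous T -> vanish_outside c d T ->
    mu.-integrable `]l, r[ (EFin \o (fun x => g x * T x)).
  move=> cT vT; have := iT T 1 cT vT.
  by rewrite (_ : (fun x => 1 * _) = (fun x => g x * T x))//; apply/funext => x; rewrite mul1r.
rewrite /inner.
rewrite -(@RintegralZl _ _ R mu _ _ k1 mlr (iT1 _ c1 v1)).
rewrite -(@RintegralZl _ _ R mu _ _ k2 mlr (iT1 _ c2 v2)).
rewrite -(@RintegralZl _ _ R mu _ _ k3 mlr (iT1 _ c3 v3)).
rewrite -(@RintegralD _ _ R mu _ _ _ mlr (iT _ k1 c1 v1) (iT _ k2 c2 v2)).
have i12 : mu.-integrable `]l, r[ (EFin \o (fun x => k1 * (g x * T1 x) + k2 * (g x * T2 x))).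
  exact: (@integrableD _ _ R mu _ mlr _ _ (iT _ k1 c1 v1) (iT _ k2 c2 v2)).
rewrite -(@RintegralD _ _ R mu _ _ _ mlr i12 (iT _ k3 c3 v3)).
by apply: eq_Rintegral => x _; ring.
Qed.

(** By [weak_ode_orthogonal], [f] annihilates every weight that [e1] and [e2] annihilate. Three
    tents weighted by the 2 by 2 minors of the means of [e1] and [e2] form such a weight; as the
    tents shrink, the determinant of [f], [e1], [e2] at any three points is seen to vanish. No
    regularity of [f] beyond continuity enters. *)
Lemma weak_ode_span l r (q f w e1 e2 d1 d2 : R -> R) W : l < r ->
  (forall x, l < x < r -> is_derive x 1 e1 (d1 x)) ->
  (forall x, l < x < r -> is_derive x 1 e2 (d2 x)) ->
  (forall x, l < x < r -> is_derive x 1 d1 (q x * e1 x)) ->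
  (forall x, l < x < r -> is_derive x 1 d2 (q x * e2 x)) ->
  (forall x, l < x < r -> e1 x * d2 x - e2 x * d1 x = W) -> W != 0 ->
  (forall x, l < x < r -> {for x, continuous q}) ->
  (forall x, l < x < r -> {for x, continuous f}) ->
  weak_derivative2 l r f w ->
  (w = (fun x => q x * f x) %[ae mu in `]l, r[%classic]) ->
  exists u v, forall x, l < x < r -> f x = u * e1 x + v * e2 x.
Proof.
move=> lr De1 De2 Dd1 Dd2 HW W0 cq cf wf wE.
have ce1 x : l < x < r -> {for x, continuous e1} by move/De1; exact: der_cont.
have ce2 x : l < x < r -> {for x, continuous e2} by move/De2; exact: der_cont.
have det y1 y2 y3 : l < y1 < r -> l < y2 < r -> l < y3 < r ->
  (e1 y2 * e2 y3 - e1 y3 * e2 y2) * f y1 + (e1 y3 * e2 y1 - e1 y1 * e2 y3) * f y2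
  + (e1 y1 * e2 y2 - e1 y2 * e2 y1) * f y3 = 0.
  move=> h1 h2 h3.
  pose A g y e := inner l r g (tent y e) / inner l r (fun=> 1) (tent y e).
  have cA g y : l < y < r -> (forall x, l < x < r -> {for x, continuous g}) ->
      A g y e @[e --> 0^'+] --> g y.
    by move=> ylr cg; exact: avg_cvg.
  pose D e := (A e1 y2 e * A e2 y3 e - A e1 y3 e * A e2 y2 e) * A f y1 e +
    (A e1 y3 e * A e2 y1 e - A e1 y1 e * A e2 y3 e) * A f y2 e +
    (A e1 y1 e * A e2 y2 e - A e1 y2 e * A e2 y1 e) * A f y3 e.
  have cD : D e @[e --> 0^'+] -->
     (e1 y2 * e2 y3 - e1 y3 * e2 y2) * f y1 + (e1 y3 * e2 y1 - e1 y1 * e2 y3) * f y2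
     + (e1 y1 * e2 y2 - e1 y2 * e2 y1) * f y3.
    have cT y y' y'' : l < y < r -> l < y' < r -> l < y'' < r ->
       (A e1 y e * A e2 y' e - A e1 y' e * A e2 y e) * A f y'' e @[e --> 0^'+] -->
       (e1 y * e2 y' - e1 y' * e2 y) * f y''.
      move=> g1 g2 g3; apply: (cvgM (cvgB (cvgM (cA _ _ g1 ce1) (cA _ _ g2 ce2))
        (cvgM (cA _ _ g2 ce1) (cA _ _ g1 ce2))) (cA _ _ g3 cf)).
    exact: cvgD (cvgD (cT _ _ _ h2 h3 h1) (cT _ _ _ h3 h1 h2)) (cT _ _ _ h1 h2 h3).
  rewrite -(cvg_lim _ cD)//; apply: lim_near_cst => //.
  pose m := Num.min y1 (Num.min y2 y3); pose M := Num.max y1 (Num.max y2 y3).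
  have lm : l < m by rewrite !lt_min; move/andP: h1 => [-> _]; move/andP: h2 => [-> _]; case/andP: h3.
  have Mr : M < r by rewrite !gt_max; move/andP: h1 => [_ ->]; move/andP: h2 => [_ ->]; case/andP: h3.
  have my y : y \in [:: y1; y2; y3] -> m <= y <= M.
    by rewrite !inE => /or3P[] /eqP ->; rewrite !ge_min !le_max !lexx ?orbT.
  near=> e.
  have e0 : 0 < e by near: e; exact: nbhs_right_gt.
  have lme : l < m - e.
    by rewrite ltrBrDl -ltrBrDr; near: e; apply: nbhs_right_lt; rewrite subr_gt0.
  have Mer : M + e < r.
    by rewrite -ltrBrDl; near: e; apply: nbhs_right_lt; rewrite subr_gt0.
  have vT y : y \in [:: y1; y2; y3] -> vanish_outside (m - e) (M + e) (tent y e).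
    move=> /my /andP[my' yM]; apply: (vanish_outsideW _ _ (@tent_vanish _ y e)); lra.
  have v1 := vT y1 (mem_head _ _).
  have v2 : vanish_outside (m - e) (M + e) (tent y2 e) by apply: vT; rewrite !inE eqxx orbT.
  have v3 : vanish_outside (m - e) (M + e) (tent y3 e) by apply: vT; rewrite !inE eqxx !orbT.
  pose Z y := inner l r (fun=> 1) (tent y e).
  pose s1 := A e1 y2 e * A e2 y3 e - A e1 y3 e * A e2 y2 e.
  pose s2 := A e1 y3 e * A e2 y1 e - A e1 y1 e * A e2 y3 e.
  pose s3 := A e1 y1 e * A e2 y2 e - A e1 y2 e * A e2 y1 e.
  pose h x := s1 / Z y1 * tent y1 e x + s2 / Z y2 * tent y2 e x + s3 / Z y3 * tent y3 e x.
  have ih g : (forall x, l < x < r -> {for x, continuous g}) ->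
      inner l r g h = s1 * A g y1 e + s2 * A g y2 e + s3 * A g y3 e.
    move=> cg; rewrite (inner_comb3 _ _ _ lme Mer)//; try exact: tent_continuous.
    rewrite /A -/(Z y1) -/(Z y2) -/(Z y3); ring.
  rewrite /D -/s1 -/s2 -/s3 -ih//.
  apply: (weak_ode_orthogonal lme Mer De1 De2 Dd1 Dd2 HW W0 cq cf wf wE).
  - move=> x; apply: cvgD; first apply: cvgD.
    + by apply: cvgMr; exact: tent_continuous.
    + by apply: cvgMr; exact: tent_continuous.
    + by apply: cvgMr; exact: tent_continuous.
  - by move=> x xcd; rewrite /h v1// v2// v3// !mulr0 !addr0.
  - by rewrite ih// /s1 /s2 /s3; ring.
  - by rewrite ih// /s1 /s2 /s3; ring.
pose x0 := (l + r) / 2.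
have x0lr : l < x0 < r by rewrite /x0; move: lr; lra.
(* If every such determinant with [x0] vanished, differentiating it at [x0] would give [W = 0]. *)
have [x1 x1lr D0] : exists2 x1, l < x1 < r & e1 x0 * e2 x1 - e1 x1 * e2 x0 != 0.
  apply: contrapT => H; move/eqP: W0; apply.
  have E y : l < y < r -> 0 = e1 x0 * e2 y - e1 y * e2 x0.
    move=> ylr; apply/esym; apply: contrapT => /eqP N; apply: H; by exists y.
  have dv : is_derive x0 1 (fun y => e1 x0 * e2 y - e1 y * e2 x0)
      (e1 x0 * d2 x0 - (d1 x0 * e2 x0 + e1 x0 * 0)).
    exact: derB (derZ _ (De2 _ x0lr)) (derM (De1 _ x0lr) (derC _ _)).
  have dv0 : is_derive x0 1 (fun y => e1 x0 * e2 y - e1 y * e2 x0) 0.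
    have /andP[lx xr] := x0lr.
    apply: (der_near (f := fun=> 0)); near=> y; apply: E; apply/andP; split; near: y.
      exact: lt_nbhsr.
    exact: lt_nbhsl.
  rewrite -(HW _ x0lr); case: dv => _ E1; case: dv0 => _; rewrite E1 => <-; ring.
set Dt := _ - _ in D0.
exists ((f x1 * e2 x0 * -1 + f x0 * e2 x1) / Dt), ((f x1 * e1 x0 - f x0 * e1 x1) / Dt).
move=> y ylr; have := det y x0 x1 ylr x0lr x1lr; rewrite -/Dt => h.
apply: (mulfI D0); move: h => /eqP; rewrite -subr_eq0 subr0 => /eqP h.
by apply/eqP; rewrite -subr_eq0 -h; apply/eqP; field.
Unshelve. all: by end_near. Qed.

End WeakOde.

(** * Eigenfunctions *)

Section Eigenfunction.
Context {R : realType} (nu : R) (nu_gt0 : 0 < nu) (nu_lt1 : nu < 1).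
Notation mu := (@lebesgue_measure R).
Implicit Types (u v l x y t : R) (f g w : R -> R).
Let sp : -1 < nu. Proof. by apply: lt_trans nu_gt0; rewrite ltrN10. Qed.
Let sm : -1 < - nu. Proof. by rewrite ltrN2. Qed.

Lemma der_scale (F F' : R -> R) t x : is_derive (t * x) 1 F (F' (t * x)) ->
  is_derive x 1 (fun x => F (t * x)) (t * F' (t * x)).
Proof.
move=> dF; apply: derE (der_comp (derZ t (derI x)) dF) _; ring.
Qed.

(** The sign [t] is 1 on the right half and -1 on the left: composing the Bessel solutions with
    multiplication by [t] treats both halves at once. *)
Lemma eigen_side l f w lo hi t : lo < hi -> t * t = 1 ->
  (forall x, lo < x < hi -> 0 < t * x) ->
  (forall x, lo < x < hi -> {for x, continuous f}) ->
  weak_derivative2 lo hi f w ->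
  (w = (fun x => (cpot nu / x ^+ 2 - l) * f x) %[ae mu in `]lo, hi[%classic]) ->
  exists u v, forall x, lo < x < hi -> f x = comb nu bsol u v l (t * x).
Proof.
move=> lohi tt1 pos cf wf wE.
pose e s x := bsol s l (t * x); pose d s x := t * dbsol s l (t * x).
have De s x : -1 < s -> lo < x < hi -> is_derive x 1 (e s) (d s x).
  move=> s1 /pos x0; exact: (@der_scale _ (dbsol s l) _ _ (bsol_is_derive s1 l x0)).
have sq x : (t * x) ^+ 2 = x ^+ 2 by rewrite exprMn expr2 tt1 mul1r.
have Dd s x : -1 < s -> s ^+ 2 = nu ^+ 2 -> lo < x < hi ->
    is_derive x 1 (d s) ((cpot nu / x ^+ 2 - l) * e s x).
  move=> s1 s2 /pos x0.
  apply: derE (derZ t (@der_scale _ (fun y => ((s ^+ 2 - 4^-1) / y ^+ 2 - l) * bsol s l y)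
     _ _ (dbsol_is_derive s1 l x0))) _.
  by rewrite mulrA tt1 mul1r /e /cpot s2 sq.
have nun : (- nu) ^+ 2 = nu ^+ 2 by rewrite sqrrN.
have HW x : lo < x < hi ->
    e nu x * d (- nu) x - e (- nu) x * d nu x = - (2 * nu) * t.
  by move=> /pos x0; have := bsol_wronskian sp nu_lt1 l x0; rewrite /e /d => <-; ring.
have W0 : - (2 * nu) * t != 0.
  rewrite mulf_neq0//; first by rewrite oppr_eq0 mulf_neq0// gt_eqF.
  by apply/eqP => t0; move: tt1; rewrite t0 mulr0 => /eqP; rewrite eq_sym oner_eq0.
have cq x : lo < x < hi -> {for x, continuous (fun x => cpot nu / x ^+ 2 - l)}.
  move=> xlr; have x0 : x != 0.
    by apply/eqP => x0; have := pos x xlr; rewrite x0 mulr0 ltxx.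
  apply: cvgB; last exact: cvg_cst.
  apply: cvgMr; apply: cvgV; first by rewrite expf_neq0.
  exact: exprn_continuous.
have [u [v uv]] := weak_ode_span lohi (fun x => De nu x sp) (fun x => De (- nu) x sm)
  (fun x => Dd nu x sp erefl) (fun x => Dd (- nu) x sm nun) HW W0 cq cf wf wE.
by exists u, v => x /uv ->.
Qed.

Definition pospow n x : R := Num.max 0 x ^+ n.

Lemma pospow_is_derive n x :
  is_derive x 1 (pospow n.+2) (n.+2%:R * pospow n.+1 x).
Proof.
have [x0|x0|->] := ltgtP x 0.
- rewrite /pospow (max_idPl (ltW x0)) expr0n mulr0.
  apply: (der_near (f := fun=> 0)); near=> y.
  have y0 : y < 0 by near: y; exact: lt_nbhsl.
  by rewrite (max_idPl (ltW y0)) expr0n.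
- rewrite /pospow (max_idPr (ltW x0)).
  apply: (der_near (f := fun y => y ^+ n.+2)); last first.
    by apply: derE (derX n.+1 (derI x)) _; rewrite mulr1.
  near=> y.
  have y0 : 0 < y by near: y; exact: lt_nbhsr.
  by rewrite (max_idPr (ltW y0)).
rewrite [X in is_derive _ _ _ X](_ : _ = 0); last by rewrite /pospow maxxx expr0n mulr0.
have H : (h : R)^-1 *: (pospow n.+2 (h + 0) - pospow n.+2 0 : R^o) @[h --> 0^'] --> (0 : R).
  apply/cvgrPdist_le => e e0; near=> h.
  have h0 : h != 0 by near: h; exact: nbhs_dnbhs_neq.
  have he : `|h| <= e by near: h; apply: dnbhs0_le.
  have h1 : `|h| <= 1 by near: h; apply: dnbhs0_le.
  rewrite sub0r normrN /pospow maxxx expr0n subr0 addr0 /GRing.scale/= normrM normfV normrX.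
  rewrite ler_pdivrMl ?normr_gt0//.
  have mh : `|Num.max 0 h| <= `|h|.
    by have [h00|h00] := leP 0 h; rewrite ?normr0.
  apply: (@le_trans _ _ (`|h| ^+ n.+2)); first by rewrite lerXn2r// nnegrE.
  rewrite exprS ler_wpM2l// exprS; apply: le_trans he.
  by rewrite ler_piMr// exprn_ile1.
have H' : derivable (pospow n.+2) 0 1.
  apply/cvg_ex; exists 0; move: H; apply: cvg_trans; apply: near_eq_cvg.
  by near=> h; rewrite /= [_%:A]mulr1.
split => //; rewrite -derive1E; exact: (cvg_lim _ H).
Unshelve. all: by end_near. Qed.

End Eigenfunction.

(** * Explicit twice differentiable test functions *)

Section SingularTest.
Context {R : realType}.
Notation mu := (@lebesgue_measure R).
Implicit Types (x y t e al be : R) (f g w : R -> R).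

Lemma pospow1_continuous : continuous (@pospow R 1).
Proof.
move=> x; have -> : @pospow R 1 = fun x => (x + `|x|) / 2.
  apply/funext => y; rewrite /pospow expr1.
  by have [y0|y0] := leP 0 y; [rewrite ger0_norm//|rewrite ltr0_norm//]; lra.
apply: cvgMl; apply: cvgD; first exact: cvg_id.
exact: norm_continuous.
Qed.

(** The cubed positive part of a parabola: C^2, as a second weak derivative requires of its test
    functions, and with an explicit integral. *)
Definition bump al be x : R := pospow 3 ((x - al) * (be - x)).
Definition dbump al be x : R := 3 * pospow 2 ((x - al) * (be - x)) * (al + be - 2 * x).
Definition ddbump al be x : R :=
  6 * pospow 1 ((x - al) * (be - x)) * (al + be - 2 * x) ^+ 2
  - 6 * pospow 2 ((x - al) * (be - x)).

Let dz al be x : is_derive x 1 (fun x => (x - al) * (be - x)) (al + be - 2 * x).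
Proof.
apply: derE (derM (derB (derI x) (derC al x)) (derB (derC be x) (derI x))) _; ring.
Qed.

Lemma bump_is_derive al be x : is_derive x 1 (bump al be) (dbump al be x).
Proof. exact: der_comp (dz al be x) (pospow_is_derive 1 _). Qed.

Lemma dbump_is_derive al be x : is_derive x 1 (dbump al be) (ddbump al be x).
Proof.
have d1 := der_comp (dz al be x) (pospow_is_derive 0 ((x - al) * (be - x))).
apply: derE (derM (derZ 3 d1) (derB (derC (al + be) x) (derZ 2 (derI x)))) _.
rewrite /ddbump; ring.
Qed.

Lemma ddbump_continuous al be : continuous (ddbump al be).
Proof.
move=> x; have cz := der_cont (dz al be x).
have c2 := der_cont (der_comp (dz al be x) (pospow_is_derive 0 ((x - al) * (be - x)))).
apply: cvgB; last exact: cvgMr.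
apply: cvgM.
  apply: cvgMr; exact: (@continuous_comp _ _ _ (fun y => (y - al) * (be - y))
    (@pospow R 1) x cz (@pospow1_continuous _)).
have c3 := der_cont (derX 1 (derB (derC (al + be) x) (derZ 2 (derI x)))).
exact: c3.
Qed.

Lemma bump_ge0 al be x : 0 <= bump al be x.
Proof. by rewrite exprn_ge0// le_max lexx. Qed.

Lemma bump_inside al be x : al <= x <= be -> bump al be x = ((x - al) * (be - x)) ^+ 3.
Proof.
by move=> xab; rewrite /bump /pospow (max_idPr _)// mulr_ge0//; move: xab; lra.
Qed.

Lemma bump_vanish al be : al < be -> vanish_outside al be (bump al be).
Proof.
move=> ab x; rewrite in_itv/= negb_and -!ltNge => xab.
rewrite /bump /pospow (max_idPl _) ?expr0n//.
case/orP: xab => h.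
  by rewrite mulr_le0_ge0//; move: h ab; lra.
by rewrite mulr_ge0_le0//; move: h ab; lra.
Qed.

Lemma bump_end al be x : (x - al) * (be - x) = 0 -> bump al be x = 0 /\ dbump al be x = 0.
Proof.
by move=> h; rewrite /bump /dbump h /pospow maxxx !expr0n/= mulr0 mul0r.
Qed.

Lemma bump_green al be g g1 g2 : al < be ->
  (forall x, al <= x <= be -> is_derive x 1 g (g1 x)) ->
  (forall x, al <= x <= be -> is_derive x 1 g1 (g2 x)) ->
  (forall x, al <= x <= be -> {for x, continuous g2}) ->
  \int[mu]_(x in `[al, be]) (g x * ddbump al be x) =
  \int[mu]_(x in `[al, be]) (g2 x * bump al be x).
Proof.
move=> ab dg dg1 cg2.
have cb x : {for x, continuous (bump al be)} := der_cont (bump_is_derive al be x).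
have c1 x : al <= x <= be -> {for x, continuous (fun x => g x * ddbump al be x)}.
  by move=> h; apply: cvgM; [exact: der_cont (dg x h)|exact: ddbump_continuous].
have c2 x : al <= x <= be -> {for x, continuous (fun x => g2 x * bump al be x)}.
  by move=> h; apply: cvgM; [exact: cg2|exact: cb].
apply/eqP; rewrite -subr_eq0.
rewrite -(@RintegralB _ _ R mu _ _ _ (measurable_itv _) (segment_integrable c1) (segment_integrable c2)).
apply/eqP; pose F x := g x * dbump al be x - g1 x * bump al be x.
transitivity (F be - F al); last first.
  rewrite /F; have [-> ->] := @bump_end al be be (etrans (congr1 (fun z => (be - al) * z) (subrr be)) (mulr0 _)).
  have [-> ->] := @bump_end al be al (etrans (congr1 (fun z => z * (be - al)) (subrr al)) (mul0r _)).
  by rewrite !mulr0 !subrr.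
apply: FTC2_is_derive.
- exact: ltW.
- move=> x h; apply: derE (derB (derM (dg x h) (dbump_is_derive al be x))
    (derM (dg1 x h) (bump_is_derive al be x))) _; ring.
- by move=> x h; apply: cvgB; [exact: c1|exact: c2].
Qed.

(** The constant 1/140 is the Beta value B(4, 4) = 3! 3! / 7!. *)
Lemma bump_integral al be : al < be ->
  \int[mu]_(x in `[al, be]) bump al be x = (be - al) ^+ 7 / 140.
Proof.
move=> ab; set e := be - al.
pose F x := e ^+ 3 / 4 * (x - al) ^+ 4 - 3 * e ^+ 2 / 5 * (x - al) ^+ 5
   + e / 2 * (x - al) ^+ 6 - 7^-1 * (x - al) ^+ 7.
transitivity (\int[mu]_(x in `[al, be]) ((x - al) * (be - x)) ^+ 3).
  by apply: eq_Rintegral => x; rewrite inE/= in_itv/=; exact: bump_inside.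
transitivity (F be - F al); last by rewrite /F -/e subrr !expr0n/=; field.
apply: FTC2_is_derive.
- exact: ltW.
- move=> x _; have d := derB (derI x) (derC al x).
  apply: derE (derB (derD (derB (derZ (e ^+ 3 / 4) (derX 3 d)) (derZ (3 * e ^+ 2 / 5) (derX 4 d)))
   (derZ (e / 2) (derX 5 d))) (derZ 7^-1 (derX 6 d))) _.
  by rewrite /e; field.
- by move=> x _; exact: der_cont (derX 2 (dz al be x)).
Qed.

End SingularTest.

(** * H^2 regularity excludes a singular second derivative *)

Section NoSingularPart.
Context {R : realType}.
Notation mu := (@lebesgue_measure R).

(* Tested against a bump on [[e, 2e]], [fr''] would be bounded below by [e^(nu - 3/2)],
   whose square is not integrable near 0. *)
Lemma H2_no_singular (nu : R) (fr G G1 G2 : R -> R) (t dl y0 sg : R) :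
  nu < 1 -> H2 (-1) 1 fr -> t * t = 1 ->
  (forall x : R, -1 < x < 1 -> 0 < t * x -> fr x = G (t * x)) ->
  (forall y : R, 0 < y < 1 -> is_derive y 1 G (G1 y)) ->
  (forall y : R, 0 < y < 1 -> is_derive y 1 G1 (G2 y)) ->
  (forall y : R, 0 < y < 1 -> {for y, continuous G2}) ->
  0 < dl -> 0 < y0 ->
  (forall y : R, 0 < y < y0 -> dl * y `^ (nu - 3 / 2) <= sg * G2 y) -> False.
Proof.
move=> nu1 [_ [f1 [f2 [_ Lf2 wf1 wf2]]]] tt1 frG dG dG1 cG2 dl0 y00 lb.
pose F := inner (-1) 1 f2 f2.
(* The inverse of the factor of [e ^+ 7] in the bump integral [(e / 2) ^+ 7 / 140]. The inequality
   [key] is absurd as [e] tends to 0, since the exponent [2 - 2 * nu] is positive. *)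
have [K [KE K0]] : exists K : R, K = 128 * 140 /\ 0 < K by exists (128 * 140); split.
have key (e : R) : 0 < e -> e < y0 -> e < 1 -> dl ^+ 2 <= K * sg ^+ 2 * F * e `^ (2 - 2 * nu).
  move=> e0 ey e1.
  (* The interval is the image of [e / 2, e] under multiplication by the sign [t]. *)
  pose al := t * (3 / 4) * e - e / 4; pose be := t * (3 / 4) * e + e / 4.
  have ab : al < be by rewrite /al /be; move: e0; lra.
  have tab (x : R) : al <= x <= be -> e / 2 <= t * x <= e.
    move=> xab; have : `|x - t * (3 / 4) * e| <= e / 4.
      by rewrite ler_norml; move: xab; rewrite /al /be; lra.
    have t1 : `|t| = 1.
      by apply/eqP; rewrite -(@eqrXn2 _ 2)// expr1n -normrX expr2 tt1 normr1.
    have E : t * x - 3 / 4 * e = t * (x - t * (3 / 4) * e).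
      by transitivity (t * x - t * t * (3 / 4) * e); [rewrite tt1|]; ring.
    rewrite -[X in X <= _]mul1r -{1}t1 -normrM -E ler_norml; lra.
  have x1 (x : R) : al <= x <= be -> -1 < x < 1.
    move=> xab; have := tab x xab => txe.
    have xE : x = t * (t * x) by rewrite mulrA tt1 mul1r.
    have t1 : `|t| = 1.
      by apply/eqP; rewrite -(@eqrXn2 _ 2)// expr1n -normrX expr2 tt1 normr1.
    rewrite -ltr_norml xE normrM t1 mul1r ger0_norm; move: txe e0 e1; lra.
  have /andP[al1 _] : -1 < al < 1 by apply: x1; rewrite lexx ltW.
  have /andP[_ be1] : -1 < be < 1 by apply: x1; rewrite lexx ltW.
  have ty (x : R) : al <= x <= be -> 0 < t * x < 1.
    by move=> /tab; move: e0 e1; lra.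
  have sub : `[al, be] `<=` (`]-1, 1[ : set R) by move=> x /=; exact: in_open_itv.
  have wfr : weak_derivative2 (-1) 1 fr f2 by exists f1.
  have T := weak_derivative2_test al1 be1 wfr (bump_is_derive al be) (dbump_is_derive al be)
    (@ddbump_continuous _ al be) (bump_vanish ab).
  have vdd : vanish_outside al be (ddbump al be).
    apply: vanish_outside_derive (dbump_is_derive al be).
    exact: vanish_outside_derive (bump_vanish ab) (bump_is_derive al be).
  have cb : continuous (bump al be) by move=> x; exact: der_cont (bump_is_derive al be x).
  pose P := bump al be.
  pose g2 x := G2 (t * x).
  have cg2 (x : R) : al <= x <= be -> {for x, continuous g2}.
    move=> /ty h; apply: (@continuous_comp _ _ _ (fun x => t * x) G2); last exact: cG2.
    exact: der_cont (derZ t (derI x)).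
  have E1 : inner (-1) 1 fr (ddbump al be) = \int[mu]_(x in `[al, be]) (g2 x * P x).
    rewrite /inner (Rintegral_support _ sub); last by move=> x /vdd ->; rewrite mulr0.
    transitivity (\int[mu]_(x in `[al, be]) (G (t * x) * ddbump al be x)).
      apply: eq_Rintegral => x; rewrite inE/= in_itv/= => h.
      by rewrite frG ?x1//; case/andP: (ty x h).
    apply: (@bump_green _ al be (fun x => G (t * x)) (fun x => t * G1 (t * x))) => //.
    - by move=> x /ty h; exact: der_scale (dG _ h).
    - move=> x /ty h; apply: derE (derZ t (der_scale (dG1 _ h))) _.
      by rewrite mulrA tt1 mul1r.
  pose Z := \int[mu]_(x in `[al, be]) P x.
  have ZE : Z = (e / 2) ^+ 7 / 140.
    by rewrite /Z bump_integral//; congr (_ ^+ 7 / _); rewrite /al /be; field.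
  pose m := dl * e `^ (nu - 3 / 2).
  have m0 : 0 < m by rewrite mulr_gt0// powR_gt0.
  have mg (x : R) : al <= x <= be -> m <= sg * g2 x.
    move=> xab; have /andP[h1 h2] := tab x xab; have /andP[h3 _] := ty x xab.
    apply: le_trans (lb (t * x) _); last by rewrite h3/=; exact: le_lt_trans h2 ey.
    rewrite ler_pM2l// (_ : nu - 3 / 2 = - (3 / 2 - nu)); last by ring.
    rewrite !powRN lef_pV2 ?posrE ?powR_gt0// ge0_ler_powR ?nnegrE ?(ltW h3) ?(ltW e0)//.
    by move: nu1; lra.
  have iP : mu.-integrable `[al, be] (EFin \o P) by apply: segment_integrable => x _; exact: cb.
  have P0 (x : R) : 0 <= P x by exact: bump_ge0.
  have lower : m * Z <= sg * inner (-1) 1 f2 P.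
    rewrite -T E1 -(@RintegralZl _ _ R mu _ _ m (measurable_itv _) iP).
    have ig : mu.-integrable `[al, be] (EFin \o (fun x => g2 x * P x)).
      by apply: segment_integrable => x h; apply: cvgM; [exact: cg2|exact: cb].
    rewrite -(@RintegralZl _ _ R mu _ _ sg (measurable_itv _) ig).
    apply: (@le_Rintegral _ _ R mu _ _ _ (measurable_itv _)).
    - exact: (@integrableZl _ _ R mu _ (measurable_itv _) _ _ iP).
    - exact: (@integrableZl _ _ R mu _ (measurable_itv _) _ _ ig).
    - by move=> x; rewrite /= in_itv/= => h; rewrite mulrA ler_wpM2r// mg.
  have Pe (x : R) : P x <= e ^+ 6.
    have [h|h] := boolP (x \in `[al, be]); last by rewrite /P (bump_vanish ab)// exprn_ge0// ltW.
    move: h; rewrite in_itv/= => h; rewrite /P bump_inside// (_ : 6 = 2 * 3)%N// exprM.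
    have he : 0 <= (x - al) * (be - x) by rewrite mulr_ge0//; move: h; lra.
    rewrite lerXn2r ?nnegrE ?exprn_ge0 ?(ltW e0)//.
    rewrite expr2.
    by apply: ler_pM; move: h e0; rewrite /al /be; lra.
  have LP : L2 (-1) 1 P.
    apply: (@L2_bounded _ _ _ _ (e ^+ 6)).
      by apply: measurable_funTS; exact: continuous_measurable_fun.
    by move=> x _; rewrite ger0_norm.
  have mI : measurable (`]-1, 1[ : set (measurableTypeR R)) by exact: measurable_itv.
  have i1 : mu.-integrable `]-1, 1[ (EFin \o (fun x => sg * (f2 x * P x))).
    exact: (@integrableZl _ _ R mu _ mI _ _ (L2_mul_integrable Lf2 LP)).
  have i2 : mu.-integrable `]-1, 1[ (EFin \o (fun x => sg ^+ 2 * e ^+ 6 / (2 * m) * (f2 x * f2 x))).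
    exact: (@integrableZl _ _ R mu _ mI _ _ (L2_mul_integrable Lf2 Lf2)).
  have iP' : mu.-integrable `]-1, 1[ (EFin \o P).
    by apply: (support_integrable mI (bump_vanish ab) sub) => x _; exact: cb.
  have i3 : mu.-integrable `]-1, 1[ (EFin \o (fun x => m / 2 * P x)).
    exact: (@integrableZl _ _ R mu _ mI _ _ iP').
  (* Young's inequality with weight [m]: the term [m / 2 * Z] is absorbed by half of the lower
     bound. *)
  have upper : sg * inner (-1) 1 f2 P <= m / 2 * Z + sg ^+ 2 * e ^+ 6 / (2 * m) * F.
    rewrite /F /inner -(@RintegralZl _ _ R mu _ _ sg mI (L2_mul_integrable Lf2 LP)).
    rewrite -(@RintegralZl _ _ R mu _ _ _ mI (L2_mul_integrable Lf2 Lf2)).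
    rewrite /Z -(Rintegral_support (bump_vanish ab) sub).
    rewrite -(@RintegralZl _ _ R mu _ _ (m / 2) mI iP').
    rewrite -(@RintegralD _ _ R mu _ _ _ mI i3 i2).
    apply: (@le_Rintegral _ _ R mu _ _ _ mI i1).
      exact: (@integrableD _ _ R mu _ mI _ _ i3 i2).
    move=> x _; rewrite -/(P x).
    have am : sg * f2 x <= m / 2 + (sg * f2 x) ^+ 2 / (2 * m).
      rewrite -subr_ge0; set a := sg * f2 x.
      have -> : m / 2 + a ^+ 2 / (2 * m) - a = (m - a) ^+ 2 / (2 * m).
        by field; rewrite gt_eqF.
      by rewrite divr_ge0 ?sqr_ge0// mulr_ge0// ltW.
    have q0 : 0 <= (sg * f2 x) ^+ 2 / (2 * m) by rewrite divr_ge0 ?sqr_ge0// mulr_ge0// ltW.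
    apply: (@le_trans _ _ ((m / 2 + (sg * f2 x) ^+ 2 / (2 * m)) * P x)).
      by rewrite mulrA ler_wpM2r.
    rewrite mulrDl lerD2l.
    apply: le_trans (ler_wpM2l q0 (Pe x)) _.
    by rewrite le_eqVlt; apply/orP; left; apply/eqP; field; rewrite gt_eqF.
  have h1 : m * Z <= m / 2 * Z + sg ^+ 2 * e ^+ 6 / (2 * m) * F by exact: le_trans upper.
  have h2 : m ^+ 2 * Z <= sg ^+ 2 * e ^+ 6 * F.
    rewrite -subr_ge0; rewrite -subr_ge0 in h1.
    have -> : sg ^+ 2 * e ^+ 6 * F - m ^+ 2 * Z =
       2 * m * (m / 2 * Z + sg ^+ 2 * e ^+ 6 / (2 * m) * F - m * Z).
      by field; rewrite gt_eqF.
    by rewrite mulr_ge0// mulr_ge0// ltW.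
  have pe : e `^ (nu - 3 / 2) ^+ 2 * e * e `^ (2 - 2 * nu) = 1.
    have en0 : e != 0 by rewrite gt_eqF.
    rewrite expr2 -!powRD ?en0 ?implybT// -[X in _ * X * _](powRr1 (ltW e0)).
    rewrite -!powRD ?en0 ?implybT// -[RHS](powRr0 e).
    by congr (_ `^ _); field.
  have h3 : dl ^+ 2 * (e `^ (nu - 3 / 2) ^+ 2 * e) <= K * sg ^+ 2 * F.
    rewrite -(ler_pM2l (exprn_gt0 6 e0)).
    have -> : e ^+ 6 * (dl ^+ 2 * (e `^ (nu - 3 / 2) ^+ 2 * e)) = K * (m ^+ 2 * Z).
      by rewrite ZE /m KE; field.
    have -> : e ^+ 6 * (K * sg ^+ 2 * F) = K * (sg ^+ 2 * e ^+ 6 * F) by ring.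
    by rewrite ler_pM2l.
  have := ler_wpM2r (powR_ge0 e (2 - 2 * nu)) h3.
  by rewrite -[X in X <= _]mulrA pe mulr1.
have cl : K * sg ^+ 2 * F * e `^ (2 - 2 * nu) @[e --> 0^'+] --> K * sg ^+ 2 * F * 0.
  by apply: cvgMr; apply: powR_cvg0; move: nu1; lra.
have : dl ^+ 2 <= 0.
  rewrite -[leRHS](mulr0 (K * sg ^+ 2 * F)) -(cvg_lim _ cl)//.
  apply: limr_ge; first exact: cvgP cl.
  near=> e; apply: key; near: e.
  - exact: nbhs_right_gt.
  - exact: nbhs_right_lt.
  - exact: nbhs_right_lt.
by rewrite leNgt exprn_gt0.
Unshelve. all: by end_near. Qed.

End NoSingularPart.

(** * Identification of the singular coefficients at 0 *)

Section Matching.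
Context {R : realType} (nu : R) (nu_gt0 : 0 < nu) (nu_lt1 : nu < 1).
Implicit Types (u v l x y t : R) (f g w : R -> R).
Let sp : -1 < nu. Proof. by apply: lt_trans nu_gt0; rewrite ltrN10. Qed.
Let sm : -1 < - nu. Proof. by rewrite ltrN2. Qed.

Lemma bessel_near1 s l : -1 < s ->
  exists2 C, 0 <= C & forall y, 0 <= y <= 1 -> `|bessel s (l * y ^+ 2) - 1| <= C * y ^+ 2.
Proof.
move=> s1; have b1 := fact2_bound_diffs (bessel_coef_bound s1) (bessel_rate_ge0 s1).
have M0 := bessel_rate_ge0 s1; have A0 := fact2_bound_ge0 b1.
set A := 1 * bessel_rate s in b1 A0; set M := bessel_rate s in b1 M0.
pose B := A * expR 1^-1 * expR (1 * (M * `|l|)).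
have B0 : 0 <= B by rewrite !mulr_ge0 ?expR_ge0.
exists (B * `|l|); first by rewrite mulr_ge0.
move=> y /andP[y0 y1].
have dB z : `|z| <= `|l| -> `|dbessel s z| <= B.
  move=> zl; apply: le_trans (fact2_psum_le z b1 M0 ltr01) _.
  by rewrite ler_wpM2l ?mulr_ge0 ?expR_ge0// ler_expR !mul1r ler_wpM2l.
pose h x := bessel s (l * x).
have dh x : is_derive x 1 h (dbessel s (l * x) * (l * 1)).
  exact: der_comp (derZ l (derI x)) (bessel_is_derive s1 _).
have [->|yn0] := eqVneq y 0; first by rewrite expr0n mulr0 bessel0 subrr normr0 mulr0.
have y20 : 0 < y ^+ 2 by rewrite exprn_gt0// lt_neqAle eq_sym yn0.
have [|c c0 hc] := @MVT _ h (fun x => dbessel s (l * x) * (l * 1)) 0 (y ^+ 2) y20.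
  by apply: derivable_within_continuous => x _; case: (dh x).
move: hc; rewrite /h mulr0 bessel0 subr0 mulr1 => ->.
rewrite normrM (ger0_norm (ltW y20)) ler_wpM2r ?(ltW y20)// normrM ler_wpM2r//; apply: dB.
rewrite normrM ler_piMr//; move: c0; rewrite in_itv/= => /andP[c0 cy].
by rewrite ger0_norm ?(ltW c0)// (le_trans (ltW cy))// exprn_ile1.
Qed.

Lemma derive0_littleo f : f 0 = 0 -> is_derive (0 : R) 1 f 0 ->
  forall t, t * t = 1 -> f (t * y) / y @[y --> 0^'+] --> (0 : R).
Proof.
move=> f0 [df dE] t tt1.
have H : h^-1 *: (f (h%:A + 0) - f 0) @[h --> 0^'] --> 'D_1 f 0 by exact: df.
rewrite dE in H.
have t1 : `|t| = 1.
  by apply/eqP; rewrite -(@eqrXn2 _ 2)// expr1n -normrX expr2 tt1 normr1.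
apply/cvgrPdist_le => e e0.
move: H => /cvgrPdist_le/(_ _ e0); rewrite near_withinE => /nbhs_ballP[d /= d0 Hd].
near=> y.
have y0 : 0 < y by near: y; exact: nbhs_right_gt.
have yd : y < d by near: y; exact: nbhs_right_lt.
have ty0 : t * y != 0.
  by rewrite mulf_neq0 ?(gt_eqF y0)// -normr_eq0 t1 oner_neq0.
have := Hd (t * y); rewrite /ball/= sub0r normrN normrM t1 mul1r gtr0_norm//.
move=> /(_ yd ty0).
rewrite !sub0r !normrN f0 subr0 addr0 [_%:A]mulr1 /GRing.scale/= !normrM !normfV.
by rewrite normrM t1 mul1r mulrC.
Unshelve. all: by end_near. Qed.

Lemma bsol_l0 s y : bsol s 0 y = y `^ (s + 2^-1).
Proof. by rewrite /bsol mul0r bessel0 mulr1. Qed.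

(** Near 0 the difference expands as (v - c2) y^(1/2 - nu) + (u - c1) y^(nu + 1/2) plus smaller
    terms. That [fr] is o(y) removes the first coefficient for every nu, and the second for nu <=
    1/2; beyond, the second is removed by [H2_no_singular]. *)
Lemma matching (fr : R -> R) t u v c1 c2 l : t * t = 1 -> H2tilde0 fr ->
  (forall x, -1 < x < 1 -> 0 < t * x ->
     fr x = comb nu bsol u v l (t * x) - comb nu bsol c1 c2 0 (t * x)) ->
  u = c1 /\ v = c2.
Proof.
move=> tt1 [Hfr _ fr0 dfr] frE.
pose g y := comb nu bsol u v l y - comb nu bsol c1 c2 0 y.
have gE y : 0 < y < 1 -> fr (t * y) = g y.
  move=> /andP[y0 y1]; have ty : t * (t * y) = y by rewrite mulrA tt1 mul1r.
  have t1 : `|t| = 1.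
    by apply/eqP; rewrite -(@eqrXn2 _ 2)// expr1n -normrX expr2 tt1 normr1.
  have xx : -1 < t * y < 1 by rewrite -ltr_norml normrM t1 mul1r gtr0_norm.
  have px : 0 < t * (t * y) by rewrite ty.
  by rewrite (frE _ xx px) ty.
have go : g y / y @[y --> 0^'+] --> (0 : R).
  apply: cvg_trans (derive0_littleo fr0 dfr tt1); apply: near_eq_cvg; near=> y.
  by rewrite gE//; apply/andP; split; near: y; [exact: nbhs_right_gt|exact: nbhs_right_lt].
pose Gp y := bessel nu (l * y ^+ 2); pose Gm y := bessel (- nu) (l * y ^+ 2).
have cG s : -1 < s -> bessel s (l * y ^+ 2) @[y --> 0^'+] --> (1 : R).
  move=> s1; apply: cvg_at_right_filter.
  have := der_cont (der_comp (derZ l (derX 1 (derI (0 : R)))) (bessel_is_derive s1 _)).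
  by rewrite /prop_for /continuous_at expr0n mulr0 bessel0.
have cGp := cG _ sp; have cGm := cG _ sm.
have pw y p q : 0 < y -> y `^ p * y `^ q = y `^ (p + q).
  by move=> y0; rewrite -powRD// (gt_eqF y0) implybT.
have vc : v = c2.
  (* The difference divided by its dominant power y^(1/2 - nu): it tends to v - c2, and also to
     0. *)
  pose ph y := (u * Gp y - c1) * y `^ (2 * nu) + (v * Gm y - c2).
  have ph1 : ph y @[y --> 0^'+] --> (u * 1 - c1) * 0 + (v * 1 - c2).
    apply: cvgD; last by apply: cvgB; [exact: cvgMr|exact: cvg_cst].
    apply: cvgM; first by apply: cvgB; [exact: cvgMr|exact: cvg_cst].
    by apply: powR_cvg0; move: nu_gt0; lra.
  have ph2 : ph y @[y --> 0^'+] --> (0 * 0 : R).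
    have : y `^ (nu + 2^-1) * (g y / y) @[y --> 0^'+] --> (0 * 0 : R).
      by apply: cvgM => //; apply: powR_cvg0; move: nu_gt0; lra.
    apply: cvg_trans; apply: near_eq_cvg; near=> y.
    have y0 : 0 < y by near: y; exact: nbhs_right_gt.
    rewrite /ph /g /comb !bsol_l0 /bsol -/(Gp y) -/(Gm y).
    have e1 : y `^ (2 * nu) = y `^ (nu + 2^-1) * y `^ (nu + 2^-1) / y.
      by rewrite pw// -[X in _ / X](powRr1 (ltW y0)) -powRN pw//; congr (_ `^ _); field.
    have e2 : y `^ (nu + 2^-1) * y `^ (- nu + 2^-1) = y.
      by rewrite pw// (_ : _ + _ = 1) ?powRr1 ?ltW//; field.
    rewrite e1; move: e2; set P := y `^ (nu + _); set Q := y `^ _ => e2.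
    have -> : (u * Gp y - c1) * (P * P / y) + (v * Gm y - c2) =
        (u * Gp y - c1) * (P * P / y) + (v * Gm y - c2) * (P * Q / y).
      by rewrite e2 mulfV ?gt_eqF// mulr1.
    by field; rewrite gt_eqF.
  have E : (u * 1 - c1) * 0 + (v * 1 - c2) = 0 * 0.
    by rewrite -(cvg_lim _ ph1)// -(cvg_lim _ ph2).
  by move: E; lra.
split=> //; rewrite -vc in frE g gE go.
have [C C0 HC] := bessel_near1 l sm.
(* Now the difference is divided by y^(nu + 1/2). Since [v] agrees on both sides, the other branch
   contributes only O(y^(2 - 2 nu)), and the limit is u - c1. *)
pose ph y := u * Gp y - c1 + v * ((Gm y - 1) * y `^ (- (2 * nu))).
have cph : ph y @[y --> 0^'+] --> u * 1 - c1 + v * 0.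
  apply: cvgD; first by apply: cvgB; [exact: cvgMr|exact: cvg_cst].
  apply: cvgMr; apply/norm_cvg0P.
  apply: (@squeeze_cvgr _ _ _ _ (fun=> 0) (fun y => C * y `^ (2 - 2 * nu))).
  - near=> y; rewrite normr_ge0/= normrM (ger0_norm (powR_ge0 _ _)).
    have y0 : 0 < y by near: y; exact: nbhs_right_gt.
    have y1 : y <= 1 by near: y; exact: nbhs_right_le.
    rewrite -(@pw y 2) // mulrA ler_wpM2r ?powR_ge0// powR_mulrn ?(ltW y0)//.
    by apply: HC; rewrite (ltW y0).
  - exact: cvg_cst.
  - have : C * y `^ (2 - 2 * nu) @[y --> 0^'+] --> C * 0.
      by apply: cvgMr; apply: powR_cvg0; move: nu_lt1; lra.
    by rewrite mulr0.
have phE y : 0 < y -> g y = y `^ (nu + 2^-1) * ph y.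
  move=> y0; rewrite /ph /g /comb !bsol_l0 /bsol -/(Gp y) -/(Gm y).
  have e1 : y `^ (- nu + 2^-1) = y `^ (nu + 2^-1) * y `^ (- (2 * nu)).
    by rewrite pw//; congr (_ `^ _); ring.
  rewrite e1; ring.
rewrite mulr1 mulr0 addr0 in cph.
(* For nu <= 1/2 and y <= 1 the power y^(nu + 1/2) is at least y, so being o(y) is decisive. *)
have [nu12|nu12] := leP nu (1 / 2).
  have ph2 : ph y @[y --> 0^'+] --> (0 : R).
    apply/norm_cvg0P.
    apply: (@squeeze_cvgr _ _ _ _ (fun=> 0) (fun y => `|g y / y|)).
    - near=> y; rewrite normr_ge0/=.
      have y0 : 0 < y by near: y; exact: nbhs_right_gt.
      have y1 : y <= 1 by near: y; exact: nbhs_right_le.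
      have -> : ph y = y `^ (2^-1 - nu) * (g y / y).
        rewrite phE// -[X in _ / X](powRr1 (ltW y0)) -powRN mulrA mulrAC !mulrA !pw//.
        by rewrite (_ : _ + _ = 0) ?powRr0 ?mul1r//; field.
      rewrite normrM ler_piMl// ger0_norm ?powR_ge0//.
      rewrite -[leRHS](powRr0 y); apply: ger_powR; first by rewrite y0 y1.
      by move: nu12; lra.
    - exact: cvg_cst.
    - by move: go => /cvg_norm; rewrite normr0.
  by apply/eqP; rewrite -subr_eq0 -(cvg_lim _ cph)// (cvg_lim _ ph2).
(* For nu > 1/2 the second derivative [G2] behaves like cc (u - c1) y^(nu - 3/2) with [cc > 0].
   Multiplied by [kap], which is u - c1, it gets the sign and the lower bound that [H2_no_singular]
   refutes. *)
apply: contrapT => /eqP; rewrite -subr_eq0 => k0.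
set kap := u - c1 in k0 cph.
pose cc := cpot nu.
have cc0 : 0 < cc.
  rewrite /cc /cpot subr_gt0 (_ : 4^-1 = (1 / 2) ^+ 2); last by field.
  by rewrite ltrXn2r// ?nnegrE//; move: nu12 nu_gt0; lra.
pose G1 y := comb nu dbsol u v l y - comb nu dbsol c1 v 0 y.
pose G2 y := (cpot nu / y ^+ 2 - l) * comb nu bsol u v l y
  - (cpot nu / y ^+ 2 - 0) * comb nu bsol c1 v 0 y.
have lim2 : kap * (G2 y * y `^ (3 / 2 - nu)) @[y --> 0^'+] --> kap * (cc * kap - l * 0).
  apply: cvgMr.
  have c0 : (cc * ph y - l * (u * Gp y * y `^ 2 + v * Gm y * y `^ (2 - 2 * nu))) @[y --> 0^'+]
      --> cc * kap - l * (u * 1 * 0 + v * 1 * 0).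
    apply: cvgB; first exact: cvgMr.
    apply: cvgMr; apply: cvgD; apply: cvgM; try by apply: cvgMr.
      by apply: powR_cvg0.
    by apply: powR_cvg0; move: nu_lt1; lra.
  rewrite !mulr0 addr0 in c0.
  rewrite mulr0; move: c0; rewrite mulr0; apply: cvg_trans; apply: near_eq_cvg; near=> y.
  have y0 : 0 < y by near: y; exact: nbhs_right_gt.
  have yn0 : y != 0 by rewrite gt_eqF.
  have -> : G2 y = cc / y ^+ 2 * g y - l * comb nu bsol u v l y.
    by rewrite /G2 /g /cc; ring.
  rewrite phE// /comb /bsol -/(Gp y) -/(Gm y).
  have h1 : y `^ (nu + 2^-1) * y `^ (3 / 2 - nu) = y ^+ 2.
    by rewrite pw// -powR_mulrn ?ltW//; congr (_ `^ _); field.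
  have h2 : y `^ (- nu + 2^-1) * y `^ (3 / 2 - nu) = y `^ (2 - 2 * nu).
    by rewrite pw//; congr (_ `^ _); field.
  rewrite (powR_mulrn 2)?ltW// -h2 -{1}h1.
  move: h1; set P := y `^ (nu + _); set Q := y `^ (- nu + _); set S := y `^ _ => h1.
  transitivity (cc * (P * S / y ^+ 2) * ph y - l * (u * Gp y * (P * S) + v * Gm y * (Q * S))).
    by rewrite h1 mulfV ?expf_neq0// mulr1.
  by field; rewrite yn0.
have kk0 : 0 < kap * (cc * kap - l * 0).
  rewrite mulr0 subr0 mulrCA mulr_gt0// -expr2 lt_neqAle sqr_ge0 andbT eq_sym.
  by rewrite expf_neq0.
set K := kap * _ in lim2 kk0.
have /cvgrPdist_le/(_ (K / 2)) := lim2; rewrite divr_gt0// => /(_ isT).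
rewrite near_withinE => /nbhs_ballP[d /= d0 Hd].
apply: (@H2_no_singular _ nu fr g G1 G2 t (K / 2) d kap) => //.
- move=> y /andP[y0 _].
  exact: derB (comb_is_derive nu_gt0 nu_lt1 _ _ _ y0) (comb_is_derive nu_gt0 nu_lt1 _ _ _ y0).
- move=> y /andP[y0 _].
  exact: derB (dcomb_is_derive nu_gt0 nu_lt1 _ _ _ y0) (dcomb_is_derive nu_gt0 nu_lt1 _ _ _ y0).
- move=> y /andP[y0 _].
  have cinv k : {for y, continuous (fun y => cpot nu / y ^+ 2 - k)}.
    apply: cvgB; last exact: cvg_cst.
    apply: cvgMr; apply: cvgV; first by rewrite expf_neq0// gt_eqF.
    exact: exprn_continuous.
  apply: cvgB; apply: cvgM; try exact: cinv.
    exact: der_cont (comb_is_derive nu_gt0 nu_lt1 _ _ _ y0).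
  exact: der_cont (comb_is_derive nu_gt0 nu_lt1 _ _ _ y0).
- by rewrite divr_gt0.
- move=> y /andP[y0 yd]; have := Hd y; rewrite /ball/= sub0r normrN gtr0_norm//.
  move=> /(_ yd y0); rewrite ler_norml => /andP[_ h].
  have yp : 0 < y `^ (3 / 2 - nu) by rewrite powR_gt0.
  rewrite (_ : nu - 3 / 2 = - (3 / 2 - nu)); last by ring.
  rewrite powRN ler_pdivrMr// -(mulrA kap (G2 y)); move: h; lra.
Unshelve. all: by end_near. Qed.

End Matching.

(** * Explicit form of the eigenfunctions *)

Section EigenfunctionForm.
Context {R : realType} (nu : R) (nu_gt0 : 0 < nu) (nu_lt1 : nu < 1).
Notation mu := (@lebesgue_measure R).
Implicit Types (u v l x y t : R) (f g w : R -> R).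
Let sp : -1 < nu. Proof. by apply: lt_trans nu_gt0; rewrite ltrN10. Qed.
Let sm : -1 < - nu. Proof. by rewrite ltrN2. Qed.

(** The equation yields some Bessel coefficients on this half; [matching] identifies them with the
    singular coefficients, on which the conditions at 0 bear. The Dirichlet condition then leaves
    one parameter [k]. *)
Lemma side_form f fr w t (lo hi c1 c2 : R) l : lo < hi -> t * t = 1 ->
  (forall x, (lo < x < hi) = (-1 < x < 1) && (0 < t * x)) ->
  H2tilde0 fr ->
  (forall x, -1 <= x <= 1 -> 0 < t * x -> f x = fr x + comb nu bsol c1 c2 0 (t * x)) ->
  f t = 0 -> weak_derivative2 lo hi f w ->
  ((fun x => l * f x) = (fun x => - w x + cpot nu / x ^+ 2 * f x)
      %[ae mu in `](-1 : R), 1[%classic]) ->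
  exists2 k, c1 = k * bessel (- nu) l /\ c2 = - k * bessel nu l &
   forall x, -1 <= x <= 1 -> 0 < t * x -> f x = comb nu bsol c1 c2 l (t * x).
Proof.
move=> lohi tt1 side Hfr fE ft0 wf ae.
have [_ cfr _ _] := Hfr.
have lo1 x : lo < x < hi -> -1 < x < 1 by rewrite side => /andP[].
have lopos x : lo < x < hi -> 0 < t * x by rewrite side => /andP[].
have cf x : lo < x < hi -> {for x, continuous f}.
  move=> xlr; have x0 := lopos x xlr; have x1 := lo1 x xlr.
  have cfrx : {for x, continuous fr}.
    have lt11 : -1 < 1 :> R by lra.
    have [+ _ _] := (continuous_within_itvP fr lt11).1 cfr.
    by apply; rewrite in_itv.
  have cc : {for x, continuous (fun x => fr x + comb nu bsol c1 c2 0 (t * x))}.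
    apply: cvgD; first exact: cfrx.
    exact: der_cont (der_scale (comb_is_derive nu_gt0 nu_lt1 c1 c2 0 x0)).
  rewrite /prop_for /continuous_at (fE x _ x0); last by case/andP: x1 => /ltW -> /ltW ->.
  apply: cvg_trans cc; apply: near_eq_cvg.
  have /andP[lx xr] := xlr; near=> y.
  have ly : lo < y by near: y; exact: lt_nbhsr.
  have yr : y < hi by near: y; exact: lt_nbhsl.
  have ylr : lo < y < hi by rewrite ly yr.
  by rewrite (fE y _ (lopos y ylr))//; case/andP: (lo1 y ylr) => /ltW -> /ltW ->.
have wE : w = (fun x => (cpot nu / x ^+ 2 - l) * f x) %[ae mu in `]lo, hi[%classic].
  move: ae; apply: filterS; first exact: (ae_filter_ringOfSetsType mu).
  move=> x /= H; rewrite in_itv/= => /lo1; move: H; rewrite in_itv/= => H /H; lra.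
have [u [v uv]] := eigen_side nu_gt0 nu_lt1 lohi tt1 lopos cf wf wE.
have [uc vc] : u = c1 /\ v = c2.
  apply: (matching nu_gt0 nu_lt1 (l := l) tt1 Hfr) => x x1 tx.
  have xlr : lo < x < hi by rewrite side x1 tx.
  rewrite -(uv x xlr) (fE x)// ?addrK//.
  by case/andP: x1 => /ltW -> /ltW ->.
rewrite {u}uc {v}vc in uv.
have t1 : `|t| = 1.
  by apply/eqP; rewrite -(@eqrXn2 _ 2)// expr1n -normrX expr2 tt1 normr1.
have tin : -1 <= t <= 1 by rewrite -ler_norml t1.
have tyin y : 0 < y < 1 -> lo < t * y < hi.
  move=> /andP[y0 y1]; rewrite side mulrA tt1 mul1r y0 andbT.
  by rewrite -ltr_norml normrM t1 mul1r gtr0_norm.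
(* The formula [uv] holds on the open interval only, while [f t = 0] is a value at its end:
   continuity of [fr] up to the boundary connects them. *)
have end1 : comb nu bsol c1 c2 l 1 = 0.
  have cy : t * y @[y --> 1^'-] --> within `[-1, 1] (nbhs t).
    have c0 : t * y @[y --> 1^'-] --> t.
      rewrite -[X in _ --> X]mulr1; apply: cvgMr; apply: cvg_at_left_filter.
      exact: cvg_id.
    move=> A; rewrite /within/= => /c0; rewrite /nbhs/= => H.
    near=> y.
    have Hy : `[-1, 1]%classic (t * y) -> A (t * y) by near: y; exact: H.
    apply: Hy; rewrite /= in_itv/=.
    have : 0 < y < 1 by apply/andP; split; near: y; [exact: nbhs_left_gt|exact: nbhs_left_lt].
    by move=> /tyin/lo1/andP[/ltW -> /ltW ->].
  have cfrt : fr (t * y) @[y --> 1^'-] --> fr t.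
    have /subspace_continuousP/(_ t) := cfr.
    by rewrite /= in_itv/= => /(_ tin); exact: cvg_comp.
  have cc1 k : comb nu bsol c1 c2 k y @[y --> 1^'-] --> comb nu bsol c1 c2 k 1.
    by apply: cvg_at_left_filter; exact: der_cont (comb_is_derive nu_gt0 nu_lt1 c1 c2 k ltr01).
  have lim : comb nu bsol c1 c2 l y @[y --> 1^'-] --> fr t + comb nu bsol c1 c2 0 1.
    apply: cvg_trans (cvgD cfrt (cc1 0)); apply: near_eq_cvg; near=> y.
    have y01 : 0 < y < 1 by apply/andP; split; near: y; [exact: nbhs_left_gt|exact: nbhs_left_lt].
    have ty := tyin y y01.
    have tE : t * (t * y) = y by rewrite mulrA tt1 mul1r.
    have d1 : -1 <= t * y <= 1 by case/andP: (lo1 _ ty) => /ltW -> /ltW ->.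
    have d2 : 0 < t * (t * y) by rewrite tE; case/andP: y01.
    by have := uv _ ty; rewrite (fE _ d1 d2) tE.
  rewrite -(cvg_lim _ (cc1 l))// (cvg_lim _ lim)//.
  have t2 : 0 < t * t by rewrite tt1.
  by have := fE t tin t2; rewrite ft0 tt1 => <-.
have fin x : -1 <= x <= 1 -> 0 < t * x -> f x = comb nu bsol c1 c2 l (t * x).
  move=> x1 tx; have [xlr|] := boolP (lo < x < hi); first exact: uv.
  rewrite side tx andbT => nx1.
  have xt : x = t.
    have xabs : `|x| = 1.
      apply/eqP; rewrite eq_le ler_norml x1/= leNgt; apply: contra nx1.
      by rewrite ltr_norml.
    have tx1 : t * x = 1 by rewrite -(gtr0_norm tx) normrM t1 xabs mul1r.
    by rewrite -[RHS]mulr1 -tx1 mulrA tt1 mul1r.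
  by rewrite xt tt1 end1.
move: end1; rewrite /comb !bsol_at1 => end1.
(* A vector orthogonal to a nonzero (a, b) is a multiple of (b, -a); the factor is read off
   whichever entry is nonzero. *)
have [b0|b0] := eqVneq (bessel (- nu) l) 0.
  have a0 : bessel nu l != 0 by have := bessel_neq0 nu_gt0 nu_lt1 l; rewrite b0 eqxx orbF.
  exists (- c2 / bessel nu l) => //; split.
    move: end1; rewrite b0 !mulr0 addr0 => /eqP; rewrite mulf_eq0 (negPf a0) orbF.
    by move/eqP.
  by rewrite !mulNr opprK mulfVK.
exists (c1 / bessel (- nu) l) => //; split; first by rewrite mulfVK.
apply: (mulIf b0).
have -> : - (c1 / bessel (- nu) l) * bessel nu l * bessel (- nu) l = - (c1 * bessel nu l).
  by field.
by apply/eqP; rewrite -subr_eq0 opprK addrC end1.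
Unshelve. all: by end_near. Qed.

Lemma singularE (c1 c2 c3 c4 : R) x :
  singular nu c1 c2 c3 c4 x =
  if x < 0 then comb nu bsol c1 c2 0 (- x) else comb nu bsol c3 c4 0 x.
Proof.
rewrite /singular /comb !bsol_l0; case: ltP => x0; first by rewrite ltr0_norm.
by rewrite ger0_norm.
Qed.

(** With one parameter per half, the two conditions at 0 decouple along the even part [kp + km] and
    the odd part [kp - km], each multiplied, up to sign, by one factor of the characteristic
    function. *)
Lemma eigenfunction_form f l : opA nu f (fun x => l * f x) -> exists kp km,
  [/\ forall x, 0 < x <= 1 ->
        f x = comb nu bsol (kp * bessel (- nu) l) (- kp * bessel nu l) l x,
      forall x, -1 <= x < 0 ->
        f x = comb nu bsol (km * bessel (- nu) l) (- km * bessel nu l) l (- x),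
      (kp + km) * (bessel (- nu) l - bessel nu l) = 0 &
      (kp - km) * ((nu - 2^-1) * bessel nu l + (nu + 2^-1) * bessel (- nu) l) = 0].
Proof.
move=> [[fr [cm1 [cm2 [cp1 [cp2 [Hfr fE [fm fp] s1 s2]]]]]] _ [w [wm wp ae]]].
have sidep x : (0 < x < 1) = (-1 < x < 1) && (0 < 1 * x).
  rewrite mul1r; apply/idP/idP => [/andP[x0 ->]|/andP[/andP[_ ->] ->]//].
  by rewrite x0 (lt_trans _ x0)// ltrN10.
have sidem x : (-1 < x < 0) = (-1 < x < 1) && (0 < -1 * x).
  rewrite mulN1r oppr_gt0; apply/idP/idP => [/andP[-> x0]|/andP[/andP[-> _] ->]//].
  by rewrite x0 (lt_trans x0)// ltr01.
have fEp x : -1 <= x <= 1 -> 0 < 1 * x -> f x = fr x + comb nu bsol cp1 cp2 0 (1 * x).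
  move=> x1; rewrite mul1r => x0; rewrite fE ?in_itv ?gt_eqF// singularE.
  by rewrite ltNge (ltW x0).
have fEm x : -1 <= x <= 1 -> 0 < -1 * x -> f x = fr x + comb nu bsol cm1 cm2 0 (-1 * x).
  move=> x1; rewrite mulN1r oppr_gt0 => x0; rewrite fE ?in_itv ?lt_eqF// singularE.
  by rewrite x0.
have [kp [kp1 kp2] fp'] := side_form ltr01 (mulr1 1) sidep Hfr fEp fp wp ae.
have tm : -1 * -1 = 1 :> R by rewrite mulN1r opprK.
have [km [km1 km2] fm'] := side_form (ltrN10 R) tm sidem Hfr fEm fm wm ae.
exists kp, km; split.
- move=> x /andP[x0 x1]; rewrite fp' ?mul1r ?kp1 ?kp2// x1 andbT.
  by rewrite (le_trans _ (ltW x0))// lerN10.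
- move=> x /andP[x0 x1]; rewrite fm' ?mulN1r ?km1 ?km2 ?oppr_gt0// x0/=.
  by rewrite (le_trans (ltW x1)).
- by move: s1; rewrite kp1 kp2 km1 km2 => <-; ring.
- move: s2; rewrite kp1 kp2 km1 km2 => /eqP; rewrite -subr_eq0 => /eqP h.
  by apply: oppr_inj; rewrite oppr0 -h; field.
Qed.

End EigenfunctionForm.

(** * The norm of an eigenfunction is bounded by boundary values at 1 *)

Section EigenfunctionNorm.
Context {R : realType} (nu : R) (nu_gt0 : 0 < nu) (nu_lt1 : nu < 1).
Notation mu := (@lebesgue_measure R).
Implicit Types (u v l x y t : R) (f g w : R -> R).

Lemma comb_sqr_continuous u v l x : 0 < x ->
  {for x, continuous (fun x => comb nu bsol u v l x ^+ 2)}.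
Proof. by move=> x0; exact: der_cont (derX 1 (comb_is_derive nu_gt0 nu_lt1 u v l x0)). Qed.

Lemma comb_sqr_integral u v l (e : R) : 0 < e <= 1 ->
  \int[mu]_(x in `[e, 1]) (comb nu bsol u v l x ^+ 2) <= energy nu u v l 1.
Proof.
move=> /andP[e0 e1].
have -> : \int[mu]_(x in `[e, 1]) (comb nu bsol u v l x ^+ 2) =
    energy nu u v l 1 - energy nu u v l e.
  have D x : e <= x <= 1 -> is_derive x 1 (energy nu u v l) (comb nu bsol u v l x ^+ 2).
    by move=> /andP[ex _]; exact: energy_is_derive (lt_le_trans e0 ex).
  apply: (FTC2_is_derive e1 D) => x /andP[ex _].
  exact: comb_sqr_continuous (lt_le_trans e0 ex).
by rewrite gerBl energy_ge0.
Qed.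

Lemma comb_sqr_integralN u v l (e : R) : 0 < e <= 1 ->
  \int[mu]_(x in `[-1, - e]) (comb nu bsol u v l (- x) ^+ 2) <= energy nu u v l 1.
Proof.
move=> /andP[e0 e1].
have -> : \int[mu]_(x in `[-1, - e]) (comb nu bsol u v l (- x) ^+ 2) =
    - energy nu u v l (- - e) - - energy nu u v l (- -1).
  have pos x : -1 <= x <= - e -> 0 < - x.
    by move=> /andP[_ ex]; rewrite oppr_gt0 (le_lt_trans ex)// oppr_lt0.
  have D x : -1 <= x <= - e -> is_derive x 1 (fun x => - energy nu u v l (- x))
      (comb nu bsol u v l (- x) ^+ 2).
    move=> /pos x0.
    apply: derE (derN (der_comp (derN (derI x)) (energy_is_derive nu_gt0 nu_lt1 u v l x0))) _.
    by rewrite mulrN1 opprK.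
  have le1 : -1 <= - e by rewrite lerN2.
  apply: (FTC2_is_derive le1 D) => x /pos x0.
  exact: der_cont (derX 1 (der_comp (derN (derI x)) (comb_is_derive nu_gt0 nu_lt1 u v l x0))).
by rewrite !opprK addrC gerBl energy_ge0.
Qed.

Lemma Rintegral_itv_eq f g (a b : R) (b0 b1 c0 c1 : bool) :
  measurable_fun `]a, b[ f -> measurable_fun `]a, b[ g ->
  (forall x, a < x < b -> f x = g x) ->
  \int[mu]_(x in [set` Interval (BSide b0 a) (BSide b1 b)]) f x =
  \int[mu]_(x in [set` Interval (BSide c0 a) (BSide c1 b)]) g x.
Proof.
move=> mf mg fg; rewrite (Rintegral_oo _ _ mf) (Rintegral_oo _ _ mg).
by apply: eq_Rintegral => x; rewrite inE/= in_itv/=; exact: fg.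
Qed.

(** The square of [f] is integrable, so its primitive [J] is continuous and the interval [-e, e] can
    be removed and shrunk. On the rest the integral is a difference of energies, of which the inner
    one is nonnegative. *)
Lemma norm_le_energy f u v u' v' l :
  mu.-integrable `](-1), 1[ (EFin \o (fun x => f x * f x)) ->
  (forall x, 0 < x <= 1 -> f x = comb nu bsol u v l x) ->
  (forall x, -1 <= x < 0 -> f x = comb nu bsol u' v' l (- x)) ->
  inner (-1) 1 f f <= energy nu u v l 1 + energy nu u' v' l 1.
Proof.
move=> iff fp fm.
pose g := (fun x => f x * f x) \_ `]-1, 1[.
have ig : mu.-integrable setT (EFin \o g).
  rewrite /g -restrict_EFin.
  by apply/(@integrable_mkcond _ _ R mu _ _ (measurable_itv _)).
have igI (i : interval R) : mu.-integrable [set` i] (EFin \o g).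
  by apply: (integrableS _ _ _ ig) => //.
pose J x := \int[mu]_(t in `[-1, x]) g t.
have cJ : {within `[-1, 1], continuous J}.
  have lt11 : -1 <= 1 :> R by lra.
  exact: (parameterized_integral_continuous lt11 (igI `[-1, 1])).
have J1 : J 1 = inner (-1) 1 f f.
  rewrite /J /inner /g -Rintegral_mkcondr; congr (Rintegral _ _ _).
  by apply/setIidPr; apply: subset_itv_oo_cc.
have gE x : -1 < x < 1 -> g x = f x * f x.
  by move=> x1; rewrite /g patchE mem_set//= in_itv.
have hp e : 0 < e < 1 -> J 1 - J e <= energy nu u v l 1.
  move=> /andP[e0 e1].
  rewrite /J Rintegral_itvB; [|exact: igI|by rewrite bnd_simp; lra|by rewrite bnd_simp; lra].
  apply: le_trans (comb_sqr_integral u v l (e := e) _); last by rewrite e0 ltW.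
  rewrite le_eqVlt; apply/orP; left; apply/eqP; apply: Rintegral_itv_eq.
  - by case/integrableP: (igI `]e, 1[) => /measurable_EFinP.
  - have cc x : e <= x <= 1 -> {for x, continuous (fun x => comb nu bsol u v l x ^+ 2)}.
      by move=> /andP[ex _]; apply: comb_sqr_continuous; exact: lt_le_trans ex.
    have := segment_integrable cc => /integrableP[/measurable_EFinP m _].
    by apply: measurable_funS m => //; exact: subset_itv_oo_cc.
  move=> x /andP[ex x1]; rewrite gE; last by rewrite x1 andbT; lra.
  by rewrite fp ?expr2// (lt_trans e0 ex) ltW.
have hm e : 0 < e < 1 -> J (- e) <= energy nu u' v' l 1.
  move=> /andP[e0 e1]; rewrite /J.
  apply: le_trans (comb_sqr_integralN u' v' l (e := e) _); last by rewrite e0 ltW.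
  rewrite le_eqVlt; apply/orP; left; apply/eqP; apply: Rintegral_itv_eq.
  - by case/integrableP: (igI `]-1, (- e)[) => /measurable_EFinP.
  - have cc x : -1 <= x <= - e -> {for x, continuous (fun x => comb nu bsol u' v' l (- x) ^+ 2)}.
      move=> /andP[_ ex]; have x0 : 0 < - x by rewrite oppr_gt0 (le_lt_trans ex)// oppr_lt0.
      exact: der_cont (derX 1 (der_comp (derN (derI x)) (comb_is_derive nu_gt0 nu_lt1 u' v' l x0))).
    have := segment_integrable cc => /integrableP[/measurable_EFinP m _].
    by apply: measurable_funS m => //; exact: subset_itv_oo_cc.
  move=> x /andP[ex x1]; rewrite gE; last by rewrite ex/=; lra.
  by rewrite fm ?expr2// (ltW ex)/=; lra.
have lt11 : -1 < 1 :> R by lra.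
have [cJ0 _ _] := (continuous_within_itvP J lt11).1 cJ.
have cJ00 : {for 0, continuous J} by apply: cJ0; rewrite in_itv/=; lra.
have c1 : J e @[e --> 0^'+] --> J 0 by exact: cvg_at_right_filter.
have c2 : J (- e) @[e --> 0^'+] --> J 0.
  apply: (@cvg_at_right_filter _ _ (fun e => J (- e))).
  have h : {for 0, continuous (fun e => J (- e))}.
    apply: (@continuous_comp _ _ _ (fun e => - e) J); first exact: oppr_continuous.
    by rewrite oppr0.
  by have := h; rewrite /prop_for /continuous_at oppr0.
have cl : energy nu u v l 1 + energy nu u' v' l 1 + (J e - J (- e)) @[e --> 0^'+] -->
    energy nu u v l 1 + energy nu u' v' l 1 + (J 0 - J 0).
  by apply: cvgD; [exact: cvg_cst|exact: cvgB].
rewrite subrr addr0 in cl.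
rewrite -J1 -(cvg_lim _ cl)//; apply: limr_ge; first exact: cvgP cl.
near=> e.
have e01 : 0 < e < 1 by apply/andP; split; near: e; [exact: nbhs_right_gt|exact: nbhs_right_lt].
have := hp e e01; have := hm e e01; lra.
Unshelve. all: by end_near. Qed.

End EigenfunctionNorm.

(** * The normal derivative at 1 as a combination of scalar products *)

Section BoundaryDerivative.
Context {R : realType} (nu : R) (nu_gt0 : 0 < nu) (nu_lt1 : nu < 1).
Notation mu := (@lebesgue_measure R).
Implicit Types (u v l x y t : R) (f g w : R -> R).

Lemma left_derivative_comb f u v l :
  (forall x, 0 < x <= 1 -> f x = comb nu bsol u v l x) ->
  left_derivative f 1 = comb nu dbsol u v l 1.
Proof.
move=> fE; have [df dE] := comb_is_derive nu_gt0 nu_lt1 u v l ltr01.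
have H : h^-1 *: (comb nu bsol u v l (h%:A + 1) - comb nu bsol u v l 1) @[h --> 0^']
    --> 'D_1 (comb nu bsol u v l) 1 by exact: df.
rewrite dE in H.
apply/cvg_lim => //.
have H' : h^-1 *: (comb nu bsol u v l (h%:A + 1) - comb nu bsol u v l 1) @[h --> 0^'-]
    --> comb nu dbsol u v l 1.
  exact: cvg_dnbhs_at_left H.
apply: cvg_trans H'; apply: near_eq_cvg; near=> h.
have h0 : h < 0 by near: h; exact: nbhs_left_lt.
have h1 : -1 < h by near: h; apply: nbhs_left_gt; rewrite ltrN10.
rewrite [_%:A]mulr1 [h + 1]addrC !fE ?ltr01 ?lexx//; first by rewrite mulrC.
by move: h0 h1; lra.
Unshelve. all: by end_near. Qed.

(** The cube and its derivative vanish at 1/2, so Green's formula on [1/2, 1] has boundary terms at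
    1 only, where the value is 1. [Lwcut] is the image of this function under -d^2/dx^2 + c_nu /
    x^2. *)
Definition wcut x : R := if (1 / 2 <= x <= 1) then (2 * x - 1) ^+ 3 else 0.
Definition Lwcut x : R := if (1 / 2 <= x <= 1) then
  cpot nu / x ^+ 2 * (2 * x - 1) ^+ 3 - 24 * (2 * x - 1) else 0.

Let cut_L2 (F : R -> R) : (forall x, 1 / 2 <= x <= 1 -> {for x, continuous F}) ->
  L2 (-1) 1 (fun x => if 1 / 2 <= x <= 1 then F x else 0).
Proof.
move=> cF.
have [K HK] : exists K, forall x, 1 / 2 <= x <= 1 -> `|F x| <= K.
  have lt : 1 / 2 <= 1 :> R by lra.
  have cn : {within `[1 / 2, 1], continuous (fun x => `|F x|)}.
    by apply: continuous_within_segment => x /cF; exact: cvg_norm.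
  have [c _ Hc] := EVT_max lt cn.
  by exists (`|F c|) => x x1; apply: Hc; rewrite in_itv.
have E : (fun x => if 1 / 2 <= x <= 1 then F x else 0) = F \_ `[1 / 2, 1].
  apply/funext => x; rewrite patchE; case: ifPn => [xi|xi].
    by rewrite mem_set//= in_itv.
  by case: ifPn => //; rewrite inE/= in_itv/= (negPf xi).
rewrite E; apply: (@L2_bounded _ _ _ _ `|K|).
  apply: measurable_funTS.
  apply/(measurable_restrictT _ (measurable_itv _)).
  by have := segment_integrable cF => /integrableP[/measurable_EFinP].
move=> x _; rewrite -E; case: ifPn => [/HK|]; last by rewrite normr0.
by move=> /le_trans; apply; exact: ler_norm.
Qed.

Lemma wcut_L2 : L2 (-1) 1 wcut.
Proof.
apply: cut_L2 => x _.
exact: der_cont (derX 2 (derB (derZ 2 (derI x)) (derC 1 x))).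
Qed.

Let cinv k x : 1 / 2 <= x <= 1 -> {for x, continuous (fun x => cpot nu / x ^+ 2 - k)}.
Proof.
move=> x1; have x0 : x != 0 by rewrite gt_eqF//; lra.
apply: cvgB; last exact: cvg_cst.
by apply: cvgMr; apply: cvgV; [rewrite expf_neq0|exact: exprn_continuous].
Qed.

Lemma Lwcut_L2 : L2 (-1) 1 Lwcut.
Proof.
apply: cut_L2 => x x1.
have d := derB (derZ 2 (derI x)) (derC 1 x).
have -> : (fun x => cpot nu / x ^+ 2 * (2 * x - 1) ^+ 3 - 24 * (2 * x - 1)) =
   (fun x => (cpot nu / x ^+ 2 - 0) * (2 * x - 1) ^+ 3 - 24 * (2 * x - 1)).
  by apply/funext => z; rewrite subr0.
apply: cvgB; last exact: der_cont (derZ 24 d).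
by apply: cvgM; [exact: cinv|exact: der_cont (derX 2 d)].
Qed.

(** Green's formula between the eigenfunction and [wcut] exchanges the trace at 1 for pairings with
    two fixed square-integrable functions, to which Bessel's inequality applies. *)
Lemma boundary_derivative f u v l :
  L2 (-1) 1 f -> f 1 = 0 ->
  (forall x, 0 < x <= 1 -> f x = comb nu bsol u v l x) ->
  comb nu dbsol u v l 1 = inner (-1) 1 f Lwcut - l * inner (-1) 1 f wcut.
Proof.
move=> Lf f1 fE.
pose h x := (2 * x - 1) ^+ 3.
pose F x := comb nu dbsol u v l x * h x - comb nu bsol u v l x * (6 * (2 * x - 1) ^+ 2).
pose F' x := ((cpot nu / x ^+ 2 - l) * h x - 24 * (2 * x - 1)) * comb nu bsol u v l x.
have pos x : 1 / 2 <= x <= 1 -> 0 < x by lra.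
have d x := derB (derZ 2 (derI x)) (derC 1 x).
have D x : 1 / 2 <= x <= 1 -> is_derive x 1 F (F' x).
  move=> /pos x0; apply: derE (derB
   (derM (dcomb_is_derive nu_gt0 nu_lt1 u v l x0) (derX 2 (d x)))
   (derM (comb_is_derive nu_gt0 nu_lt1 u v l x0) (derZ 6 (derX 1 (d x))))) _.
  by rewrite /F' /h; ring.
have C x : 1 / 2 <= x <= 1 -> {for x, continuous F'}.
  move=> x1; apply: cvgM; last exact: der_cont (comb_is_derive nu_gt0 nu_lt1 u v l (pos x x1)).
  apply: cvgB; last exact: der_cont (derZ 24 (d x)).
  by apply: cvgM; [exact: cinv|exact: der_cont (derX 2 (d x))].
have half : 1 / 2 <= 1 :> R by lra.
have := FTC2_is_derive half D C.
have c1 : comb nu bsol u v l 1 = 0 by rewrite -fE ?f1// ltr01 lexx.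
rewrite /F c1 /h (_ : 2 * 1 - 1 = 1); last by ring.
rewrite (_ : 2 * (1 / 2) - 1 = 0); last by field.
rewrite !expr0n/= expr1n !mulr0 !mul0r !subr0 mulr1 => <-.
have -> : inner (-1) 1 f Lwcut - l * inner (-1) 1 f wcut =
    inner (-1) 1 f (fun x => - l * wcut x + Lwcut x).
  rewrite inner_linr//; [ring|exact: wcut_L2|exact: Lwcut_L2].
rewrite /inner.
have E : (fun x => f x * (- l * wcut x + Lwcut x)) \_ `]-1, 1[ = F' \_ `[1 / 2, 1].
  apply/funext => x; rewrite !patchE /wcut /Lwcut.
  have [x1|x1] := boolP (1 / 2 <= x <= 1).
    rewrite [in RHS]mem_set /=; last by rewrite in_itv.
    case: ifPn => [_|].
      by rewrite fE /F' /h; [ring|move: x1; lra].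
    rewrite notin_setE /= in_itv/= => nx.
    have -> : x = 1 by apply: contrapT => x1'; apply: nx; move: x1; have := x1'; lra.
    by rewrite /F' c1 mulr0.
  rewrite (_ : - l * 0 + 0 = 0) ?mulr0; last by ring.
  case: ifPn => _; case: ifPn => //; rewrite inE/= in_itv/= (negPf x1)//.
by rewrite [RHS]Rintegral_mkcond E -Rintegral_mkcond.
Qed.

End BoundaryDerivative.

(** * Zeros of the characteristic function and estimates on boundary derivatives *)

Section SpectralEstimates.
Context {R : realType} (nu : R) (nu_gt0 : 0 < nu) (nu_lt1 : nu < 1).
Context (lam : nat -> R) (phi : nat -> R -> R) (basis : eigenbasis nu lam phi).
Notation mu := (@lebesgue_measure R).
Notation beta n := (left_derivative (phi n) 1).

Lemma lam_ge0 n : 0 <= lam n.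
Proof.
have [l0 linc _ _] := basis.
elim: n => [|n IH]; first by rewrite l0.
exact: le_trans IH (ltW (linc n)).
Qed.

Lemma basis_L2 n : L2 (-1) 1 (phi n).
Proof. by have [_ _ _ []] := basis. Qed.

Lemma basis_ortho m n : inner (-1) 1 (phi m) (phi n) = (m == n)%:R.
Proof. by have [_ _ _ []] := basis. Qed.

(** Both halves have the same energy, [kp ^+ 2] times the modulus of P', so the norm 1 is at most
    twice that; and [beta n = 2 * nu * kp]. *)
Lemma eigenfunction_char n : psum (char_coef nu) (lam n) = 0 /\
  2 * nu ^+ 2 <= `|taylor_coef (char_coef nu) (lam n) 1| * beta n ^+ 2.
Proof.
have [_ _ eig _] := basis.
have [kp [km [fp fm s1 s2]]] := eigenfunction_form nu_gt0 nu_lt1 (eig n).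
set a := bessel nu (lam n) in fp fm s1 s2; set b := bessel (- nu) (lam n) in fp fm s1 s2.
have nrm := norm_le_energy nu_gt0 nu_lt1 (L2_mul_integrable (basis_L2 n) (basis_L2 n)) fp fm.
rewrite basis_ortho eqxx in nrm.
have bE : beta n = 2 * nu * kp.
  by rewrite (left_derivative_comb nu_gt0 nu_lt1 fp) dcomb_at1.
have e0 k : 0 <= energy nu (k * b) (- k * a) (lam n) 1 by exact: energy_ge0.
set D := (nu - 2^-1) * a + (nu + 2^-1) * b in s2.
have PE : psum (char_coef nu) (lam n) = (a - b) * D by rewrite psum_char.
have kk : kp ^+ 2 = km ^+ 2 /\ psum (char_coef nu) (lam n) = 0 /\ 
   kp ^+ 2 * `|taylor_coef (char_coef nu) (lam n) 1| =
     energy nu (kp * b) (- kp * a) (lam n) 1.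
  (* [a = b] is the even case, where [kp = km]; otherwise [km = - kp] and the eigenfunction is
     odd. *)
  have [ab|ab] := eqVneq a b.
    have D0 : D != 0.
      apply/eqP => D0; have := bessel_neq0 nu_gt0 nu_lt1 (lam n).
      have a0 : a = 0.
        have : 2 * nu * a = 0 by rewrite -D0 /D -ab; field.
        by move/eqP; rewrite mulf_eq0 mulf_eq0 (gt_eqF nu_gt0) orbF pnatr_eq0/= => /eqP.
      by rewrite -/a -/b -ab a0 eqxx.
    split.
      by move/eqP: s2; rewrite mulf_eq0 (negPf D0) orbF subr_eq0 => /eqP ->.
    split; first by rewrite PE ab subrr mul0r.
    have := char_derive_even nu_gt0 nu_lt1 kp ab; rewrite -/a -/b => <-.
    rewrite -[RHS]ger0_norm; first by rewrite normrM ger0_norm// sqr_ge0.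
    by rewrite (char_derive_even nu_gt0 nu_lt1 kp ab) e0.
  have kpm : km = - kp.
    move/eqP: s1; rewrite mulf_eq0 subr_eq0 [b == a]eq_sym (negPf ab) orbF addrC addr_eq0.
    by move/eqP.
  (* With [kp = 0] both energies would vanish, against the norm 1. *)
  have [k0|k0] := eqVneq kp 0.
    exfalso; move: nrm; rewrite kpm k0 !(mul0r, oppr0) /energy /comb !mul0r !addr0.
    by rewrite !mul0r subrr addr0 ler10.
  have D0 : D = 0.
    have : (2 * kp) * D = 0 by rewrite -s2 kpm; ring.
    by move/eqP; rewrite mulf_eq0 mulf_eq0 (negPf k0) pnatr_eq0/= => /eqP.
  split; first by rewrite kpm sqrrN.
  split; first by rewrite PE D0 mulr0.
  have := char_derive_odd nu_gt0 nu_lt1 kp D0; rewrite -/a -/b => /(congr1 Num.norm).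
  by rewrite normrM normrN (ger0_norm (sqr_ge0 _)) (ger0_norm (e0 _)).
have [k2 [P0 kE]] := kk; split=> //.
have eE : energy nu (km * b) (- km * a) (lam n) 1 = energy nu (kp * b) (- kp * a) (lam n) 1.
  by rewrite !energy_at1// k2.
move: nrm; rewrite eE -kE bE => nrm.
have -> : `|taylor_coef (char_coef nu) (lam n) 1| * (2 * nu * kp) ^+ 2 =
  2 * nu ^+ 2 * (kp ^+ 2 * `|taylor_coef (char_coef nu) (lam n) 1| +
   kp ^+ 2 * `|taylor_coef (char_coef nu) (lam n) 1|) by ring.
by rewrite ler_peMr// mulr_ge0// sqr_ge0.
Qed.

(** [beta n] is [x - lam n * y] with [x], [y] the coordinates of two fixed functions, so dividing by
    [lam n + 1] leaves a square-summable sequence. Both the admissibility of the control operator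
    and the convergence of the control rest on it. *)
Lemma beta_sum : exists C, forall N,
  \sum_(n < N) (beta n / (lam n + 1)) ^+ 2 <= C.
Proof.
have [_ _ eig _] := basis.
pose L := @Lwcut R nu; pose W := @wcut R.
exists (2 * (inner (-1) 1 L L + inner (-1) 1 W W)) => N.
have h n : (beta n / (lam n + 1)) ^+ 2 <=
    2 * (inner (-1) 1 L (phi n) ^+ 2 + inner (-1) 1 W (phi n) ^+ 2).
  have [kp [km [fp fm s1 s2]]] := eigenfunction_form nu_gt0 nu_lt1 (eig n).
  have f1 : phi n 1 = 0 by have [[? [? [? [? [? [_ _ [_ ->]]]]]]] _ _] := eig n.
  rewrite (left_derivative_comb nu_gt0 nu_lt1 fp).
  rewrite (boundary_derivative nu_gt0 nu_lt1 (basis_L2 n) f1 fp).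
  rewrite ![inner _ _ (phi n) _]innerC -/L -/W.
  set x := inner _ _ L _; set y := inner _ _ W _; have l0 := lam_ge0 n.
  rewrite expr_div_n ler_pdivrMr; last by rewrite exprn_gt0// ltr_wpDl.
  rewrite -subr_ge0.
  have -> : 2 * (x ^+ 2 + y ^+ 2) * (lam n + 1) ^+ 2 - (x - lam n * y) ^+ 2 =
    (x + lam n * y) ^+ 2 + 2 * (lam n) ^+ 2 * x ^+ 2 + 4 * lam n * x ^+ 2 + 2 * y ^+ 2
    + 4 * lam n * y ^+ 2 by ring.
  have a0 := sqr_ge0 x; have b0 := sqr_ge0 y; have c0 := sqr_ge0 (x + lam n * y).
  have d0 := mulr_ge0 (mulr_ge0 (ler0n R 2) (sqr_ge0 (lam n))) a0.
  have h0 := mulr_ge0 (mulr_ge0 (ler0n R 4) l0) a0.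
  have i0 := mulr_ge0 (mulr_ge0 (ler0n R 4) l0) b0.
  have j0 := mulr_ge0 (ler0n R 2) b0.
  exact: addr_ge0 (addr_ge0 (addr_ge0 (addr_ge0 c0 d0) h0) j0) i0.
apply: (@le_trans _ _ (\sum_(n < N)
    2 * (inner (-1) 1 L (phi n) ^+ 2 + inner (-1) 1 W (phi n) ^+ 2))).
  by apply: ler_sum => n _; exact: h.
rewrite -mulr_sumr big_split/= ler_wpM2l// lerD//.
- exact: (bessel_inequality basis_L2 basis_ortho N (Lwcut_L2 nu)).
- exact: (bessel_inequality basis_L2 basis_ortho N (wcut_L2 (R := R))).
Qed.

End SpectralEstimates.

(** * The moment problem *)

Section GevreyMoments.
Context {R : realType}.
Notation mu := (@lebesgue_measure R).
Implicit Types (c : R^nat) (t l m s A M e a b T X : R).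

(** Order 3/2 against 2 leaves j!^(-1/2): the square of the left side is (4 X^2)^j / j! times
    4^(-j), and the first factor is at most exp(4 X^2). *)
Lemma sqrt_fact_geometric X j : 0 <= X ->
  X ^+ j * (Num.sqrt (j`!%:R ^+ 3) / j`!%:R ^+ 2) <= Num.sqrt (expR (4 * X ^+ 2)) * 2^-1 ^+ j :> R.
Proof.
move=> X0; have f0 : 0 < j`!%:R :> R by rewrite ltr0n fact_gt0.
rewrite -ler_sqr ?nnegrE; last 2 first.
- by rewrite mulr_ge0 ?exprn_ge0// divr_ge0 ?sqrtr_ge0// exprn_ge0.
- by rewrite mulr_ge0 ?sqrtr_ge0// exprn_ge0.
rewrite !exprMn !sqr_sqrtr ?expR_ge0 ?exprn_ge0//.
have -> : (X ^+ j) ^+ 2 * (j`!%:R ^+ 3 * j`!%:R ^- 2 ^+ 2) =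
    (4 * X ^+ 2) ^+ j / j`!%:R * (2^-1 ^+ j) ^+ 2.
  have -> : (4 * X ^+ 2) ^+ j = (X ^+ j) ^+ 2 * (2 ^+ j) ^+ 2.
    have -> : 4 * X ^+ 2 = (X * 2) ^+ 2 by ring.
    by rewrite exprAC exprMn exprMn.
  have p0 : 2 ^+ j != 0 :> R by rewrite expf_neq0.
  rewrite [2^-1 ^+ j]exprVn; move: p0 f0; set p := 2 ^+ j; set f := j`!%:R => p0 f0.
  by field; rewrite p0 gt_eqF.
by rewrite ler_wpM2r ?exprn_ge0// exp_term_le// mulr_ge0// exprn_ge0.
Qed.

Definition gevrey_term c a b l t : R^nat :=
  fun j => (-1) ^+ j * taylor_coef c l j.+1 * flat_bump a b j t.

Definition gevrey_sum c a b l t : R := limn (series (gevrey_term c a b l t)).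

(** [K] is chosen before [l], [t] and [e], so that the rate [e] can later be adapted to the length
    of the time interval. *)
Lemma gevrey_term_bound c A M : fact2_bound A M c -> 0 <= M ->
  exists2 K : R, 0 <= K & forall a b l t e j, 0 < e ->
    `|gevrey_term c a b l t j| <=
      geometric (K * (expR e^-1 * expR (e * (M * `|l|)))) 2^-1 j.
Proof.
move=> cb M0; have [D D0 HD] := @flat_bump_bound R.
have A0 := fact2_bound_ge0 cb.
exists (A * M * Num.sqrt (expR (4 * (M * D) ^+ 2))) => [|a b l t e j e0].
  by rewrite !mulr_ge0// sqrtr_ge0.
set E := expR e^-1 * _.
have E0 : 0 <= E by rewrite mulr_ge0 ?expR_ge0.
have f0 : 0 < j`!%:R :> R by rewrite ltr0n fact_gt0.
have tb : `|taylor_coef c l j.+1| <= A * (M ^+ j.+1 / j`!%:R ^+ 2) * E.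
  apply: le_trans (taylor_coef_le l j.+1 cb M0 e0) _; rewrite -/E.
  rewrite ler_wpM2r// ler_wpM2l// ler_wpM2l ?exprn_ge0// lef_pV2 ?posrE ?exprn_gt0 ?ltr0n ?fact_gt0//.
  by rewrite lerXn2r ?nnegrE// ler_nat factS leq_pmull.
rewrite /gevrey_term !normrM normrX normrN normr1 expr1n mul1r.
apply: le_trans (ler_pM (normr_ge0 _) (normr_ge0 _) tb (HD a b j t)) _.
have -> : A * (M ^+ j.+1 / j`!%:R ^+ 2) * E * (D ^+ j * Num.sqrt (j`!%:R ^+ 3)) =
    A * M * E * ((M * D) ^+ j * (Num.sqrt (j`!%:R ^+ 3) / j`!%:R ^+ 2)).
  by rewrite exprS exprMn; ring.
rewrite /geometric/= /GRing.scale/=.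
have -> : A * M * Num.sqrt (expR (4 * (M * D) ^+ 2)) * E * 2^-1 ^+ j =
  A * M * E * (Num.sqrt (expR (4 * (M * D) ^+ 2)) * 2^-1 ^+ j) by ring.
by rewrite ler_wpM2l ?mulr_ge0// sqrt_fact_geometric// mulr_ge0.
Qed.

Lemma half_geometric k : cvgn (series (geometric k (2^-1 : R))) /\
  limn (series (geometric k (2^-1 : R))) = 2 * k.
Proof.
have h : `|2^-1 : R| < 1 by rewrite ger0_norm// invf_lt1// ltr1n.
split; first exact: is_cvg_geometric_series.
rewrite (cvg_lim _ (cvg_geometric_series h))//.
by field; lra.
Qed.

Lemma gevrey_sum_bound c A M : fact2_bound A M c -> 0 <= M ->
  exists2 K : R, 0 <= K & forall a b l e, 0 < e -> forall t,
    [/\ cvgn (series (gevrey_term c a b l t)),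
        `|gevrey_sum c a b l t| <= K * (expR e^-1 * expR (e * (M * `|l|)))
      & forall n, `|series (gevrey_term c a b l t) n| <=
          K * (expR e^-1 * expR (e * (M * `|l|)))].
Proof.
move=> cb M0; have [K K0 HK] := gevrey_term_bound cb M0.
exists (2 * K) => [|a b l e e0 t]; first by rewrite mulr_ge0.
set E := expR e^-1 * _; have E0 : 0 <= E by rewrite mulr_ge0 ?expR_ge0.
have [cg lg] := half_geometric (K * E).
have [cs ls] := series_dominated (fun j => HK a b l t e j e0) cg.
split => //; first by rewrite -mulrA -lg.
move=> n; rewrite -mulrA -lg; apply: le_trans (ler_norm_sum _ _ _) _.
apply: (@le_trans _ _ (series (geometric (K * E) 2^-1) n)).
  by apply: ler_sum => j _; exact: HK.
apply: nondecreasing_cvgn_le => //; apply: nondecreasing_series => j _ _.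
by rewrite /geometric/= mulr_ge0 ?mulr_ge0 ?exprn_ge0.
Qed.

Lemma flat_bump_exp_integral T s j : 0 < T ->
  \int[mu]_(t in `[0, T]) (expR (s * t) * flat_bump (T / 2) T j t) =
  (- s) ^+ j * \int[mu]_(t in `[0, T]) (expR (s * t) * flat_bump (T / 2) T 0 t).
Proof.
move=> T0; pose g j t := expR (s * t) * flat_bump (T / 2) T j t.
have dg i t : is_derive t 1 (g i) (s * g i t + g i.+1 t).
  by apply: derE (derM (expR_scale_is_derive s t) (flat_bump_is_derive _ _ i t)) _; rewrite /g; ring.
have cg i t : {for t, continuous (g i)} by exact: der_cont (dg i t).
have ig i : mu.-integrable `[0, T] (EFin \o g i).
  by apply: segment_integrable => t _; exact: cg.
rewrite -/(g _); elim: j => [|j IH]; first by rewrite expr0 mul1r.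
have := FTC2_is_derive (ltW T0) (fun t _ => dg j t).
have gT : g j T = 0 by rewrite /g flat_bump_vanish ?mulr0//; right.
have g0 : g j 0 = 0.
  by rewrite /g flat_bump_vanish ?mulr0//; left; rewrite divr_ge0// ltW.
rewrite g0 gT subrr.
have isg : mu.-integrable `[0, T] (EFin \o (fun t => s * g j t)).
  exact: (@integrableZl _ _ R mu _ (measurable_itv _) s _ (ig j)).
rewrite (@RintegralD _ _ R mu _ _ _ (measurable_itv _) isg (ig j.+1)).
rewrite (@RintegralZl _ _ R mu _ _ s (measurable_itv _) (ig j)) IH => /(_ _)/eqP.
rewrite addrC addr_eq0 => /(_ _)/eqP -> => [|t _].
  by rewrite exprS; ring.
by apply: cvgD; [apply: cvgM; [exact: cvg_cst|exact: cg]|exact: cg].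
Qed.

Lemma gevrey_moment c A M T l m : fact2_bound A M c -> 0 <= M -> 0 < T ->
  psum c l = 0 -> psum c m = 0 ->
  measurable_fun `[0, T] (gevrey_sum c (T / 2) T l) /\
  \int[mu]_(t in `[0, T]) (expR ((m - l) * t) * gevrey_sum c (T / 2) T l t) =
  if m == l then taylor_coef c l 1 * \int[mu]_(t in `[0, T]) flat_bump (T / 2) T 0 t
  else 0.
Proof.
move=> cb M0 T0 Pl Pm; pose s := m - l.
have [K K0 HK] := gevrey_sum_bound cb M0.
pose S n t := series (gevrey_term c (T / 2) T l t) n.
have cS n : continuous (S n).
  elim: n => [|n IH] t.
    have -> : S 0%N = cst 0 by apply/funext => x; rewrite /S /series/= big_nil.
    exact: cvg_cst.
  have -> : S n.+1 = (fun t => S n t + gevrey_term c (T / 2) T l t n).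
    by apply/funext => x; rewrite /S /series/= big_nat_recr.
  apply: cvgD; first exact: IH.
  by apply: cvgM; [exact: cvg_cst|exact: flat_bump_continuous].
have mS n : measurable_fun `[0, T] (S n).
  by apply: measurable_funTS; exact: continuous_measurable_fun.
have HS := HK (T / 2) T l 1 ltr01.
set B := K * _ in HS.
have B0 : 0 <= B by rewrite !mulr_ge0 ?expR_ge0.
have [mg _] : measurable_fun `[0, T] (gevrey_sum c (T / 2) T l) /\
    \int[mu]_(t in `[0, T]) S n t @[n --> \oo] -->
    \int[mu]_(t in `[0, T]) gevrey_sum c (T / 2) T l t.
  apply: (@bounded_cvg_Rintegral _ _ _ _ _ B) => //.
  - by move=> n t _; have [_ _ HB] := HS t; exact: HB.
  - by move=> t _; have [cv _ _] := HS t; exact: cv.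
split => //.
have cE : continuous (fun t => expR (s * t)).
  by move=> t; exact: der_cont (expR_scale_is_derive s t).
have [_ ci] : measurable_fun `[0, T] (fun t => expR (s * t) * gevrey_sum c (T / 2) T l t) /\
    \int[mu]_(t in `[0, T]) (expR (s * t) * S n t) @[n --> \oo] -->
    \int[mu]_(t in `[0, T]) (expR (s * t) * gevrey_sum c (T / 2) T l t).
  apply: (@bounded_cvg_Rintegral _ _ _ _ _ (expR (`|s| * T) * B)) => //.
  - move=> n; apply: measurable_funM => //.
    by apply: measurable_funTS; exact: continuous_measurable_fun.
  - move=> n t /andP[t0 tT]; have [_ _ HB] := HS t; rewrite normrM ler_pM//; last exact: HB.
    rewrite ger0_norm ?expR_ge0// ler_expR.
    apply: le_trans (ler_norm _) _; rewrite normrM (ger0_norm t0).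
    by rewrite ler_wpM2l.
  - by move=> t _; have [cv _ _] := HS t; apply: cvgM; [exact: cvg_cst|exact: cv].
pose Zs := \int[mu]_(t in `[0, T]) (expR (s * t) * flat_bump (T / 2) T 0 t).
pose d j := taylor_coef c l j.+1.
have SE n : \int[mu]_(t in `[0, T]) (expR (s * t) * S n t) = pseries d s n * Zs.
  rewrite /pseries /S /series/= mulr_suml.
  elim: n => [|n IH].
    under eq_Rintegral do rewrite big_nil mulr0.
    by rewrite big_nil Rintegral_cst ?mul0r//; exact: measurable_itv.
  under eq_Rintegral do rewrite big_nat_recr//= mulrDr.
  rewrite big_nat_recr//=.
  have i1 : mu.-integrable `[0, T] (EFin \o (fun t => expR (s * t) *
     \sum_(0 <= i < n) gevrey_term c (T / 2) T l t i)).
    by apply: segment_integrable => t _; apply: cvgM; [exact: cE|exact: cS].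
  have i2 : mu.-integrable `[0, T] (EFin \o (fun t => expR (s * t) *
     flat_bump (T / 2) T n t)).
    by apply: segment_integrable => t _; apply: cvgM; [exact: cE|exact: flat_bump_continuous].
  have i3 : mu.-integrable `[0, T] (EFin \o (fun t => expR (s * t) *
     gevrey_term c (T / 2) T l t n)).
    apply: segment_integrable => t _; apply: cvgM; first exact: cE.
    by apply: cvgM; [exact: cvg_cst|exact: flat_bump_continuous].
  rewrite (@RintegralD _ _ R mu _ _ _ (measurable_itv _) i1 i3) IH; congr (_ + _).
  transitivity (\int[mu]_(t in `[0, T]) ((-1) ^+ n * d n * (expR (s * t) * flat_bump (T / 2) T n t))).
    by apply: eq_Rintegral => t _; rewrite /gevrey_term /d; ring.
  rewrite (@RintegralZl _ _ R mu _ _ _ (measurable_itv _) i2) flat_bump_exp_integral//.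
  rewrite -/Zs (exprNn s); have : (-1) ^+ n * (-1) ^+ n = 1 :> R by rewrite -exprMn mulrNN mulr1 expr1n.
  move=> h; transitivity ((-1) ^+ n * (-1) ^+ n * (d n * s ^+ n * Zs)); first by ring.
  by rewrite h mul1r.
rewrite -/s; rewrite (_ : (fun n => _) = (fun n => pseries d s n * Zs)) in ci; last first.
  by apply/funext => n; exact: SE.
have A0 := fact2_bound_ge0 cb.
pose E := expR 1^-1 * expR (1 * (M * `|l|)).
have tb : fact2_bound (A * E) M (taylor_coef c l).
  move=> j; apply: le_trans (taylor_coef_le l j cb M0 ltr01) _.
  by rewrite -/E mulrAC.
have db : fact2_bound (A * E * M) M d.
  move=> j; apply: le_trans (tb j.+1) _.
  have -> : A * E * (M ^+ j.+1 / j.+1`!%:R ^+ 2) = A * E * M * (M ^+ j / j.+1`!%:R ^+ 2).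
    by rewrite exprS; ring.
  rewrite ler_wpM2l ?mulr_ge0 ?expR_ge0// ler_wpM2l ?exprn_ge0//.
  rewrite lef_pV2 ?posrE ?exprn_gt0 ?ltr0n ?fact_gt0// lerXn2r ?nnegrE//.
  by rewrite ler_nat factS leq_pmull.
have cd := fact2_cvg (x := s) db M0.
have cdZ : pseries d s n * Zs @[n --> \oo] --> psum d s * Zs.
  by apply: cvgM; [exact: cd|exact: cvg_cst].
rewrite -(cvg_lim _ ci)// (cvg_lim _ cdZ)//.
have [ml|ml] := eqVneq m l.
  have s0 : s = 0 by rewrite /s ml subrr.
  rewrite s0 psum0; congr (_ * _); apply: eq_Rintegral => t _.
  by rewrite s0 mul0r expR0 mul1r.
have s0 : s != 0 by rewrite subr_eq0.
(* This is the Taylor series of P about [l] without its constant term P(l) = 0, hence it equals P(m)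
   = 0. *)
have h : s * psum d s = 0.
  have := pseries_shift_cvg (c := taylor_coef c l) (x := s).
  rewrite taylor_coef0 => /(_ Pl cd) H.
  rewrite -(cvg_lim _ H)// -[limn _]/(psum (taylor_coef c l) s) -(taylorE _ _ cb M0).
  by rewrite /s addrC subrK.
by move/eqP: h; rewrite mulf_eq0 (negPf s0)/= => /eqP ->; rewrite mul0r.
Qed.

End GevreyMoments.

(** * Series with nonnegative terms and weighted Cauchy-Schwarz inequalities *)

Section NonnegativeSeries.
Context {R : realType}.
Implicit Types (a x y w : R^nat) (C e : R).

Lemma bounded_series a C : (forall n, 0 <= a n) ->
  (forall N, \sum_(0 <= n < N) a n <= C) ->
  [/\ cvgn (series a), (\sum_(0 <= n <oo) (a n)%:E)%E = (limn (series a))%:E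
    & limn (series a) <= C].
Proof.
move=> a0 aC.
have ca : cvgn (series a).
  apply: nondecreasing_is_cvgn; first by apply: nondecreasing_series => n _ _.
  by exists C => _ [N _ <-]; exact: aC.
split => //; last by apply: limr_le => //; near=> N; exact: aC.
rewrite -EFin_lim//; congr (limn _); apply/funext => N /=.
by rewrite sumEFin.
Unshelve. all: by end_near. Qed.

Lemma finite_series a : (forall n, 0 <= a n) ->
  (\sum_(0 <= n <oo) (a n)%:E < +oo)%E -> exists C : R, forall N, \sum_(0 <= n < N) a n <= C.
Proof.
move=> a0 fin; exists (fine (\sum_(0 <= n <oo) (a n)%:E)%E) => N.
rewrite -lee_fin fineK; last first.
  by rewrite ge0_fin_numE// nneseries_ge0// => n _ _; rewrite lee_fin.
rewrite -sumEFin; apply: nneseries_lim_ge => n _ _; by rewrite lee_fin.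
Qed.

Lemma series_partial_le a N : (forall n, 0 <= a n) -> cvgn (series a) ->
  \sum_(0 <= n < N) a n <= limn (series a).
Proof.
move=> a0 ca; apply: (nondecreasing_cvgn_le (u_ := series a)) => //.
by apply: nondecreasing_series => n _ _.
Qed.

Lemma sum_cauchy_schwarz x y w N : (forall n, 0 < w n) ->
  (\sum_(0 <= n < N) x n * y n) ^+ 2 <=
  (\sum_(0 <= n < N) x n ^+ 2 / w n) * \sum_(0 <= n < N) w n * y n ^+ 2.
Proof.
move=> w0; set S := \sum_(0 <= n < N) _; set X := \sum_(0 <= n < N) _.
set G := \sum_(0 <= n < N) _.
have G0 : 0 <= G by apply: sumr_ge0 => n _; rewrite mulr_ge0 ?sqr_ge0// ltW.
(* The product is a weighted sum of squares. When [G = 0] it says nothing, but then every [y n] in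
   the sum vanishes. *)
have key : 0 <= G * (G * X - S ^+ 2).
  have -> : G * (G * X - S ^+ 2) =
      \sum_(0 <= n < N) (w n)^-1 * (G * x n - S * (w n * y n)) ^+ 2.
    have -> : G * (G * X - S ^+ 2) = G ^+ 2 * X - 2 * G * S * S + S ^+ 2 * G by ring.
    have -> : G ^+ 2 * X = \sum_(0 <= n < N) G ^+ 2 * (x n ^+ 2 / w n) by rewrite mulr_sumr.
    have -> : 2 * G * S * S = \sum_(0 <= n < N) 2 * G * S * (x n * y n) by rewrite mulr_sumr.
    have -> : S ^+ 2 * G = \sum_(0 <= n < N) S ^+ 2 * (w n * y n ^+ 2) by rewrite mulr_sumr.
    rewrite -sumrB -big_split/=; apply: eq_bigr => n _.
    by field; rewrite gt_eqF.
  by apply: sumr_ge0 => n _; rewrite mulr_ge0 ?sqr_ge0// invr_ge0 ltW.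
have [G1|G1] := ltP 0 G.
  by move: key; rewrite pmulr_rge0// subr_ge0 mulrC.
have GE : G = 0 by apply/eqP; rewrite eq_le G1.
have yn n : (n < N)%N -> y n = 0.
  move=> nN; have : w n * y n ^+ 2 <= 0.
    rewrite -GE /G big_mkord (bigD1 (Ordinal nN))//= lerDl sumr_ge0// => i _.
    by rewrite mulr_ge0 ?sqr_ge0// ltW.
  rewrite pmulr_rle0// => h; apply/eqP; rewrite -sqrf_eq0 eq_le h; exact: sqr_ge0.
suff -> : S = 0 by rewrite GE mulr0 expr0n.
by rewrite /S big_nat big1// => n /andP[_ nN]; rewrite yn// mulr0.
Qed.

Lemma sum_domination x y w N : (forall n, 0 < w n) ->
  \sum_(0 <= n < N) `|x n * y n| <=
  \sum_(0 <= n < N) x n ^+ 2 / w n + \sum_(0 <= n < N) w n * y n ^+ 2.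
Proof.
move=> w0; rewrite -big_split/=; apply: ler_sum => n _.
have key (p q c : R) : 0 <= p * q -> 0 < c -> p * q <= p ^+ 2 / c + c * q ^+ 2.
  move=> pq c0; rewrite -subr_ge0.
  have -> : p ^+ 2 / c + c * q ^+ 2 - p * q = (p - c * q) ^+ 2 / c + p * q.
    by field; rewrite gt_eqF.
  by rewrite addr_ge0// divr_ge0 ?sqr_ge0// ltW.
rewrite normrM -[x n ^+ 2]real_normK ?num_real// -[y n ^+ 2]real_normK ?num_real//.
by apply: key => //; rewrite mulr_ge0.
Qed.

End NonnegativeSeries.

(** * Coordinates of continuous linear forms on the form domain *)

Section DualForms.
Context {R : realType} (nu : R).
Context (lam : nat -> R) (phi : nat -> R -> R) (basis : eigenbasis nu lam phi).
Implicit Types (g : R -> R) (a c : R^nat) (F : (R -> R) -> R).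

Lemma lam1_ge1 n : 1 <= lam n + 1.
Proof. by rewrite lerDr; exact: lam_ge0 basis n. Qed.

Lemma lam1_gt0 n : 0 < lam n + 1.
Proof. exact: lt_le_trans ltr01 (lam1_ge1 n). Qed.

Lemma lam_inj m n : (lam m == lam n) = (m == n).
Proof.
have [_ linc _ _] := basis.
have lt i j : (i < j)%N -> lam i < lam j.
  elim: j => // j IH; rewrite ltnS leq_eqVlt => /predU1P[->//|/IH h].
  exact: lt_trans h (linc j).
have [/lt h|/lt h|->] := ltngtP m n; last by rewrite !eqxx.
  by rewrite lt_eqF.
by rewrite gt_eqF.
Qed.

Lemma sqnorm_half a :
  sqnorm lam 2^-1 a = (\sum_(0 <= n <oo) ((lam n + 1) * a n ^+ 2)%:E)%E.
Proof.
apply: eq_eseriesr => n _; rewrite mulfV// powRr1 ?(ltW (lam1_gt0 n))//.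
by rewrite real_normK ?num_real.
Qed.

Lemma sqnorm_Nhalf a :
  sqnorm lam (- 2^-1) a = (\sum_(0 <= n <oo) (a n ^+ 2 / (lam n + 1))%:E)%E.
Proof.
apply: eq_eseriesr => n _; rewrite mulrN mulfV// powR_inv1 ?(ltW (lam1_gt0 n))//.
by rewrite real_normK ?num_real// mulrC.
Qed.

Let weight_ge0 a n : 0 <= (lam n + 1) * a n ^+ 2.
Proof. by rewrite mulr_ge0 ?sqr_ge0// ltW// lam1_gt0. Qed.

Lemma domApow_bound g : domApow lam phi 2^-1 g -> L2 (-1) 1 g /\
  exists C : R, forall N, \sum_(0 <= n < N) (lam n + 1) * coord phi g n ^+ 2 <= C.
Proof.
move=> [Lg]; rewrite sqnorm_half => fin; split=> //.
by apply: finite_series fin => n; exact: weight_ge0.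
Qed.

Lemma domApow_tail g (C : R) : L2 (-1) 1 g ->
  (forall N, \sum_(0 <= n < N) (lam n + 1) * coord phi g n ^+ 2 <= C) ->
  domApow lam phi 2^-1 g /\ (sqnorm lam 2^-1 (coord phi g) <= C%:E)%E.
Proof.
move=> Lg gC; have [_ E lC] := bounded_series (weight_ge0 (coord phi g)) gC.
by rewrite /domApow sqnorm_half E ltry lee_fin.
Qed.

Lemma coord_sum c N n : coord phi (fun x => \sum_(k < N) c k * phi k x) n =
  if (n < N)%N then c n else 0.
Proof. exact: (inner_sum_coord (basis_L2 basis) (basis_ortho basis)). Qed.

Lemma domApow_sum c N : domApow lam phi 2^-1 (fun x => \sum_(k < N) c k * phi k x) /\
  (sqnorm lam 2^-1 (coord phi (fun x => (\sum_(k < N) c k * phi k x)%R)) <=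
    (\sum_(0 <= k < N) (lam k + 1) * c k ^+ 2)%:E)%E.
Proof.
apply: domApow_tail; first exact: L2_sum (basis_L2 basis) c N.
move=> K; under eq_bigr do rewrite coord_sum.
have h (L : nat) : (N <= L)%N ->
    \sum_(0 <= n < L) (lam n + 1) * (if (n < N)%N then c n else 0) ^+ 2 =
    \sum_(0 <= n < N) (lam n + 1) * c n ^+ 2.
  move=> NL; rewrite (@big_cat_nat _ _ _ N)//= [X in _ + X]big_nat [X in _ + X]big1.
    by rewrite addr0; apply: eq_big_nat => n /andP[_ ->].
  by move=> n /andP[nN _]; rewrite ltnNge nN/= expr0n mulr0.
have [KN|KN] := leqP K N; last by rewrite h// ltnW.
rewrite -(h N)// [leRHS](@big_cat_nat _ _ _ K)//= lerDl sumr_ge0// => n _.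
exact: (weight_ge0 (fun n => if (n < N)%N then c n else 0)).
Qed.

Lemma domApow_basis n : domApow lam phi 2^-1 (phi n).
Proof.
have -> : phi n = fun x => \sum_(k < n.+1) (k == n :> nat)%:R * phi k x.
  apply/funext => x; rewrite big_ord_recr/= eqxx mul1r big1 ?add0r// => i _.
  by rewrite ltn_eqF ?mul0r.
exact: (domApow_sum (fun k => (k == n)%:R) n.+1).1.
Qed.

Lemma dual_sum F c N : dual_half lam phi F ->
  F (fun x => \sum_(k < N) c k * phi k x) = \sum_(0 <= k < N) c k * F (phi k).
Proof.
move=> [lin _]; elim: N => [|N IH].
  rewrite big_nil; have := lin 1 _ _ (domApow_sum c 0).1 (domApow_sum c 0).1.
  have -> : (fun x : R => 1 * (\sum_(k < 0) c k * phi k x) + \sum_(k < 0) c k * phi k x) =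
      (fun x => \sum_(k < 0) c k * phi k x).
    by apply/funext => x; rewrite !big_ord0 mulr0 addr0.
  by rewrite mul1r; lra.
rewrite big_nat_recr//= -IH addrC -lin; last 2 first.
- exact: domApow_basis.
- exact: (domApow_sum c N).1.
by congr F; apply/funext => x; rewrite big_ord_recr/= addrC.
Qed.

(** The Riesz argument on finite sums: with coefficients [F (phi k) / (lam k + 1)] both the value of
    [F] and the bound on the squared norm are the partial sum [S], so continuity gives
    [S ^+ 2 <= C * S]. *)
Lemma dual_coef_bound F : dual_half lam phi F -> exists2 C : R, 0 <= C &
  forall N, \sum_(0 <= n < N) F (phi n) ^+ 2 / (lam n + 1) <= C.
Proof.
move=> dF; have [_ [C HC]] := dF.
exists `|C| => // N; pose c k := F (phi k) / (lam k + 1).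
have [dg sg] := domApow_sum c N.
set S := \sum_(0 <= n < N) _.
have FS : F (fun x => \sum_(k < N) c k * phi k x) = S.
  by rewrite dual_sum//; apply: eq_bigr => k _; rewrite /c expr2 mulrAC.
have gS : \sum_(0 <= k < N) (lam k + 1) * c k ^+ 2 = S.
  by apply: eq_bigr => k _; rewrite /c; field; rewrite gt_eqF// lam1_gt0.
have S0 : 0 <= S by rewrite -gS sumr_ge0.
have := HC _ dg; rewrite FS real_normK ?num_real// => h.
have : ((S ^+ 2)%:E <= (`|C| * S)%:E)%E.
  apply: le_trans h _; rewrite gS in sg.
  apply: (@le_trans _ _ (`|C|%:E * sqnorm lam 2^-1 (coord phi (fun x => (\sum_(k < N) c k * phi k x)%R)))%E).
    apply: lee_wpmul2r; last by rewrite lee_fin ler_norm.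
    by rewrite sqnorm_half nneseries_ge0// => n _ _; rewrite lee_fin.
  by rewrite EFinM lee_wpmul2l// lee_fin.
rewrite lee_fin expr2; have [->//|S1] := eqVneq S 0.
by rewrite ler_pM2r// lt_neqAle eq_sym S1.
Qed.

End DualForms.

(** * Construction of the control *)

Section NullControl.
Context {R : realType} (nu : R) (nu_gt0 : 0 < nu) (nu_lt1 : nu < 1).
Context (lam : nat -> R) (phi : nat -> R -> R) (basis : eigenbasis nu lam phi).
Context (F : (R -> R) -> R) (dF : dual_half lam phi F) (T : R) (T_gt0 : 0 < T).
Notation mu := (@lebesgue_measure R).
Notation beta n := (left_derivative (phi n) 1).
Notation P' n := (taylor_coef (char_coef nu) (lam n) 1).
Implicit Types (t d e : R).

Lemma beta_series : exists C : R, forall N,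
  \sum_(0 <= n < N) (beta n / (lam n + 1)) ^+ 2 <= C.
Proof.
have [C HC] := beta_sum nu_gt0 nu_lt1 basis.
by exists C => N; rewrite big_mkord.
Qed.

Let one_term (a : R^nat) (C : R) n : (forall n, 0 <= a n) ->
  (forall N, \sum_(0 <= n < N) a n <= C) -> a n <= C.
Proof.
move=> a0 /(_ n.+1); rewrite big_nat_recr//=; apply: le_trans.
by rewrite lerDr sumr_ge0.
Qed.

(** P' grows subexponentially, so [beta n] cannot decay exponentially. This allows a factor
    [beta n ^+ 2] to be inserted at small cost and brings the summable sequence of [beta_series]
    into play. *)
Lemma exp_beta_ge e : 0 < e -> exists2 C : R, 0 <= C &
  forall n, 1 <= C * expR (e * (lam n + 1)) * beta n ^+ 2.
Proof.
move=> e0; have [A [M [M0 cb]]] := char_coef_bound nu_gt0 nu_lt1.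
have A0 := fact2_bound_ge0 cb.
pose e1 := e / (M + 1).
have M1 : 0 < M + 1 by rewrite ltr_wpDl.
have e10 : 0 < e1 by rewrite divr_gt0.
have v0 : 0 < 2 * nu ^+ 2 by rewrite mulr_gt0// exprn_gt0.
exists (A * M * expR e1^-1 / (2 * nu ^+ 2)) => [|n].
  by rewrite divr_ge0 ?(ltW v0)// !mulr_ge0// expR_ge0.
have l0 := lam_ge0 basis n.
have [_ h] := eigenfunction_char nu_gt0 nu_lt1 basis n.
have h1 : `|P' n| <= A * M * expR e1^-1 * expR (e * (lam n + 1)).
  apply: le_trans (taylor_coef_le (lam n) 1 cb M0 e10) _.
  rewrite expr1 -[1`!]/1%N expr1n divr1 mulrA ler_wpM2l ?mulr_ge0 ?expR_ge0//.
  rewrite ler_expR ger0_norm//.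
  have h2 : e1 * (M + 1) = e by rewrite /e1 mulfVK// gt_eqF.
  rewrite -h2 -mulrA ler_wpM2l ?(ltW e10)//.
  by apply: ler_pM => //; lra.
rewrite -(ler_pM2l v0) mulr1; apply: le_trans h _.
have -> : 2 * nu ^+ 2 * (A * M * expR e1^-1 / (2 * nu ^+ 2) *
    expR (e * (lam n + 1)) * beta n ^+ 2) =
  A * M * expR e1^-1 * expR (e * (lam n + 1)) * beta n ^+ 2.
  by field; rewrite gt_eqF.
by rewrite ler_wpM2r// sqr_ge0.
Qed.

Let Z := \int[mu]_(t in `[0, T]) flat_bump (T / 2) T 0 t.

Let Z_gt0 : 0 < Z.
Proof.
have lt : T / 2 < T by move: T_gt0; lra.
have sub : `[T / 2, T] `<=` `[0, T].
  by apply: subset_itv; rewrite bnd_simp//; move: T_gt0; lra.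
rewrite /Z (@Rintegral_support _ _ (T / 2) T)//; first exact: flat_bump_integral_gt0.
move=> x; rewrite in_itv/= negb_and -!ltNge => /orP h.
by apply: flat_bump_vanish; case: h => /ltW; [left|right].
Qed.

(** The required moment [F (phi n) / beta n] divided by [P' n * Z], the moment of [theta n] against
    its own exponential. *)
Let alpha n := F (phi n) / (beta n * P' n * Z).
Let theta n t := expR (- (lam n + 1) * t) * gevrey_sum (char_coef nu) (T / 2) T (lam n) t.

Let beta_P_neq0 n : beta n * P' n != 0.
Proof.
have [_ h] := eigenfunction_char nu_gt0 nu_lt1 basis n.
have v0 : 0 < 2 * nu ^+ 2 by rewrite mulr_gt0// exprn_gt0.
have := lt_le_trans v0 h; rewrite mulf_eq0 negb_or; apply: contraTT.
by rewrite negb_and !negbK => /orP[] /eqP ->; rewrite ?normr0 ?expr0n ?(mul0r, mulr0) ltxx.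
Qed.

Let alpha_le : exists2 C : R, 0 <= C & forall n, `|alpha n| <= C * (lam n + 1) ^+ 2.
Proof.
have [C C0 HC] := dual_coef_bound basis dF.
have [B HB] := beta_series.
have sB n : (beta n / (lam n + 1)) ^+ 2 <= B by apply: one_term HB => // k; exact: sqr_ge0.
have B0 : 0 <= B by apply: le_trans (sB 0%N); exact: sqr_ge0.
have sF n : F (phi n) ^+ 2 / (lam n + 1) <= C.
  apply: (one_term (a := fun n => F (phi n) ^+ 2 / (lam n + 1))) HC => k.
  by rewrite divr_ge0 ?sqr_ge0// ltW// (lam1_gt0 basis).
have v0 : 0 < 2 * nu ^+ 2 by rewrite mulr_gt0// exprn_gt0.
have le1 (x : R) : `|x| <= 1 + x ^+ 2.
  rewrite -(real_normK (num_real x)); have := sqr_ge0 (`|x| - 1); have := normr_ge0 x.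
  by rewrite sqrrB1; lra.
exists ((1 + C) * (1 + B) / (2 * nu ^+ 2 * Z)) => [|n].
  by rewrite divr_ge0// ?mulr_ge0 ?addr_ge0// ltW// Z_gt0.
have m1 := lam1_ge1 basis n; have m0 := lam1_gt0 basis n.
have [_ h] := eigenfunction_char nu_gt0 nu_lt1 basis n.
have hF : `|F (phi n)| <= (1 + C) * (lam n + 1).
  apply: le_trans (le1 _) _; have := sF n; rewrite ler_pdivrMr// => h1.
  by rewrite mulrDl mul1r lerD.
have hb : `|beta n| <= (1 + B) * (lam n + 1).
  have -> : beta n = beta n / (lam n + 1) * (lam n + 1) by rewrite mulfVK// gt_eqF.
  rewrite normrM (gtr0_norm m0) ler_pM2r//; apply: le_trans (le1 _) _.
  by rewrite lerD2l.
(* The lower bound on |P'| beta^2 bounds the inverse of [beta n * P' n] by a multiple of |beta n|,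
   which itself grows at most linearly in [lam n + 1]. *)
have hP : `|(beta n * P' n)^-1| <= `|beta n| / (2 * nu ^+ 2).
  rewrite normfV ler_pdivlMr// mulrC ler_pdivrMr ?normr_gt0 ?beta_P_neq0//.
  apply: le_trans h _; rewrite -(real_normK (num_real (beta n))) normrM.
  by rewrite le_eqVlt; apply/orP; left; apply/eqP; ring.
rewrite /alpha invfM mulrA !normrM [`|Z^-1|]ger0_norm ?invr_ge0 ?(ltW Z_gt0)//.
have -> : (1 + C) * (1 + B) / (2 * nu ^+ 2 * Z) * (lam n + 1) ^+ 2 =
  (1 + C) * (lam n + 1) * ((1 + B) * (lam n + 1) / (2 * nu ^+ 2)) / Z.
  by field; rewrite !gt_eqF.
rewrite ler_wpM2r ?invr_ge0 ?(ltW Z_gt0)// ler_pM//.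
by apply: le_trans hP _; rewrite ler_wpM2r// invr_ge0 ltW.
Qed.

Let theta_le : exists2 C : R, 0 <= C &
  forall n t, `|theta n t| <= C * expR (- (3 * T / 8) * (lam n + 1)).
Proof.
have [A [M [M0 cb]]] := char_coef_bound nu_gt0 nu_lt1.
have [K K0 HK] := gevrey_sum_bound cb M0.
have M1 : 0 < M + 1 by rewrite ltr_wpDl.
(* The growth of P then costs at most [T / 8 * (lam n + 1)] in the exponent; of the [T / 2] gained
   from the support of the bump, [3 * T / 8] remains. *)
pose e := T / 8 / (M + 1).
have e0 : 0 < e by rewrite !divr_gt0.
exists (K * expR e^-1) => [|n t]; first by rewrite mulr_ge0// expR_ge0.
have l0 := lam_ge0 basis n.
have [t2|t2] := ltP t (T / 2).
  rewrite /theta (_ : gevrey_sum _ _ _ _ _ = 0) ?mulr0 ?normr0 ?mulr_ge0 ?expR_ge0//.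
  rewrite /gevrey_sum (_ : series _ = cst 0) ?lim_cst//.
  apply/funext => k; rewrite /series/= big1// => j _.
  by rewrite /gevrey_term flat_bump_vanish ?mulr0//; left; exact: ltW.
have [_ h _] := HK (T / 2) T (lam n) e e0 t.
rewrite /theta normrM (ger0_norm (expR_ge0 _)).
apply: le_trans (ler_wpM2l (expR_ge0 _) h) _.
rewrite [X in X <= _](_ : _ = K * expR e^-1 *
    (expR (- (lam n + 1) * t) * expR (e * (M * `|lam n|)))); last by ring.
rewrite ler_wpM2l ?mulr_ge0 ?expR_ge0// -expRD ler_expR (ger0_norm l0).
have h1 : e * (M * lam n) <= T / 8 * (lam n + 1).
  have h2 : e * (M + 1) = T / 8 by rewrite /e mulfVK// gt_eqF.
  rewrite -h2 -mulrA ler_wpM2l ?(ltW e0)//.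
  by apply: ler_pM => //; lra.
have h3 : (lam n + 1) * (T / 2) <= (lam n + 1) * t by rewrite ler_wpM2l//; lra.
by move: h1 h3; rewrite !mulNr; lra.
Qed.

Lemma pow4_exp_le d x : 0 < d -> 0 <= x -> x ^+ 4 * expR (- (d * x)) <= 24 / d ^+ 4.
Proof.
move=> d0 x0; have := exp_term_le 4 (mulr_ge0 (ltW d0) x0).
have -> : 4`! = 24%N by [].
rewrite ler_pdivrMr// exprMn => h.
rewrite expRN ler_pdivlMr ?exprn_gt0// mulrAC ler_pdivrMr ?expR_gt0//.
by rewrite mulrC [24 * _]mulrC.
Qed.

(** Inserting [beta n ^+ 2] spends [T / 8] of the decay [3 * T / 8]. The remaining [T / 4] absorbs a
    fourth power of [lam n + 1]: two from [alpha], two to form the quotient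
    [beta n / (lam n + 1)]. *)
Let term_le : exists2 C : R, 0 <= C &
  forall n t, `|alpha n * theta n t| <= C * (beta n / (lam n + 1)) ^+ 2.
Proof.
have [Ca Ca0 Ha] := alpha_le; have [Ct Ct0 Ht] := theta_le.
have T8 : 0 < T / 8 by rewrite divr_gt0.
have T4 : 0 < T / 4 by rewrite divr_gt0.
have [Ce Ce0 He] := exp_beta_ge T8.
exists (Ca * Ct * Ce * (24 / (T / 4) ^+ 4)) => [|n t].
  by rewrite !mulr_ge0// invr_ge0 exprn_ge0// ltW.
have m0 := lam1_gt0 basis n; set m := lam n + 1 in m0 *.
rewrite normrM; apply: le_trans (ler_pM (normr_ge0 _) (normr_ge0 _) (Ha n) (Ht n t)) _.
rewrite -/m; set E := expR _.
have E0 : 0 <= E by exact: expR_ge0.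
apply: (@le_trans _ _ (Ca * m ^+ 2 * (Ct * E) * (Ce * expR (T / 8 * m) * beta n ^+ 2))).
  by rewrite ler_peMr// ?He// !mulr_ge0// ltW.
have -> : Ca * m ^+ 2 * (Ct * E) * (Ce * expR (T / 8 * m) * beta n ^+ 2) =
    Ca * Ct * Ce * (m ^+ 4 * (E * expR (T / 8 * m))) * (beta n / m) ^+ 2.
  by field; rewrite gt_eqF.
rewrite ler_wpM2r ?sqr_ge0// ler_wpM2l ?mulr_ge0//.
rewrite /E -expRD.
have -> : - (3 * T / 8) * m + T / 8 * m = - (T / 4 * m) by field.
exact: pow4_exp_le T4 (ltW m0).
Qed.

Let moment n m : measurable_fun `[0, T] (theta m) /\
  \int[mu]_(t in `[0, T]) (expR ((lam n + 1) * t) * theta m t) =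
  if n == m then P' m * Z else 0.
Proof.
have [A [M [M0 cb]]] := char_coef_bound nu_gt0 nu_lt1.
have [Pn _] := eigenfunction_char nu_gt0 nu_lt1 basis n.
have [Pm _] := eigenfunction_char nu_gt0 nu_lt1 basis m.
have [mg I] := gevrey_moment cb M0 T_gt0 Pm Pn.
split.
  apply: measurable_funM => //; apply: measurable_funTS; apply: continuous_measurable_fun.
  by move=> t; exact: der_cont (expR_scale_is_derive _ t).
rewrite -(lam_inj basis) -/Z -I; apply: eq_Rintegral => t _.
by rewrite /theta mulrA -expRD; congr (expR _ * _); ring.
Qed.

(** The control comes out bounded, so exchanging sum and integral is bounded convergence, and later
    the modes of the solution are estimated directly by [U]. *)
Lemma null_control : exists (u : R -> R) (U : R),
  [/\ measurable_fun `[0, T] u, forall t, `|u t| <= U &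
    forall n, beta n * \int[mu]_(t in `[0, T]) (expR ((lam n + 1) * t) * u t) = F (phi n)].
Proof.
have [C C0 HC] := term_le; have [B HB] := beta_series.
pose b n : R := C * (beta n / (lam n + 1)) ^+ 2.
have b0 n : 0 <= b n by rewrite mulr_ge0 ?sqr_ge0.
have bC N : \sum_(0 <= n < N) b n <= C * B by rewrite -mulr_sumr ler_wpM2l.
have [cb _ lb] := bounded_series b0 bC.
pose S N t := series (fun n => alpha n * theta n t) N.
pose u t := limn (S ^~ t).
have SB N t : `|S N t| <= C * B.
  apply: le_trans (ler_norm_sum _ _ _) _; apply: le_trans (bC N).
  by apply: ler_sum => n _; exact: HC.
have cS t : S N t @[N --> \oo] --> u t.
  by have [] := series_dominated (fun n => HC n t) cb.
have mS N : measurable_fun `[0, T] (S N).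
  elim: N => [|N IH].
    have -> : S 0%N = cst 0 by apply/funext => x; rewrite /S /series/= big_nil.
    exact: measurable_cst.
  have -> : S N.+1 = (fun t => S N t + alpha N * theta N t).
    by apply/funext => x; rewrite /S /series/= big_nat_recr.
  apply: measurable_funD => //; apply: measurable_funM => //.
  by have [] := moment 0 N.
have uB t : `|u t| <= C * B.
  have [_ h] := series_dominated (fun n => HC n t) cb.
  exact: le_trans h lb.
have cE n : continuous (fun t => expR ((lam n + 1) * t)).
  by move=> t; exact: der_cont (expR_scale_is_derive _ t).
have CB0 : 0 <= C * B by apply: le_trans (uB 0).
have mE n : measurable_fun `[0, T] (fun t => expR ((lam n + 1) * t)).
  by apply: measurable_funTS; exact: continuous_measurable_fun.
have EB n t : 0 <= t <= T -> `|expR ((lam n + 1) * t)| <= expR ((lam n + 1) * T).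
  move=> /andP[_ tT]; rewrite ger0_norm ?expR_ge0// ler_expR ler_wpM2l//.
  exact: ltW (lam1_gt0 basis n).
have [mu_ _] := bounded_cvg_Rintegral mS (fun N t _ => SB N t) (fun t _ => cS t).
exists u, (C * B); split => //.
move=> n.
have [] := @bounded_cvg_Rintegral _ (fun N t => expR ((lam n + 1) * t) * S N t)
  (fun t => expR ((lam n + 1) * t) * u t) 0 T (expR ((lam n + 1) * T) * (C * B)).
- by move=> N; exact: measurable_funM.
- by move=> N t tT; rewrite normrM ler_pM// EB.
- by move=> t _; apply: cvgM; [exact: cvg_cst|exact: cS].
move=> _ cv.
have iterm k : mu.-integrable `[0, T]
    (EFin \o (fun t => expR ((lam n + 1) * t) * theta k t)).
  have [Ct Ct0 Ht] := theta_le.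
  apply: (@bounded_integrable _ _ _ _ (expR ((lam n + 1) * T) * (Ct * expR (- (3 * T / 8) * (lam k + 1))))).
    by apply: measurable_funM => //; have [] := moment 0 k.
  by move=> t tT; rewrite normrM ler_pM// EB.
have iS N : mu.-integrable `[0, T] (EFin \o (fun t => expR ((lam n + 1) * t) * S N t)).
  apply: (@bounded_integrable _ _ _ _ (expR ((lam n + 1) * T) * (C * B))).
    exact: measurable_funM.
  by move=> t tT; rewrite normrM ler_pM// EB.
have SE N : \int[mu]_(t in `[0, T]) (expR ((lam n + 1) * t) * S N t) =
    \sum_(0 <= k < N) alpha k * (if n == k then P' k * Z else 0).
  elim: N => [|N IH].
    rewrite big_nil; under eq_Rintegral do rewrite /S /series/= big_nil mulr0.
    by rewrite Rintegral_cst ?mul0r//; exact: measurable_itv.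
  have ia : mu.-integrable `[0, T]
      (EFin \o (fun t => alpha N * (expR ((lam n + 1) * t) * theta N t))).
    exact: (@integrableZl _ _ R mu _ (measurable_itv _) (alpha N) _ (iterm N)).
  rewrite big_nat_recr//= -IH; have [_ <-] := moment n N.
  rewrite -(@RintegralZl _ _ R mu _ _ (alpha N) (measurable_itv _) (iterm N)).
  rewrite -(@RintegralD _ _ R mu _ _ _ (measurable_itv _) (iS N) ia).
  by apply: eq_Rintegral => t _; rewrite /S /series/= big_nat_recr//=; ring.
have -> : \int[mu]_(t in `[0, T]) (expR ((lam n + 1) * t) * u t) = alpha n * (P' n * Z).
  rewrite -(cvg_lim _ cv)//; apply/cvg_lim => //.
  apply: cvg_near_cst; near=> N.
  have nN : (n < N)%N by near: N; exact: nbhs_infty_gt.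
  rewrite SE big_mkord (bigD1 (Ordinal nN))//= eqxx big1 ?addr0// => k.
  by rewrite -val_eqE/= eq_sym => /negPf ->; rewrite mulr0.
have := beta_P_neq0 n; rewrite mulf_eq0 negb_or => /andP[bn Pn].
by rewrite /alpha; field; rewrite bn Pn gt_eqF.
Unshelve. all: by end_near. Qed.

End NullControl.

(** * Modal construction of the solution *)

Section WeakSolution.
Context {R : realType} (nu : R) (nu_gt0 : 0 < nu) (nu_lt1 : nu < 1).
Context (lam : nat -> R) (phi : nat -> R -> R) (basis : eigenbasis nu lam phi).
Notation mu := (@lebesgue_measure R).
Implicit Types (g u : R -> R) (a c h x y : R^nat) (F : (R -> R) -> R) (s t T U C : R).

(** The head is kept exact and the tail replaced by that of a summable majorant; this serves both
    for remainders of expansions and for continuity in time. *)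
Lemma series_tail_le c h N K : (forall n, 0 <= c n) -> (forall n, 0 <= h n) ->
  (forall n, (N <= n)%N -> c n <= h n) -> cvgn (series h) ->
  \sum_(0 <= n < K) c n <=
  \sum_(0 <= n < N) c n + (limn (series h) - \sum_(0 <= n < N) h n).
Proof.
move=> c0 h0 ch cvh.
have NM : (N <= maxn N K)%N := leq_maxl N K.
apply: (@le_trans _ _ (\sum_(0 <= n < maxn N K) c n)).
  by rewrite [leRHS](@big_cat_nat _ _ _ K)//= ?leq_maxr// lerDl sumr_ge0.
rewrite (@big_cat_nat _ _ _ N)//= lerD2l lerBrDl.
apply: le_trans (series_partial_le (maxn N K) h0 cvh).
rewrite [leRHS](@big_cat_nat _ _ _ N)//= lerD2l.
by apply: ler_sum_nat => n /andP[Nn _]; exact: ch.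
Qed.

(** [F] vanishes on the partial expansions of [g], so [F g] is its value on the remainder, whose
    squared form norm is at most the tail of a convergent series. *)
Lemma dual_eq0_basis F : dual_half lam phi F -> (forall n, F (phi n) = 0) ->
  dual_eq0 lam phi F.
Proof.
move=> dF F0 g dg; have [lin [C HC]] := dF.
have [Lg [B HB]] := domApow_bound basis dg.
pose a n := (lam n + 1) * coord phi g n ^+ 2.
have a0 n : 0 <= a n by rewrite mulr_ge0 ?sqr_ge0// ltW// (lam1_gt0 basis).
have [ca _ _] := bounded_series a0 HB.
pose S N (x : R) := \sum_(k < N) coord phi g k * phi k x.
have key N : F g ^+ 2 <= `|C| * (limn (series a) - series a N).
  pose r (x : R) := (-1) * S N x + g x.
  have LS : L2 (-1) 1 (S N) by exact: L2_sum (basis_L2 basis) _ N.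
  have rE n : coord phi r n = if (n < N)%N then 0 else coord phi g n.
    rewrite /coord inner_linl//; last exact: basis_L2 basis n.
    have := coord_sum basis (coord phi g) N n; rewrite /coord -/(S N) => ->.
    by case: ifP => _; ring.
  have [dr sr] : domApow lam phi 2^-1 r /\
      (sqnorm lam 2^-1 (coord phi r) <= (limn (series a) - series a N)%:E)%E.
    apply: (domApow_tail basis); first exact: L2_lin.
    move=> K; have := @series_tail_le (fun n => (lam n + 1) * coord phi r n ^+ 2) a N K.
    rewrite [X in X + _]big_nat [X in X + _]big1 ?add0r; last first.
      by move=> n /andP[_ nN]; rewrite rE nN expr0n mulr0.
    apply => //.
    - by move=> n; rewrite mulr_ge0 ?sqr_ge0// ltW// (lam1_gt0 basis).
    - by move=> n Nn; rewrite rE ltnNge Nn.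
  have Fr : F r = F g.
    rewrite (lin (-1) _ _ (domApow_sum basis _ N).1 dg) (dual_sum basis)// big1 ?mulr0 ?add0r// => k _.
    by rewrite F0 mulr0.
  rewrite -lee_fin; have := HC r dr; rewrite Fr real_normK ?num_real// => le.
  apply: le_trans le _.
  apply: (@le_trans _ _ (`|C|%:E * sqnorm lam 2^-1 (coord phi r))%E).
    apply: lee_wpmul2r; last by rewrite lee_fin ler_norm.
    rewrite (sqnorm_half basis) nneseries_ge0// => n _ _.
    by rewrite lee_fin mulr_ge0 ?sqr_ge0// ltW// (lam1_gt0 basis).
  by rewrite EFinM lee_wpmul2l// lee_fin.
have cv : `|C| * (limn (series a) - series a N) @[N --> \oo] --> (0 : R).
  have -> : (0 : R) = `|C| * (limn (series a) - limn (series a)) by rewrite subrr mulr0.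
  by apply: cvgMr; apply: cvgB; [exact: cvg_cst|exact: ca].
have : F g ^+ 2 <= 0.
  by rewrite -(cvg_lim _ cv)//; apply: limr_ge; [exact: cvgP cv|near=> N; exact: key].
by rewrite le_eqVlt ltNge sqr_ge0 orbF sqrf_eq0 => /eqP.
Unshelve. all: by end_near. Qed.

(** Duhamel's formula for the scalar equation satisfied by the coordinate [n]. *)
Definition modal F u n t : R := expR (- (lam n + 1) * t) * F (phi n) +
  control_coord phi n *
    \int[mu]_(s in `[0, t]) (expR (- (lam n + 1) * (t - s)) * u s).

Section Modal.
Variables (F : (R -> R) -> R) (u : R -> R) (T U : R).
Hypotheses (dF : dual_half lam phi F) (T_gt0 : 0 < T)
  (mesu : measurable_fun `[0, T] u) (uU : forall t, `|u t| <= U).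

Let exp_mul_integrable (k t : R) : 0 <= t <= T ->
  mu.-integrable `[0, t] (EFin \o (fun s => expR (k * s) * u s)).
Proof.
move=> /andP[t0 tT].
have cE : continuous (fun s => expR (k * s)).
  by move=> s; exact: der_cont (expR_scale_is_derive k s).
apply: (@bounded_integrable _ _ _ _ (expR (`|k| * T) * U)).
  apply: measurable_funM.
    by apply: measurable_funTS; exact: continuous_measurable_fun.
  by apply: measurable_funS mesu => //; apply: subset_itvl; rewrite bnd_simp.
move=> s /andP[s0 st]; rewrite normrM ler_pM//.
rewrite ger0_norm ?expR_ge0// ler_expR (le_trans (ler_norm _))//.
by rewrite normrM (ger0_norm s0) ler_wpM2l// (le_trans st).
Qed.

(** With the exponential out of the convolution the integrand is free of [t]: continuity becomes
    that of a primitive, and the value at [T] involves exactly the moment prescribed by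
    [null_control]. *)
Lemma modalE n t : 0 <= t <= T -> modal F u n t = expR (- (lam n + 1) * t) *
  (F (phi n) + control_coord phi n *
    \int[mu]_(s in `[0, t]) (expR ((lam n + 1) * s) * u s)).
Proof.
move=> tT; rewrite /modal mulrDr; congr (_ + _); rewrite mulrCA; congr (_ * _).
rewrite -(@RintegralZl _ _ R mu _ _ _ (measurable_itv _) (exp_mul_integrable _ tT)).
by apply: eq_Rintegral => s _; rewrite mulrA -expRD; congr (expR _ * _); ring.
Qed.

Let modal_cvg n t : 0 <= t <= T ->
  modal F u n s @[s --> within `[0, T] (nbhs t)] --> modal F u n t.
Proof.
move=> tT; pose J t := \int[mu]_(s in `[0, t]) (expR ((lam n + 1) * s) * u s).
have TT : 0 <= T <= T by rewrite lexx ltW.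
have cJ : {within `[0, T], continuous J}.
  exact: (parameterized_integral_continuous (ltW T_gt0) (exp_mul_integrable (lam n + 1) TT)).
have tI : `[0, T]%classic t by rewrite /= in_itv.
have cJt : J s @[s --> within `[0, T] (nbhs t)] --> J t.
  by move/subspace_continuousP : cJ => /(_ t tI).
have cEt : expR (- (lam n + 1) * s) @[s --> within `[0, T] (nbhs t)] --> expR (- (lam n + 1) * t).
  apply: cvg_within_filter; exact: der_cont (expR_scale_is_derive (- (lam n + 1)) t).
rewrite modalE// -/(J t).
apply: (@cvg_trans _ ((fun s => expR (- (lam n + 1) * s) *
    (F (phi n) + control_coord phi n * J s)) @ within `[0, T] (nbhs t))).
  apply: near_eq_cvg; near=> s; rewrite modalE// -[_ && _]/(s \in `[0, T]).
  near: s; exact: withinT.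
apply: cvgM => //; apply: cvgD; first exact: cvg_cst.
by apply: cvgM => //; exact: cvg_cst.
Unshelve. all: by end_near. Qed.

(** A bounded control makes the convolution at most [U / (lam n + 1)], so each mode is dominated,
    uniformly in time, by a summable sequence. *)
Let modal_sqr n t : 0 <= t <= T -> modal F u n t ^+ 2 / (lam n + 1) <=
  2 * (F (phi n) ^+ 2 / (lam n + 1)) +
  2 * U ^+ 2 * (left_derivative (phi n) 1 / (lam n + 1)) ^+ 2.
Proof.
move=> tT; have /andP[t0 _] := tT.
have m0 := lam1_gt0 basis n; have m1 := lam1_ge1 basis n.
set m := lam n + 1 in m0 m1 *.
pose I := \int[mu]_(s in `[0, t]) (expR (- m * (t - s)) * u s).
have U0 : 0 <= U := le_trans (normr_ge0 _) (uU 0).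
have IE : I = expR (- m * t) * \int[mu]_(s in `[0, t]) (expR (m * s) * u s).
  rewrite -(@RintegralZl _ _ R mu _ _ _ (measurable_itv _) (exp_mul_integrable _ tT)).
  by apply: eq_Rintegral => s _; rewrite mulrA -expRD; congr (expR _ * _); ring.
have Jb : `|\int[mu]_(s in `[0, t]) (expR (m * s) * u s)| <= U / m * expR (m * t).
  have iE := exp_mul_integrable m tT.
  have iEn : mu.-integrable `[0, t] (EFin \o (fun s => `|expR (m * s) * u s|)).
    exact: integrable_norm iE.
  apply: le_trans (@le_normr_Rintegral _ _ R mu _ _ (measurable_itv _) iE) _.
  pose G s := U / m * expR (m * s).
  have dG s : is_derive s 1 G (U * expR (m * s)).
    apply: derE (derZ (U / m) (expR_scale_is_derive m s)) _.
    by field; rewrite gt_eqF.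
  have cG s : {for s, continuous (fun s => U * expR (m * s))}.
    exact: der_cont (derZ U (expR_scale_is_derive m s)).
  have iG : mu.-integrable `[0, t] (EFin \o (fun s => U * expR (m * s))).
    by apply: segment_integrable => s _; exact: cG.
  apply: (@le_trans _ _ (\int[mu]_(s in `[0, t]) (U * expR (m * s)))).
    apply: (@le_Rintegral _ _ R mu _ _ _ (measurable_itv _) iEn iG) => s _.
    by rewrite normrM (ger0_norm (expR_ge0 _)) mulrC ler_wpM2r ?expR_ge0.
  rewrite (FTC2_is_derive t0 (fun s _ => dG s) (fun s _ => cG s)) gerBl /G.
  by rewrite mulr_ge0 ?expR_ge0// divr_ge0// ltW.
have Ib : `|I| <= U / m.
  rewrite IE normrM (ger0_norm (expR_ge0 _)).
  apply: le_trans (ler_wpM2l (expR_ge0 _) Jb) _.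
  by rewrite mulrCA -expRD mulNr addNr expR0 mulr1.
have Fb : `|expR (- m * t) * F (phi n)| <= `|F (phi n)|.
  rewrite normrM (ger0_norm (expR_ge0 _)) ler_piMl// -expR0 ler_expR mulNr oppr_le0.
  by rewrite mulr_ge0// ltW.
have sq (v w : R) : `|v| <= w -> v ^+ 2 <= w ^+ 2.
  move=> vw; rewrite -(real_normK (num_real v)) lerXn2r ?nnegrE//.
  exact: le_trans vw.
have sF := sq _ _ Fb; rewrite real_normK ?num_real// in sF.
have sI := sq _ _ Ib.
rewrite /modal -/m -/I /control_coord.
set b := left_derivative _ _; set p := expR _ * _; set f := F (phi n).
rewrite -/p -/f in sF.
apply: (@le_trans _ _ ((2 * p ^+ 2 + 2 * (b ^+ 2 * I ^+ 2)) / m)).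
  rewrite ler_wpM2r ?invr_ge0 ?(ltW m0)// -subr_ge0.
  have -> : 2 * p ^+ 2 + 2 * (b ^+ 2 * I ^+ 2) - (p + - b * I) ^+ 2 = (p + b * I) ^+ 2 by ring.
  exact: sqr_ge0.
rewrite mulrDl lerD//.
  by rewrite -mulrA ler_wpM2l// ler_wpM2r// invr_ge0 ltW.
apply: (@le_trans _ _ (2 * (b ^+ 2 * (U / m) ^+ 2) / m)).
  rewrite ler_wpM2r ?invr_ge0 ?(ltW m0)// ler_wpM2l// ler_wpM2l// sqr_ge0//.
have -> : 2 * U ^+ 2 * (b / m) ^+ 2 = 2 * (b ^+ 2 * (U / m) ^+ 2) by field; rewrite gt_eqF.
by rewrite ler_pdivrMr// ler_peMr// mulr_ge0// mulr_ge0 ?sqr_ge0.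
Qed.

Let modal_bound : exists2 b : R^nat, (forall n, 0 <= b n) /\ (exists B : R, forall N, \sum_(0 <= n < N) b n <= B) &
  forall n t, 0 <= t <= T -> modal F u n t ^+ 2 / (lam n + 1) <= b n.
Proof.
have [C C0 HC] := dual_coef_bound basis dF.
have [B HB] := beta_series nu_gt0 nu_lt1 basis.
exists (fun n => 2 * (F (phi n) ^+ 2 / (lam n + 1)) +
  2 * U ^+ 2 * (left_derivative (phi n) 1 / (lam n + 1)) ^+ 2); last by move=> n t; exact: modal_sqr.
split=> [n|].
  apply: addr_ge0; last by rewrite mulr_ge0 ?sqr_ge0// mulr_ge0 ?sqr_ge0.
  by rewrite mulr_ge0// divr_ge0 ?sqr_ge0// ltW// (lam1_gt0 basis).
exists (2 * C + 2 * U ^+ 2 * B) => N; rewrite big_split/= -!mulr_sumr lerD//.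
  by rewrite ler_wpM2l.
by rewrite ler_wpM2l// mulr_ge0 ?sqr_ge0.
Qed.

Let pairing_cvg x g : (exists B : R, forall N, \sum_(0 <= n < N) x n ^+ 2 / (lam n + 1) <= B) ->
  domApow lam phi 2^-1 g -> cvgn (series (fun n => x n * coord phi g n)).
Proof.
move=> [B HB] /(domApow_bound basis)[_ [C HC]].
have [cn _ _] := @bounded_series _ (fun n => `|x n * coord phi g n|) (B + C)
  (fun n => normr_ge0 _) (fun N => le_trans (sum_domination x (coord phi g) N (lam1_gt0 basis))
     (lerD (HB N) (HC N))).
exact: normed_cvg cn.
Qed.

Lemma modal_weak_solution : exists f, weak_solution lam phi T F u f.
Proof.
have [b [b0 [B HB]] bB] := modal_bound.
pose x n t := modal F u n t.
have xB t : 0 <= t <= T -> forall N, \sum_(0 <= n < N) x n t ^+ 2 / (lam n + 1) <= B.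
  by move=> tT N; apply: le_trans (HB N); apply: ler_sum => n _; exact: bB.
(* The pairing with the coordinates [x n t]. It converges on the form domain, the only place where
   the conditions on a solution test it. *)
pose f t g := limn (series (fun n => x n t * coord phi g n)).
have fphi t n : f t (phi n) = x n t.
  apply/cvg_lim => //; apply: cvg_near_cst; near=> N.
  have nN : (n < N)%N by near: N; exact: nbhs_infty_gt.
  rewrite /series/= big_mkord (bigD1 (Ordinal nN))//= /coord (basis_ortho basis) eqxx mulr1.
  rewrite big1 ?addr0// => k; rewrite -val_eqE/= (basis_ortho basis) eq_sym => /negPf ->.
  by rewrite mulr0.
have [cb _ lb] := bounded_series b0 HB.
exists f; split; last by move=> n t _; rewrite fphi.
- move=> t; rewrite in_itv/= => tT.
  have cvp g : domApow lam phi 2^-1 g -> cvgn (series (fun n => x n t * coord phi g n)).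
    by apply: pairing_cvg; exists B; exact: xB.
  split=> [k g h dg dh|].
    have [Lg _] := dg; have [Lh _] := dh.
    rewrite /f; have ck : cvgn (series (k *: (fun n => x n t * coord phi g n))).
      exact: is_cvg_seriesZ (cvp g dg).
    rewrite -[k * _]/(k *: _) -lim_seriesZ; last exact: cvp.
    rewrite -lim_seriesD//; last exact: cvp.
    congr (limn (series _)); apply/funext => n /=.
    rewrite /coord inner_linl//; last exact: basis_L2 basis n.
    transitivity (k * (x n t * inner (-1) 1 g (phi n)) + x n t * inner (-1) 1 h (phi n)) => //.
    by rewrite mulrDr mulrCA.
  exists B => g dg; have [Lg [C HC]] := domApow_bound basis dg.
  have w0 n : 0 <= (lam n + 1) * coord phi g n ^+ 2.
    by rewrite mulr_ge0 ?sqr_ge0// ltW// (lam1_gt0 basis).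
  have [cw E _] := bounded_series w0 HC.
  rewrite (sqnorm_half basis) E -EFinM lee_fin real_normK ?num_real//.
  have cv : series (fun n => x n t * coord phi g n) N ^+ 2 @[N --> \oo] --> f t g ^+ 2.
    by rewrite expr2; under eq_fun do rewrite expr2; apply: cvgM; exact: cvp.
  rewrite -(cvg_lim _ cv)//; apply: limr_le; first exact: cvgP cv.
  near=> N; apply: le_trans (sum_cauchy_schwarz _ _ N (lam1_gt0 basis)) _.
  apply: ler_pM; [| |exact: xB|exact: series_partial_le].
    by apply: sumr_ge0 => n _; rewrite divr_ge0 ?sqr_ge0// ltW// (lam1_gt0 basis).
  by apply: sumr_ge0 => n _; exact: w0.
move=> t; rewrite in_itv/= => tT.
pose q s n := (x n s - x n t) ^+ 2 / (lam n + 1).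
have q0 s n : 0 <= q s n by rewrite divr_ge0 ?sqr_ge0// ltW// (lam1_gt0 basis).
(* By (v - w)^2 <= 2 v^2 + 2 w^2 the majorant does not depend on time, so continuity of finitely
   many modes suffices. *)
have qb s n : 0 <= s <= T -> q s n <= 4 * b n.
  have key (v w m B' : R) : 0 < m -> v ^+ 2 / m <= B' -> w ^+ 2 / m <= B' ->
      (v - w) ^+ 2 / m <= 4 * B'.
    move=> m0; rewrite !ler_pdivrMr// => h1 h2.
    have := sqr_ge0 (v + w); rewrite sqrrD sqrrB; lra.
  by move=> sT; apply: key (lam1_gt0 basis n) (bB n s sT) (bB n t tT).
have c4 : cvgn (series (fun n => 4 * b n)) by exact: is_cvg_seriesZ cb.
have b40 n : 0 <= 4 * b n by rewrite mulr_ge0.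
have qN s N K : 0 <= s <= T -> \sum_(0 <= n < K) q s n <= \sum_(0 <= n < N) q s n +
    (limn (series (fun n => 4 * b n)) - series (fun n => 4 * b n) N).
  move=> sT; apply: (series_tail_le K (q0 s) b40 _ c4) => n _; exact: qb.
have qE s N : 0 <= s <= T -> exists2 r : R,
    sqnorm lam (- 2^-1) (fun n => f s (phi n) - f t (phi n)) = r%:E &
    0 <= r <= \sum_(0 <= n < N) q s n +
    (limn (series (fun n => 4 * b n)) - series (fun n => 4 * b n) N).
  move=> sT; have [cq E lq] := bounded_series (q0 s) (fun K => qN s N K sT).
  exists (limn (series (q s))).
    rewrite (sqnorm_Nhalf basis) -E; congr (limn _); apply/funext => K.
    by apply: eq_bigr => n _; rewrite !fphi.
  rewrite lq andbT; apply: limr_ge => //; near=> K; exact: sumr_ge0.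
have qc N : \sum_(0 <= n < N) q s n @[s --> within `[0, T] (nbhs t)] --> (0 : R).
  elim: N => [|N IH]; first by under eq_fun do rewrite big_nil; exact: cvg_cst.
  have h : q s N @[s --> within `[0, T] (nbhs t)] --> (x N t - x N t) * (x N t - x N t) / (lam N + 1).
    rewrite /q; under eq_fun do rewrite expr2.
    have d : x N s - x N t @[s --> within `[0, T] (nbhs t)] --> x N t - x N t.
      by apply: cvgB; [exact: modal_cvg|exact: cvg_cst].
    by apply: cvgM; [exact: cvgM|exact: cvg_cst].
  have -> : (fun s => \sum_(0 <= n < N.+1) q s n) = (fun s => \sum_(0 <= n < N) q s n + q s N).
    by apply/funext => s; rewrite big_nat_recr.
  by have := cvgD IH h; rewrite subrr !mul0r addr0; apply.
have inT : \forall s \near within `[0, T] (nbhs t), 0 <= s <= T.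
  by near=> s; rewrite -[_ && _]/(s \in `[0, T]); near: s; exact: withinT.
apply/fine_cvgP; split.
  near=> s; have sT : 0 <= s <= T by near: s; exact: inT.
  by have [r -> _] := qE s 0%N sT.
apply/cvgrPdist_le => e e0.
have e2 : 0 < e / 2 by rewrite divr_gt0.
have /cvgrPdist_le/(_ _ e2)[N _ /(_ N (leqnn N)) HN] : series (fun n => 4 * b n) @ \oo --> limn (series (fun n => 4 * b n)) by exact: c4.
have /cvgrPdist_le/(_ _ e2) HqN := qc N.
near=> s.
have sT : 0 <= s <= T by near: s; exact: inT.
have [r /= -> /andP[r0 rle]] := qE s N sT.
have : `|0 - \sum_(0 <= n < N) q s n| <= e / 2 by near: s; exact: HqN.
rewrite !sub0r !normrN (ger0_norm r0) ger0_norm ?sumr_ge0// => h.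
have := le_trans (ler_norm _) HN; move: rle h; lra.
Unshelve. all: by end_near. Qed.

End Modal.

End WeakSolution.

Theorem theorem4p13 (R : realType) (nu : R) (nu_gt0 : 0 < nu) (nu_lt1 : nu < 1)
    (lam : nat -> R) (phi : nat -> R -> R) (phi_basis : eigenbasis nu lam phi)
    (f0 : (R -> R) -> R) (f0_dual : dual_half lam phi f0)
    (T : R) (T_gt0 : 0 < T) :
  exists u : R -> R,
    [/\ L2 0 T u,
        exists f : R -> (R -> R) -> R, weak_solution lam phi T f0 u f
      & forall f : R -> (R -> R) -> R,
          weak_solution lam phi T f0 u f -> dual_eq0 lam phi (f T)].
Proof.
have [u [U [mesu uU mom]]] := null_control nu_gt0 nu_lt1 phi_basis f0_dual T_gt0.
have TT : 0 <= T <= T by rewrite lexx ltW.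
exists u; split.
- apply: (@L2_bounded _ 0 T u U); last by move=> t _; exact: uU.
  by apply: measurable_funS mesu => //; exact: subset_itv_oo_cc.
- exact: (modal_weak_solution nu_gt0 nu_lt1 phi_basis f0_dual T_gt0 mesu uU).
(* Any weak solution has Duhamel coordinates at time [T], in which the moment equations cancel the
   free evolution. *)
move=> f [df _ fE].
have TI : T \in `[0, T] by rewrite in_itv.
apply: (dual_eq0_basis phi_basis (df T TI)) => n.
rewrite fE// -/(modal lam phi f0 u n T) (modalE lam phi f0 mesu uU n TT).
by rewrite /control_coord [- left_derivative _ _ * _]mulNr mom subrr mulr0.
Qed.
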